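(* Let $(\overline y,\overline u)\in Y\times U$ be a local solution of the optimal control problem $$\min_{(y,u)\in Y\times U}\ J(y,u)=\frac12\|y-z_d\|_{L^2(\Omega)^N}^2+\frac{\alpha}{2}\|u\|_{L^2(\Omega)^N}^2$$ subject to $$\mu\int_\Omega \varepsilon y:\varepsilon v\,dx+\nu\int_\Omega \mathsf{m}(\varepsilon y):\varepsilon v\,dx=\int_\Omega u\cdot v\,dx\quad\text{for all }v\in Y.$$ Then there exist an adjoint state $p\in Y$ and a multiplier $\lambda\in L^2(\Omega;\mathbb{R}^{N\times N})$ such that $$\mu\int_\Omega \varepsilon \overline y:\varepsilon v\,dx+\nu\int_\Omega \mathsf{m}(\varepsilon \overline y):\varepsilon v\,dx=\int_\Omega \overline u\cdot v\,dx\quad\forall v\in Y,$$ $$\mu\int_\Omega \varepsilon p:\varepsilon v\,dx+\nu\int_\Omega \lambda:\varepsilon v\,dx=\int_\Omega(\overline y-z_d)\cdot v\,dx\quad\forall v\in Y,$$ $$\alpha\overline u+p=0\quad\text{a.e. in }\Omega,$$ $$\lambda=0\quad\text{a.e. in }\{|\varepsilon\overline y|<g\},$$ $$\lambda=\varepsilon p+\frac{g}{|\varepsilon\overline y|^3}(\varepsilon\overline y:\varepsilon p)\,\varepsilon\overline y-g\frac{\varepsilon p}{|\varepsilon\overline y|}\quad\text{a.e. in }\{|\varepsilon\overline y|>g\}.$$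
   Context: $N\in\{2,3\}$; $\Omega\subset\mathbb{R}^N$ is a bounded Lipschitz domain with boundary $\Gamma$; $\mu>0$, $\nu\ge 0$, $g>0$, $\alpha>0$ are constants; $z_d\in L^2(\Omega)^N$. $Y=\{y\in H^1(\Omega)^N:\nabla\cdot y=0\text{ in }\Omega,\ y=0\text{ on }\Gamma\}$ with the $H^1$-norm; $U=L^2(\Omega)^N$. $\varepsilon y=\frac12(\nabla y+\nabla y^T)$; $A:B$ is the Frobenius inner product and $|\cdot|$ the Frobenius norm on $\mathbb{R}^{N\times N}$. $\mathsf{m}(E)=\max(0,|E|-g)\frac{E}{|E|}$ for $E\ne0$, $\mathsf{m}(0)=0$. For each $u\in U$ the constraint equation has a unique solution $y=:S(u)\in Y$. $(\overline y,\overline u)$ is a local solution if $\overline y=S(\overline u)$ and there is $r>0$ with $J(S(\overline u),\overline u)\le J(S(u),u)$ for all $u\in U$ with $\|u-\overline u\|_U\le r$. *)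

(* Defs.v *)
From HB Require Import structures.
From mathcomp Require Import all_boot all_order all_algebra.
From mathcomp Require Import all_classical all_reals all_analysis.

Set Implicit Arguments.
Unset Strict Implicit.
Unset Printing Implicit Defensive.
Import Order.TTheory GRing.Theory Num.Theory.
Import numFieldNormedType.Exports.
Local Open Scope classical_set_scope.
Local Open Scope ring_scope.

(* The sigma-algebra generated by the coordinate maps, as the library does for
   [n.-tuple T]; it is the Borel sigma-algebra. *)
Definition rV_display : measure_display.
Proof. exact: measure_tuple_display default_measure_display. Qed.

Section measurable_rV.
Context {R : realType} {n : nat}.

Definition rV_coord (i : 'I_n) (x : 'rV[R]_n) : R := x ord0 i.

Let rV_set0 : g_sigma_preimage rV_coord set0.
Proof. exact: sigma_algebra0. Qed.

Let rV_setC A : g_sigma_preimage rV_coord A -> g_sigma_preimage rV_coord (~` A).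
Proof. exact: sigma_algebraC. Qed.

Let rV_bigcup (F : (set 'rV[R]_n)^nat) :
  (forall i, g_sigma_preimage rV_coord (F i)) ->
  g_sigma_preimage rV_coord (\bigcup_i (F i)).
Proof. exact: sigma_algebra_bigcup. Qed.

HB.instance Definition _ := @isMeasurable.Build rV_display
  'rV[R]_n (g_sigma_preimage rV_coord) rV_set0 rV_setC rV_bigcup.

Lemma measurable_coord (i : 'I_n) :
  measurable_fun [set: 'rV[R]_n] (fun x : 'rV[R]_n => x ord0 i).
Proof.
move=> _ Y mY; rewrite setTI; apply: sub_sigma_algebra => /=.
rewrite -bigcup_seq/=; exists i => /=; first by rewrite mem_index_enum.
by exists Y => //; rewrite setTI.
Qed.

Lemma measurable_fun_rV d (T : measurableType d) (f : T -> 'rV[R]_n) :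
  (forall i, measurable_fun [set: T] (fun t => f t ord0 i)) ->
  measurable_fun [set: T] f.
Proof.
move=> mf _ A mA; rewrite setTI.
suff H : g_sigma_preimage (fun i => rV_coord i \o f) `<=` measurable.
  by apply: H; rewrite g_sigma_preimage_comp; exists A => //; rewrite setTI.
apply: smallest_sub; first exact: sigma_algebra_measurable.
rewrite -bigcup_seq; apply: bigcup_sub => i _.
by move=> B [C mC <-]; exact: mf.
Qed.

End measurable_rV.

Section lebesgue_rV.
Context {R : realType}.

Definition rV_cons n (z : R * 'rV[R]_n) : 'rV[R]_n.+1 :=
  \row_i oapp (z.2 ord0) z.1 (unlift ord0 i).

Definition rV_uncons n (x : 'rV[R]_n.+1) : R * 'rV[R]_n :=
  (x ord0 ord0, \row_i x ord0 (lift ord0 i)).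

Lemma rV_consK n : cancel (@rV_cons n) (@rV_uncons n).
Proof.
move=> [a v]; congr (_, _); first by rewrite mxE unlift_none.
by apply/rowP => i; rewrite !mxE liftK.
Qed.

Lemma measurable_rV_cons n : measurable_fun setT (@rV_cons n).
Proof.
apply: measurable_fun_rV => i; rewrite /rV_cons.
under eq_fun do rewrite mxE.
case: unliftP => [j|] _ /=; last exact: measurable_fst.
exact: (measurableT_comp (measurable_coord j) measurable_snd).
Qed.

Lemma measurable_rV_uncons n : measurable_fun setT (@rV_uncons n).
Proof.
apply/measurable_fun_pairP; split; first exact: measurable_coord.
apply: measurable_fun_rV => i; rewrite /comp /=.
by under eq_fun do rewrite mxE; exact: measurable_coord.
Qed.

Section cons_measure.
Variables (n : nat) (m : {sigma_finite_measure set 'rV[R]_n -> \bar R}).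

Let mu : {measure set _ -> \bar R} := (@lebesgue_measure R \x m)%E.

Definition cons_measure : set 'rV[R]_n.+1 -> \bar R :=
  pushforward mu (@rV_cons n).

Let mT : {measure set 'rV[R]_n.+1 -> \bar R} :=
  measure_function_pushforward__canonical__measure_function_Measure
    mu (@measurable_rV_cons n).

HB.instance Definition _ := isMeasure.Build _ _ _ cons_measure
  (measure0 mT) (measure_ge0 mT) (@measure_semi_sigma_additive _ _ _ mT).

Lemma cons_measureE (A : set (measurableTypeR R)) (B : set 'rV[R]_n) :
  measurable A -> measurable B ->
  cons_measure (@rV_uncons n @^-1` (A `*` B)) = (lebesgue_measure A * m B)%E.
Proof.
move=> mA mB; rewrite /cons_measure /pushforward -comp_preimage.
have -> : @rV_uncons n \o @rV_cons n = id.
  by apply/funext => z /=; rewrite rV_consK.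
exact: product_measure1E.
Qed.

Let cons_measure_sigma_finite : sigma_finite setT cons_measure.
Proof.
have /sigma_finiteP[F [TF ndF Foo]] := sigma_finiteT (@lebesgue_measure R).
have /sigma_finiteP[G [TG ndG Goo]] := sigma_finiteT m.
exists (fun k => @rV_uncons n @^-1` (F k `*` G k)).
  rewrite -preimage_bigcup (_ : \bigcup_k _ = setT) ?preimage_setT//.
  apply/seteqP; split => // -[x y] _.
  have : setT x /\ setT y by [].
  rewrite TF TG => -[[k _ Fkx] [l _ Gly]]; exists (maxn k l) => //; split.
  - by move: x Fkx; exact/subsetPset/ndF/leq_maxl.
  - by move: y Gly; exact/subsetPset/ndG/leq_maxr.
move=> k; have [mF ?] := Foo k; have [mG ?] := Goo k; split.
  rewrite -[X in measurable X]setTI; apply: measurable_rV_uncons => //.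
  exact: measurableX.
by rewrite cons_measureE// lte_mul_pinfty// ge0_fin_numE.
Qed.

HB.instance Definition _ := @Measure_isSigmaFinite.Build _ _ _ cons_measure
  cons_measure_sigma_finite.

End cons_measure.

(* n-dimensional Lebesgue measure as the n-fold product of the
   one-dimensional one. *)
Fixpoint lebesgue_rV n : {sigma_finite_measure set 'rV[R]_n -> \bar R} :=
  if n is k.+1 then cons_measure (lebesgue_rV k) else \d_(0 : 'rV[R]_0).

End lebesgue_rV.

Lemma lebesgue_rV_box (R : realType) n (a b : 'rV[R]_n) :
  (forall i, a ord0 i <= b ord0 i) ->
  lebesgue_rV n [set x | forall i, a ord0 i <= x ord0 i <= b ord0 i] =
  (\prod_i (b ord0 i - a ord0 i))%:E.
Proof.
have mbox k (c d : 'rV[R]_k) :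
    measurable [set x : 'rV[R]_k | forall i, c ord0 i <= x ord0 i <= d ord0 i].
  rewrite (_ : [set _ | _] = \bigcap_(i in [set: 'I_k])
    ((fun x : 'rV[R]_k => x ord0 i) @^-1` `[c ord0 i, d ord0 i])).
    apply: fin_bigcap_measurable => // i _.
    by rewrite -[X in measurable X]setTI; exact: measurable_coord.
  apply/seteqP; split => x /= h i; first by move=> _; rewrite /= in_itv/=.
  by have := h i I; rewrite /= in_itv/=.
elim: n a b => [a b _|n ih a b ab].
  by rewrite big_ord0 /= diracE mem_set// => -[].
rewrite [X in lebesgue_rV _ X](_ : _ = @rV_uncons R n @^-1` (`[a ord0 ord0, b ord0 ord0] `*`
  [set x : 'rV[R]_n | forall i, (rV_uncons a).2 ord0 i <= x ord0 i
                     <= (rV_uncons b).2 ord0 i])); last first.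
  apply/seteqP; split => x /=.
    by move=> h; split=> [|i]; rewrite ?in_itv/= ?mxE.
  rewrite in_itv/= => -[h0 h] i.
  by case: (unliftP ord0 i) => [j|] ->//; have := h j; rewrite !mxE.
rewrite [LHS](@cons_measureE R n (lebesgue_rV n))//.
rewrite lebesgue_measure_itv/= lte_fin ih; last first.
  by move=> i; rewrite !mxE.
rewrite big_ord_recl EFinM; congr (_ * _)%E.
  have := ab ord0; rewrite le_eqVlt => /predU1P[->|->]; last by rewrite EFinB.
  by rewrite ltxx subrr.
by congr EFin; apply: eq_bigr => i _; rewrite !mxE.
Qed.

Section domains.
Context {R : realType} {N : nat}.
Implicit Types (Omega : set 'rV[R]_N) (x : 'rV[R]_N).

Definition frob m n (A B : 'M[R]_(m, n)) : R := \sum_i \sum_j A i j * B i j.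
Definition frob_norm m n (A : 'M[R]_(m, n)) : R := Num.sqrt (frob A A).

(* In suitable orthonormal coordinates, Omega lies locally below the graph of a
   Lipschitz function phi: e is the vertical unit vector and only the values of
   phi on the hyperplane orthogonal to e matter. *)
Definition lipschitz_boundary Omega : Prop :=
  forall x0, (closure Omega `\` Omega) x0 ->
    exists (e : 'rV[R]_N) (phi : 'rV[R]_N -> R^o) (k : R),
      [/\ frob e e = 1, k.-lipschitz phi &
        \forall x \near x0,
          Omega x <-> frob x e < phi (x - frob x e *: e)].

Definition bounded_lipschitz_domain Omega : Prop :=
  [/\ Omega !=set0, open Omega, connected Omega, bounded_set Omega
    & lipschitz_boundary Omega].

End domains.

Section sobolev.
Context {R : realType} {N : nat} (Omega : set 'rV[R]_N).
Local Notation leb := (@lebesgue_rV R N).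

(* Functions on Omega are represented by functions on the whole space whose
    values outside Omega are irrelevant. *)

Definition L2 m n (f : 'rV[R]_N -> 'M[R]_(m, n)) : Prop :=
  forall i j, ((fun x => f x i j) \_ Omega) \in Lfun leb 2%:E.

Definition L2_dot m n (f g : 'rV[R]_N -> 'M[R]_(m, n)) : R :=
  \int[leb]_(x in Omega) frob (f x) (g x).
Definition L2_norm m n (f : 'rV[R]_N -> 'M[R]_(m, n)) : R :=
  Num.sqrt (L2_dot f f).

Definition partial (j : 'I_N) (phi : 'rV[R]_N -> R^o) : 'rV[R]_N -> R^o :=
  fun x => 'D_(delta_mx ord0 j) phi x.

Definition smooth (phi : 'rV[R]_N -> R^o) : Prop :=
  forall (s : seq 'I_N) x, differentiable (foldr partial phi s) x.

Definition test_function (phi : 'rV[R]_N -> R^o) : Prop :=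
  let supp := closure [set x | phi x != 0] in
  [/\ smooth phi, compact supp & supp `<=` Omega].

(* [G x i j] is the weak derivative of the i-th component in direction j. *)
Definition weak_gradient (y : 'rV[R]_N -> 'rV[R]_N) (G : 'rV[R]_N -> 'M[R]_N) :=
  L2 G /\ forall i j phi, test_function phi ->
    \int[leb]_(x in Omega) (y x ord0 i * partial j phi x) =
    - \int[leb]_(x in Omega) (G x i j * phi x).

Definition H1 (y : 'rV[R]_N -> 'rV[R]_N) : Prop :=
  L2 y /\ exists G, weak_gradient y G.

(* Determined a.e. in Omega when y is in H1. *)
Definition grad (y : 'rV[R]_N -> 'rV[R]_N) : 'rV[R]_N -> 'M[R]_N :=
  xget (fun=> 0) [set G | weak_gradient y G].

Definition H1_norm (y : 'rV[R]_N -> 'rV[R]_N) : R :=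
  Num.sqrt (L2_dot y y + L2_dot (grad y) (grad y)).

(* The condition y = 0 on the boundary, in the sense of traces: y is an H1-limit
   of test fields. *)
Definition H10 (y : 'rV[R]_N -> 'rV[R]_N) : Prop :=
  H1 y /\ exists phi : nat -> 'rV[R]_N -> 'rV[R]_N,
    (forall k i, test_function (fun x => phi k x ord0 i)) /\
    H1_norm (y \- phi k) @[k --> \oo] --> (0 : R).

Definition Y (y : 'rV[R]_N -> 'rV[R]_N) : Prop :=
  H10 y /\ {ae leb, forall x, Omega x -> \tr (grad y x) = 0}.

Definition eps (y : 'rV[R]_N -> 'rV[R]_N) : 'rV[R]_N -> 'M[R]_N :=
  fun x => 2^-1 *: (grad y x + (grad y x)^T).

End sobolev.

Section control_problem.
Context {R : realType} {N : nat} (Omega : set 'rV[R]_N) (mu nu g alpha : R).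
Implicit Types y u z : 'rV[R]_N -> 'rV[R]_N.

Definition mreg (E : 'M[R]_N) : 'M[R]_N :=
  if E == 0 then 0 else (Num.max 0 (frob_norm E - g) / frob_norm E) *: E.

Definition state_equation y u : Prop :=
  forall v, Y Omega v ->
    mu * L2_dot Omega (eps Omega y) (eps Omega v)
    + nu * L2_dot Omega (mreg \o eps Omega y) (eps Omega v)
    = L2_dot Omega u v.

(* y = S(u): the solution operator S enters through its graph, which determines
   y up to null sets. *)
Definition is_state y u : Prop := Y Omega y /\ state_equation y u.

Definition J zd y u : R :=
  2^-1 * L2_norm Omega (y \- zd) ^+ 2 + alpha / 2 * L2_norm Omega u ^+ 2.

Definition local_solution zd ybar ubar : Prop :=
  [/\ L2 Omega ubar, is_state ybar ubar &
    exists2 r : R, 0 < r &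
      forall u y, L2 Omega u -> is_state y u ->
        L2_norm Omega (u \- ubar) <= r -> J zd ybar ubar <= J zd y u].

End control_problem.

(* Main.v *)
(* No regularisation of m is needed. The map m is E minus the projection of E on
   the ball of radius g, so it is monotone, 1-Lipschitz and directionally
   differentiable at every E, with derivative D(E; W) nonlinear in W only where
   |E| = g. For w in Y and h in L2 put f_w(v) = mu (eps w, eps v) +
   nu (D(eps ybar; eps w), eps v) and c(h, w) for the norm of (h, .) - f_w in the
   dual of Y. Comparing ybar with the states of ubar + t h, strong monotonicity
   and optimality give, as t -> 0,
     (ybar - zd, w) + alpha (ubar, h) >= - C c(h, w).
   With w = 0 this says that ubar lies in Y, which yields p = - alpha ubar; since
   L2 is dense in the dual of Y, letting (h, .) tend to f_w yields the variational
   inequality (ybar - zd, w) >= f_w(p) for every w in Y. Off {|eps ybar| = g} the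
   functional f_w(p) is linear in w and defines lambda there; the remaining gap is
   a linear form in w bounded by the L2 norm of eps w on {|eps ybar| = g}, and its
   Riesz representative defines lambda on that set. *)

Require Import Defs.
From mathcomp Require Import all_boot all_order all_algebra.
From mathcomp Require Import all_classical all_reals all_analysis.
From mathcomp Require Import measurable_realfun ring lra.

Set Implicit Arguments.
Unset Strict Implicit.
Unset Printing Implicit Defensive.
Import Order.TTheory GRing.Theory Num.Theory.
Import numFieldNormedType.Exports.
Local Open Scope classical_set_scope.
Local Open Scope ring_scope.

(** * Seminormed Hilbert spaces *)

(** The control-to-state map is never differentiated. For w in Y the functional f_w need not be a
    load in L2, so ybar + t w may fail to be the state of an L2 control; c(h, w) measures this
    defect. Strong monotonicity gives mu |w_t - w| <= c(h, w) + nu r(t), where w_t is the difference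
    quotient of states for ubar + t h and r(t) is the L2 distance between the difference quotient of
    m and D(eps ybar; eps w). As m is 1-Lipschitz, dominated convergence sends r(t) to 0. The
    variational inequality is one-sided and D is only positively homogeneous, but the gap is linear
    in w, so using w and -w bounds it from both sides. Fields are functions, not classes modulo null
    sets, hence the seminormed setting: limits and Riesz representatives are determined up to null
    vectors. A single Riesz lemma, for functionals bounded by the norm of T x where the range of T
    need not be closed, serves for loads, for p, for the density of L2 and for lambda. *)

Record hilbert (R : realType) (V : lmodType R) (S : set V) (b : V -> V -> R) :
    Prop := Hilbert {
  hilbert0 : S 0;
  hilbert_lin : forall a u v, S u -> S v -> S (a *: u + v);
  hilbert_form : forall a u v w, S u -> S v -> S w ->
    b (a *: u + v) w = a * b u w + b v w;
  hilbertC : forall u v, S u -> S v -> b u v = b v u;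
  hilbert_ge0 : forall u, S u -> 0 <= b u u;
  hilbert_complete : forall u_ : nat -> V, (forall n, S (u_ n)) ->
    (forall e, 0 < e -> exists n0, forall m n, (n0 <= m)%N -> (n0 <= n)%N ->
       b (u_ m - u_ n) (u_ m - u_ n) < e) ->
    exists2 u, S u & b (u_ n - u) (u_ n - u) @[n --> \oo] --> (0 : R)
}.

Section hilbert_theory.
Context {R : realType} (V : lmodType R) (S : set V) (b : V -> V -> R).
Hypothesis H : hilbert S b.
Implicit Types u v w : V.

Lemma hilbertZ_in a u : S u -> S (a *: u).
Proof. by move=> Su; rewrite -[_ *: _]addr0; apply: (hilbert_lin H) => //; exact: hilbert0 H. Qed.

Lemma hilbertD_in u v : S u -> S v -> S (u + v).
Proof. by move=> Su Sv; rewrite -[u]scale1r; exact: (hilbert_lin H). Qed.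

Lemma hilbertB_in u v : S u -> S v -> S (u - v).
Proof. by move=> Su Sv; rewrite addrC -scaleN1r; exact: (hilbert_lin H). Qed.

Lemma hilbertDl u v w : S u -> S v -> S w -> b (u + v) w = b u w + b v w.
Proof. by move=> *; rewrite -[u]scale1r (hilbert_form H)// mul1r scale1r. Qed.

Lemma hilbert0l w : S w -> b 0 w = 0.
Proof.
move=> Sw; have S0 := hilbert0 H.
by have := hilbertDl S0 S0 Sw; rewrite addr0 => /eqP; rewrite -subr_eq subrr => /eqP.
Qed.

Lemma hilbertZl a u w : S u -> S w -> b (a *: u) w = a * b u w.
Proof.
move=> Su Sw; have S0 := hilbert0 H.
by rewrite -[_ *: _]addr0 (hilbert_form H)// hilbert0l// addr0.
Qed.

Lemma hilbertBl u v w : S u -> S v -> S w -> b (u - v) w = b u w - b v w.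
Proof. by move=> *; rewrite addrC -scaleN1r (hilbert_form H)// mulN1r addrC. Qed.

Lemma hilbertBr u v w : S u -> S v -> S w -> b w (u - v) = b w u - b w v.
Proof.
by move=> *; rewrite !(hilbertC H (u := w))// ?hilbertBl//; exact: hilbertB_in.
Qed.

Lemma hilbertDr u v w : S u -> S v -> S w -> b w (u + v) = b w u + b w v.
Proof.
by move=> *; rewrite !(hilbertC H (u := w))// ?hilbertDl//; exact: hilbertD_in.
Qed.

Lemma hilbertZr a u w : S u -> S w -> b w (a *: u) = a * b w u.
Proof.
by move=> *; rewrite !(hilbertC H (u := w))// ?hilbertZl//; exact: hilbertZ_in.
Qed.

Lemma hilbert_sqD t u v : S u -> S v ->
  b (u + t *: v) (u + t *: v) = b u u + 2 * t * b u v + t ^+ 2 * b v v.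
Proof.
move=> Su Sv; have Stv := hilbertZ_in t Sv; have S1 := hilbertD_in Su Stv.
rewrite hilbertDl// hilbertDr// hilbertDr// hilbertZl// !hilbertZr//.
by rewrite (hilbertC H (u := v))// hilbertZl//; ring.
Qed.

Lemma hilbert_sqB u v : S u -> S v ->
  b (u - v) (u - v) = b u u - 2 * b u v + b v v.
Proof. by move=> Su Sv; rewrite -scaleN1r hilbert_sqD//; ring. Qed.

(** The discriminant test, degenerate leading coefficient included. It yields Cauchy-Schwarz, and
    with [a = 0] the vanishing of a first variation. *)
Lemma quadratic_ge0 (a c d : R) :
  (forall t, 0 <= a + 2 * t * c + t ^+ 2 * d) -> c ^+ 2 <= a * d.
Proof.
move=> h; have [d0|d0] := eqVneq d 0.
  have [->|c0] := eqVneq c 0; first by rewrite d0; lra.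
  have := h (- (a + 1) / (2 * c)); rewrite d0 mulr0 addr0.
  have -> : 2 * (- (a + 1) / (2 * c)) * c = - (a + 1) by field.
  by move=> ?; lra.
have dp : 0 < d.
  rewrite lt_def d0/=; have h1 := h 1; have h2 := h (-1); have h0 := h 0.
  rewrite leNgt; apply/negP => dn.
  (* If [d < 0], the quadratic is at most -M at this M: since M >= 1, the lower-order terms are at
     most M (|a| + 2|c|), while M^2 |d| >= M (|a| + 2|c| + 1). *)
  pose M := (`|a| + `|c| *+ 2 + 1) / - d + 1.
  have nd : 0 < - d by lra.
  have M1 : 1 <= M by rewrite /M lerDr divr_ge0 ?ltW// !addr_ge0// mulrn_wge0.
  have Md : `|a| + `|c| *+ 2 + 1 <= M * - d.
    rewrite /M mulrDl mul1r divfK ?gt_eqF//; lra.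
  have := h M.
  have ca := ler_norm a; have cc := ler_norm c.
  have : M * (2 * c) <= M * (`|c| *+ 2) by rewrite ler_pM2l; lra.
  have : M * (`|a| + `|c| *+ 2 + 1) <= M * (M * - d) by rewrite ler_pM2l; lra.
  have : `|a| <= M * `|a| by rewrite ler_peMl.
  nra.
have := h (- c / d).
have -> : a + 2 * (- c / d) * c + (- c / d) ^+ 2 * d = (a * d - c ^+ 2) / d by field.
by rewrite pmulr_lge0 ?invr_gt0// subr_ge0.
Qed.

Lemma hilbert_CS u v : S u -> S v -> b u v ^+ 2 <= b u u * b v v.
Proof.
move=> Su Sv; apply: quadratic_ge0 => t; rewrite -hilbert_sqD//.
by apply: (hilbert_ge0 H); apply: hilbertD_in => //; exact: hilbertZ_in.
Qed.

Lemma hilbert_CS_norm u v : S u -> S v ->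
  `|b u v| <= Num.sqrt (b u u) * Num.sqrt (b v v).
Proof.
move=> Su Sv; rewrite -sqrtrM ?(hilbert_ge0 H)// -sqrtr_sqr ler_wsqrtr//.
exact: hilbert_CS.
Qed.

Lemma hilbert_triangle u v : S u -> S v ->
  Num.sqrt (b (u + v) (u + v)) <= Num.sqrt (b u u) + Num.sqrt (b v v).
Proof.
move=> Su Sv; rewrite -[leRHS]ger0_norm ?addr_ge0 ?sqrtr_ge0// -sqrtr_sqr.
apply: ler_wsqrtr; rewrite -[v in leLHS]scale1r hilbert_sqD// sqrrD.
rewrite !sqr_sqrtr ?(hilbert_ge0 H)//.
by have := ler_norm (b u v); have := hilbert_CS_norm Su Sv; lra.
Qed.

Lemma hilbert_cvg (u_ : nat -> V) u v : (forall n, S (u_ n)) -> S u -> S v ->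
  b (u_ n - u) (u_ n - u) @[n --> \oo] --> (0 : R) ->
  b (u_ n) v @[n --> \oo] --> b u v.
Proof.
move=> Su_ Su Sv cv; apply/cvgrPdistC_lt => e e0.
have k0 : 0 < e ^+ 2 / (b v v + 1).
  by rewrite divr_gt0 ?exprn_gt0// ltr_wpDl// (hilbert_ge0 H).
have /cvgrPdistC_lt/(_ _ k0) := cv; apply: filterS => n.
have Sd : S (u_ n - u) by exact: hilbertB_in.
rewrite subr0 ger0_norm ?(hilbert_ge0 H)// -hilbertBl// ltr_pdivlMr; last first.
  by rewrite ltr_wpDl// (hilbert_ge0 H).
move=> lt; rewrite -(@ltr_pXn2r _ 2)// ?nnegrE ?normr_ge0 ?ltW//.
rewrite real_normK ?num_real//; apply: le_lt_trans (hilbert_CS Sd Sv) _.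
apply: le_lt_trans lt; rewrite ler_wpM2l ?(hilbert_ge0 H)//; lra.
Qed.

Lemma hilbert_cvg_sq (u_ : nat -> V) u : (forall n, S (u_ n)) -> S u ->
  b (u_ n - u) (u_ n - u) @[n --> \oo] --> (0 : R) ->
  b (u_ n) (u_ n) @[n --> \oo] --> b u u.
Proof.
move=> Su_ Su cv.
have -> : (fun n => b (u_ n) (u_ n)) =
   (fun n => b (u_ n - u) (u_ n - u) + 2 * b (u_ n) u - b u u).
  by apply/funext => n; rewrite hilbert_sqB//; ring.
rewrite -[X in _ --> X](_ : 0 + 2 * b u u - b u u = _); last by ring.
apply: cvgB; last exact: cvg_cst.
apply: cvgD => //; apply: cvgMr; exact: hilbert_cvg.
Qed.

(* The energy |T x|^2 - 2 l x is minimised over the domain of T: by the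
   parallelogram law the images of a minimising sequence form a Cauchy
   sequence, whose limit represents l. *)
Lemma riesz_pullback (X : lmodType R) (D : set X) (T : X -> V) (l : X -> R)
    (C : R) :
  D 0 -> (forall a x y, D x -> D y -> D (a *: x + y)) ->
  (forall x, D x -> S (T x)) ->
  (forall a x y v, D x -> D y -> S v ->
    b (T (a *: x + y)) v = a * b (T x) v + b (T y) v) ->
  (forall a x y, D x -> D y -> l (a *: x + y) = a * l x + l y) ->
  0 <= C -> (forall x, D x -> l x ^+ 2 <= C * b (T x) (T x)) ->
  exists z, [/\ S z, (forall x, D x -> l x = b z (T x)) &
    exists x_ : nat -> X, (forall n, D (x_ n)) /\
      b (T (x_ n) - z) (T (x_ n) - z) @[n --> \oo] --> (0 : R)].
Proof.
move=> D0 DD ST Tlin llin C0 lC.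
pose F x := b (T x) (T x) - 2 * l x.
have DZ a x : D x -> D (a *: x) by move=> Dx; rewrite -[_ *: _]addr0; exact: DD.
have FE t x y : D x -> D y ->
    F (t *: y + x) = F x + 2 * t * (b (T x) (T y) - l y) + t ^+ 2 * b (T y) (T y).
  move=> Dx Dy; have Dt := DD t _ _ Dy Dx.
  have Sx := ST _ Dx; have Sy := ST _ Dy; have St := ST _ Dt.
  rewrite /F Tlin// (hilbertC H Sy St) (hilbertC H Sx St) !Tlin// llin//.
  by rewrite (hilbertC H Sy Sx); ring.
have Fge x : D x -> - C <= F x.
  move=> Dx; rewrite /F; have q0 := hilbert_ge0 H (ST _ Dx).
  set q := b _ _ in q0 *; have := lC _ Dx; rewrite -/q => lq.
  have [l0|l0] := leP (l x) 0; first by lra.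
  suff : 0 <= q + C - 2 * l x by lra.
  (* Multiply by the conjugate: (C + q)^2 - 4 l^2 = (C - q)^2 + 4 (C q - l^2), and the last bracket
     is nonnegative by hypothesis. *)
  rewrite -(@pmulr_rge0 _ (C + q + 2 * l x)); last by lra.
  have -> : (C + q + 2 * l x) * (q + C - 2 * l x) =
            (C - q) ^+ 2 + 4 * (C * q - l x ^+ 2) by ring.
  by rewrite addr_ge0 ?sqr_ge0// mulr_ge0// subr_ge0.
pose A := [set F x | x in D].
have Ainf : has_inf A.
  by split; [exists (F 0), 0 | exists (- C) => _ [x Dx <-]; exact: Fge].
have /choice [x_ x_P] : forall n : nat, exists x, D x /\ F x < inf A + n.+1%:R^-1.
  move=> n; have n0 : 0 < n.+1%:R^-1 :> R by rewrite invr_gt0.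
  by have [_ [x Dx <-] ?] := inf_adherent n0 Ainf; exists x.
have Dx_ n : D (x_ n) by have [] := x_P n.
have Fmin x : D x -> inf A <= F x.
  by move=> Dx; apply: ge_inf; [exact: Ainf.2 | exists x].
have small (e : R) : 0 < e -> exists n0 : nat, forall n, (n0 <= n)%N -> n.+1%:R^-1 < e.
  move=> e0; have /cvgr_lt /(_ _ e0) [n0 _ hn] := @cvg_harmonic R.
  by exists n0.
have STx_ n := ST _ (Dx_ n).
(* The energy of the midpoint is at least [inf A], so a quarter of this squared distance is at most
   the mean of the two excesses over the infimum. *)
have cau m n : b (T (x_ m) - T (x_ n)) (T (x_ m) - T (x_ n)) <=
    2 * m.+1%:R^-1 + 2 * n.+1%:R^-1.
  have := Fmin _ (DD (2^-1) _ _ (Dx_ n) (DZ 2^-1 _ (Dx_ m))).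
  have : F (2^-1 *: x_ n + 2^-1 *: x_ m) = 
     2^-1 * F (x_ m) + 2^-1 * F (x_ n)
     - 4^-1 * b (T (x_ m) - T (x_ n)) (T (x_ m) - T (x_ n)).
    have E0 : F (2^-1 *: x_ m) = 4^-1 * b (T (x_ m)) (T (x_ m)) - l (x_ m).
      rewrite -[_ *: _]addr0 FE//.
      have T0 v : S v -> b (T 0) v = 0.
        move=> Sv; have := Tlin (-1) 0 0 v D0 D0 Sv.
        by rewrite scaler0 addr0 => ->; ring.
      have l0 : l 0 = 0 by have := llin (-1) 0 0 D0 D0; rewrite scaler0 addr0 => ->; ring.
      have ST0 := ST _ D0.
      by rewrite /F !T0// l0; field.
    rewrite FE ?E0//; last exact: DZ.
    have -> : b (T (2^-1 *: x_ m)) (T (x_ n)) = 2^-1 * b (T (x_ m)) (T (x_ n)).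
      rewrite -[_ *: _]addr0 Tlin //.
      suff -> : b (T 0) (T (x_ n)) = 0 by rewrite addr0.
      have := Tlin (-1) 0 0 _ D0 D0 (ST _ (Dx_ n)).
      by rewrite scaler0 addr0 => ->; ring.
    by rewrite hilbert_sqB // /F; field.
  move=> ->; move: (x_P m).2 (x_P n).2.
  move: (F (x_ m)) (F (x_ n)) (b _ _) (inf A) (m.+1%:R^-1) (n.+1%:R^-1).
  by move=> *; lra.
have cauS (e : R) : 0 < e -> exists n0, forall m n, (n0 <= m)%N -> (n0 <= n)%N ->
    b (T (x_ m) - T (x_ n)) (T (x_ m) - T (x_ n)) < e.
  move=> e0; have [|n0 hn0] := small (e / 4); first by lra.
  exists n0 => m n hm hn; apply: le_lt_trans (cau m n) _.
  move: (hn0 _ hm) (hn0 _ hn); move: (m.+1%:R^-1) (n.+1%:R^-1) => *; lra.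
have [z Sz cz] := hilbert_complete H STx_ cauS.
exists z; split => //; last by exists x_.
move=> x Dx.
(* Perturb the minimising sequence by t x and let n tend to infinity: the excess disappears, and a
   nonnegative quadratic without constant term has no linear term. *)
have key t : 0 <= 0 + 2 * t * (b z (T x) - l x) + t ^+ 2 * b (T x) (T x).
  suff cv : n.+1%:R^-1 + 2 * t * (b (T (x_ n)) (T x) - l x) + t ^+ 2 * b (T x) (T x)
      @[n --> \oo] --> 0 + 2 * t * (b z (T x) - l x) + t ^+ 2 * b (T x) (T x).
    apply: (cvgr_to_ge cv); near=> n.
    have := Fmin _ (DD t _ _ Dx (Dx_ n)); rewrite FE//.
    have := (x_P n).2; move: (n.+1%:R^-1) => h; lra.
  apply: cvgD; last exact: cvg_cst.
  apply: cvgD; first exact: cvg_harmonic.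
  apply: cvgMr; apply: cvgB; last exact: cvg_cst.
  by apply: hilbert_cvg cz => //; exact: ST.
have /quadratic_ge0 := key; rewrite mul0r => h.
have : (b z (T x) - l x) ^+ 2 = 0 by apply/le_anti; rewrite h sqr_ge0.
by move/eqP; rewrite sqrf_eq0 subr_eq0 => /eqP ->.
Unshelve. all: by end_near. Qed.

(** Banach's theorem for a seminorm: Picard iteration from 0 converges, but the limit is fixed only
    up to a null vector. *)
Lemma contraction_fixpoint (T : V -> V) (c : R) :
  (forall u, S u -> S (T u)) -> 0 <= c < 1 ->
  (forall u v, S u -> S v ->
    Num.sqrt (b (T u - T v) (T u - T v)) <= c * Num.sqrt (b (u - v) (u - v))) ->
  exists2 u, S u & b (T u - u) (T u - u) = 0.
Proof.
move=> ST /andP[c0 c1] Tc; pose N u : R := Num.sqrt (b u u).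
pose x n := iter n T 0.
have Sx n : S (x n) by elim: n => [|n ih]; [exact: hilbert0 H | exact: ST].
(* The geometric series bounds the distance of every iterate from the first one; contracting n times
   gives the tail bound [c ^+ n * B]. *)
pose B : R := N (x 1%N - x 0%N) / (1 - c).
have xB n : N (x n - x 0%N) <= B.
  have B0 : 0 <= B by rewrite divr_ge0 ?sqrtr_ge0// subr_ge0 ltW.
  elim: n => [|n ih]; first by rewrite subrr /N hilbert0l ?sqrtr0//; exact: hilbert0 H.
  have -> : x n.+1 - x 0%N = (T (x n) - T (x 0%N)) + (x 1%N - x 0%N).
    by rewrite -[x 1%N]/(T (x 0%N)) addrA subrK.
  apply: le_trans (hilbert_triangle _ _) _.
  - by apply: hilbertB_in; [exact: (Sx n.+1)|exact: (Sx 1%N)].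
  - exact: hilbertB_in.
  apply: (@le_trans _ _ (c * B + N (x 1%N - x 0%N))).
    rewrite lerD2r; apply: le_trans (Tc _ _ _ _) _ => //.
    by rewrite ler_wpM2l.
  have -> : N (x 1%N - x 0%N) = B * (1 - c).
    by rewrite /B divfK// gt_eqF// subr_gt0.
  by rewrite le_eqVlt; apply/orP; left; apply/eqP; ring.
have xc k n : N (x (n + k)%N - x n) <= c ^+ n * B.
  elim: n => [|n ih]; first by rewrite expr0 mul1r.
  by rewrite exprS -mulrA; apply: le_trans (Tc _ _ _ _) _ => //; rewrite ler_wpM2l.
have cau (e : R) : 0 < e -> exists n0, forall m n, (n0 <= m)%N -> (n0 <= n)%N ->
    b (x m - x n) (x m - x n) < e.
  move=> e0.
  have cv : 2 * (c ^+ n * B) @[n --> \oo] --> (0 : R).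
    rewrite -[X in _ --> X](_ : 2 * (0 * B) = _); last by ring.
    apply: cvgMr; apply: cvgMl; apply: cvg_expr; by rewrite ger0_norm.
  have se0 : 0 < Num.sqrt e by rewrite sqrtr_gt0.
  have /cvgr_lt/(_ _ se0) [n0 _ hn0] := cv.
  exists n0 => m p hm hp.
  have Sd i j : S (x i - x j) by exact: hilbertB_in.
  rewrite -(@ltr_sqrt _ _ e)//; apply: le_lt_trans (hn0 n0 (leqnn _)).
  have -> : x m - x p = (x m - x n0) + (-1) *: (x p - x n0).
    by rewrite scaleN1r opprB addrA subrK.
  apply: le_trans (hilbert_triangle _ _) _ => //; first exact: hilbertZ_in.
  rewrite hilbertZl ?hilbertZr//; last exact: hilbertZ_in.
  rewrite mulN1r mulN1r opprK mulr_natl mulr2n lerD//.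
    by rewrite -(subnKC hm); exact: xc.
  by rewrite -(subnKC hp); exact: xc.
have [u Su cu] := hilbert_complete H Sx cau.
exists u => //.
have STu := ST _ Su; have Sd : S (T u - u) by exact: hilbertB_in.
suff N0 : N (T u - u) <= 0.
  rewrite -(sqr_sqrtr (hilbert_ge0 H Sd)) -/(N _).
  have -> : N (T u - u) = 0 by apply/le_anti; rewrite N0 sqrtr_ge0.
  by rewrite expr0n.
have cN : N (x n - u) @[n --> \oo] --> (0 : R).
  by rewrite -(sqrtr0 R); apply: (@continuous_cvg _ _ _ _ _ _ _ _ (@sqrt_continuous R 0)).
have cN1 : c * N (x n - u) + N (x n.+1 - u) @[n --> \oo] --> (0 : R).
  rewrite -[X in _ --> X](_ : c * 0 + 0 = _); last by ring.
  apply: cvgD; first exact: cvgMr.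
  by rewrite (cvg_shiftS (fun n => N (x n - u))).
apply: (cvgr_to_ge cN1); near=> n.
have -> : T u - u = (-1) *: (T (x n) - T u) + (x n.+1 - u).
  by rewrite scaleN1r opprB addrA subrK.
apply: le_trans (hilbert_triangle _ _) _; [|exact: hilbertB_in|].
  by apply: hilbertZ_in; apply: hilbertB_in => //; exact: ST.
rewrite lerD2r hilbertZl ?hilbertZr; try exact/hilbertB_in/STu/ST.
  by rewrite mulN1r mulN1r opprK; exact: Tc.
by apply: hilbertZ_in; apply: hilbertB_in => //; exact: ST.
Unshelve. all: by end_near. Qed.

End hilbert_theory.

(** * Square integrable functions and fields *)

Lemma cvg_sumr (R : realType) (I : Type) (s : seq I) (f : I -> nat -> R) (l : I -> R) :
  (forall i, f i k @[k --> \oo] --> l i) ->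
  \sum_(i <- s) f i k @[k --> \oo] --> \sum_(i <- s) l i.
Proof.
move=> fl; elim: s => [|i s ih].
  under eq_fun do rewrite big_nil.
  by rewrite big_nil; exact: cvg_cst.
under eq_fun do rewrite big_cons.
by rewrite big_cons; apply: cvgD.
Qed.

(** The steps are at most s 2^-k with s = sqrt M, so the tail from k is at most 2 s 2^-k, whose
    square is the stated bound. The sequences v_k -+ 2 s 2^-k are monotone and squeeze v, which
    produces the limit. *)
Lemma geometric_steps_cvg (R : realType) (v : nat -> R) (M : R) :
  (forall k, 4 ^+ k * (v k.+1 - v k) ^+ 2 <= M) ->
  exists l : R, v @ \oo --> l /\ forall k, (v k - l) ^+ 2 <= 4 * 4^-1 ^+ k * M.
Proof.
move=> vM; have M0 : 0 <= M by apply: le_trans (vM 0%N); rewrite expr0 mul1r sqr_ge0.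
pose s : R := Num.sqrt M.
pose e k : R := 2^-1 ^+ k.
have e0 k : 0 < e k by rewrite exprn_gt0// invr_gt0.
have eS k : e k = 2 * e k.+1 by rewrite /e exprS mulrA divff ?mul1r// pnatr_eq0.
have e2 k : e k ^+ 2 * 4 ^+ k = 1.
  by rewrite -exprM mulnC exprM -exprMn (_ : 2^-1 ^+ 2 * 4 = 1) ?expr1n//; field.
have step k : `|v k.+1 - v k| <= s * e k.
  rewrite -(@ler_pXn2r _ 2)// ?nnegrE ?mulr_ge0 ?sqrtr_ge0 ?(ltW (e0 _))//.
  rewrite exprMn sqr_sqrtr// real_normK ?num_real//.
  rewrite -[leLHS]mul1r -(e2 k) -mulrA mulrC ler_wpM2r ?sqr_ge0//.
pose a k := v k - 2 * s * e k; pose b k := v k + 2 * s * e k.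
have nda : nondecreasing_seq a.
  apply/nondecreasing_seqP => k.
  by have := step k; rewrite /a ler_norml eS => /andP[]; lra.
have nib : nonincreasing_seq b.
  apply/nonincreasing_seqP => k.
  by have := step k; rewrite /b ler_norml eS => /andP[]; lra.
have ab k : a k <= b k.
  have : 0 <= s * e k by rewrite mulr_ge0 ?sqrtr_ge0 ?(ltW (e0 _)).
  by rewrite /a /b; lra.
have ca : cvgn a.
  apply: nondecreasing_is_cvgn => //; exists (b 0%N) => _ [k _ <-].
  by apply: le_trans (ab k) _; exact: nib.
have ce : 2 * s * e k @[k --> \oo] --> (0 : R).
  rewrite -[X in _ --> X](mulr0 (2 * s)); apply: cvgMr; apply: cvg_expr.
  by rewrite ger0_norm ?invr_ge0// invf_lt1// ltr1n.
have cv : v @ \oo --> limn a.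
  have -> : v = (fun k => a k + 2 * s * e k) by apply/funext => k; rewrite /a subrK.
  by rewrite -[X in _ --> X]addr0; apply: cvgD.
have cb : b @ \oo --> limn a.
  by rewrite -[X in _ --> X]addr0; apply: cvgD.
exists (limn a); split=> // k.
have h1 := nondecreasing_cvgn_le nda ca k.
have h2 : limn a <= b k.
  by rewrite -(cvg_lim _ cb)//; apply: nonincreasing_cvgn_ge => //; apply/cvg_ex; exists (limn a).
have : `|v k - limn a| <= 2 * s * e k.
  by rewrite ler_norml; move: h1 h2; rewrite /a /b => *; apply/andP; split; lra.
rewrite -(@ler_pXn2r _ 2)// ?nnegrE ?mulr_ge0 ?sqrtr_ge0 ?(ltW (e0 _))//.
rewrite real_normK ?num_real// => /le_trans; apply.
rewrite !exprMn sqr_sqrtr// -exprM mulnC exprM.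
have -> : (2^-1 ^+ 2 : R) = 4^-1 by field.
by rewrite le_eqVlt; apply/orP; left; apply/eqP; ring.
Qed.

Section Lfun2.
Context d (T : measurableType d) (R : realType) (mu : {measure set T -> \bar R}).
Implicit Types f g : T -> R.

Lemma Lfun2P f : f \in Lfun mu 2%:E <->
  measurable_fun setT f /\ mu.-integrable setT (EFin \o (fun x => f x ^+ 2)).
Proof.
split=> [f2|[mf /integrableP[m2 i2]]].
  split; last exact: Lfun2_integrable_sqr.
  by move: f2; rewrite inE => /andP[]; rewrite inE.
rewrite inE/=; apply/andP; split; rewrite inE//=.
rewrite /finite_norm unlock poweR_lty//; move: i2; congr (_ < _)%E.
apply: eq_integral => x _ /=; by rewrite powR_mulrn// normrX.
Qed.

Lemma Lfun2_lin a f g : f \in Lfun mu 2%:E -> g \in Lfun mu 2%:E ->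
  (fun x => a * f x + g x) \in Lfun mu 2%:E.
Proof.
move=> hf hg; have p1 : (1 <= 2%:E :> \bar R)%E by rewrite lee_fin ler1n.
have := @Lfun_submod_closed _ _ _ mu 2%:E p1.
by case=> _ /(_ a f g hf hg).
Qed.

Lemma Lfun2_mul f g : f \in Lfun mu 2%:E -> g \in Lfun mu 2%:E ->
  mu.-integrable setT (EFin \o (fun x => f x * g x)).
Proof. by move=> hf hg; apply/Lfun1_integrable; exact: Lfun2_mul_Lfun1. Qed.

Lemma Lfun2_le f g : measurable_fun setT f -> g \in Lfun mu 2%:E ->
  (forall x, `|f x| <= `|g x|) -> f \in Lfun mu 2%:E.
Proof.
move=> mf hg fg; apply/Lfun2P; split=> //.
have /Lfun2P[mg ig] := hg; apply: le_integrable ig => //.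
  by apply/measurable_EFinP; exact: measurable_funX.
move=> x _ /=; rewrite lee_fin !normrX lerXn2r ?nnegrE//.
Qed.

(** Riesz-Fischer. Along a subsequence with squared steps below 8^-k, the series [h] of the steps
    weighted by 4^k has integral at most sum 2^-k = 2. Where [h] is finite the subsequence converges
    geometrically, with a rate controlled by [h], which integrates to a rate in L2. *)
Lemma Lfun2_complete (u : nat -> T -> R) :
  (forall n, u n \in Lfun mu 2%:E) ->
  (forall e, 0 < e -> exists n0, forall m n, (n0 <= m)%N -> (n0 <= n)%N ->
    \int[mu]_x (u m x - u n x) ^+ 2 < e) ->
  exists2 f, f \in Lfun mu 2%:E &
    \int[mu]_x (u n x - f x) ^+ 2 @[n --> \oo] --> (0 : R).
Proof.
move=> hu cau.
have uB m n : (fun x => u m x - u n x) \in Lfun mu 2%:E.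
  rewrite (_ : (fun _ => _) = (fun x => (-1) * u n x + u m x)).
    exact: Lfun2_lin.
  by apply/funext => x; rewrite mulN1r addrC.
have /choice[N0 hN0] : forall k, exists n0, forall m n, (n0 <= m)%N -> (n0 <= n)%N ->
    \int[mu]_x (u m x - u n x) ^+ 2 < 8^-1 ^+ k.
  by move=> k; apply: cau; rewrite exprn_gt0// invr_gt0.
(* Partial sums make the indices nondecreasing while staying above every [N0 k]. *)
pose nk k := (\sum_(i < k.+1) N0 i)%N.
have nkge k : (N0 k <= nk k)%N by rewrite /nk big_ord_recr leq_addl.
have nkS k : (nk k <= nk k.+1)%N by rewrite /nk [leqRHS]big_ord_recr leq_addr.
pose v k := u (nk k).
have mv k : measurable_fun setT (v k) by have /Lfun2P[] := hu (nk k).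
have vstep k : \int[mu]_x (v k.+1 x - v k x) ^+ 2 <= 8^-1 ^+ k.
  by apply/ltW/hN0; rewrite ?nkge// (leq_trans (nkge k)).
pose hh k x : \bar R := (4 ^+ k * (v k.+1 x - v k x) ^+ 2)%:E.
have hh0 k x : (0 <= hh k x)%E by rewrite lee_fin mulr_ge0 ?sqr_ge0// exprn_ge0.
have mhh k : measurable_fun setT (hh k).
  apply/measurable_EFinP; apply: measurable_funM => //.
  by apply: measurable_funX; exact: measurable_funB.
pose h x := (\sum_(k <oo) hh k x)%E.
have h0 x : (0 <= h x)%E by apply: nneseries_ge0.
have mh : measurable_fun setT h by apply: ge0_emeasurable_sum.
have ih : (\int[mu]_x h x <= 2%:E)%E.
  rewrite integral_nneseries//; apply: lime_le.
    by apply: is_cvg_nneseries => // *; exact: integral_ge0.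
  apply: nearW => n; rewrite big_mkord.
  apply: (@le_trans _ _ (\sum_(k < n) (2^-1 ^+ k)%:E)%E).
    apply: lee_sum => k _; rewrite /hh.
    under eq_integral do rewrite EFinM.
    have iq : mu.-integrable setT (fun x => ((v k.+1 x - v k x) ^+ 2)%:E).
      by have /Lfun2P[] := uB (nk k.+1) (nk k).
    rewrite integralZl//.
    have fq := integrable_fin_num measurableT iq.
    rewrite -(fineK fq) -EFinM lee_fin.
    have -> : (2^-1 ^+ k : R) = 4 ^+ k * 8^-1 ^+ k.
      by rewrite -exprMn; congr (_ ^+ _); field.
    by rewrite ler_wpM2l ?exprn_ge0//; exact: vstep.
  rewrite sumEFin lee_fin.
  suff -> : \sum_(i < n) (2^-1 : R) ^+ i = 2 - 2 * 2^-1 ^+ n.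
    by rewrite gerBl mulr_ge0// exprn_ge0.
  elim: n => [|n ih]; first by rewrite big_ord0 expr0; ring.
  by rewrite big_ord_recr/= ih exprS; field.
have inth : mu.-integrable setT h.
  apply/integrableP; split=> //; under eq_integral do rewrite gee0_abs//.
  by apply: le_lt_trans ih _; rewrite ltry.
pose A := [set x | h x \is a fin_num].
have mA : measurable A by have := emeasurable_fin_num measurableT mh; rewrite setTI.
have vA x : A x -> forall k, 4 ^+ k * (v k.+1 x - v k x) ^+ 2 <= fine (h x).
  move=> Ax k; rewrite -lee_fin fineK//.
  apply: le_trans (nneseries_lim_ge k.+1 _) => [|*]; last exact: hh0.
  by rewrite big_nat_recr//= -[leLHS]add0e leeD2r// sume_ge0.
have /choice[f0 hf0] : forall x, exists l : R, A x -> v ^~ x @ \oo --> l /\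
    forall k, (v k x - l) ^+ 2 <= 4 * 4^-1 ^+ k * fine (h x).
  move=> x; have [Ax|nA] := pselect (A x); last by exists 0.
  by have [l hl] := geometric_steps_cvg (vA _ Ax); exists l.
(* Off the full-measure set [A] the chosen limit is arbitrary; replacing it by 0 makes [f] a
   pointwise limit of measurable functions. *)
pose f := f0 \_ A.
have mf : measurable_fun setT f.
  apply: (@measurable_fun_cvg _ _ _ _ (fun k => v k \_ A)) => [k|x _].
    by apply/(measurable_restrictT _ _).1 => //; exact: measurable_funTS.
  rewrite /f patchE; under eq_fun do rewrite patchE.
  by case: ifPn => [/set_mem/hf0[]//|_]; exact: cvg_cst.
have bnd k x : A x -> (v k x - f x) ^+ 2 <= 4 * 4^-1 ^+ k * fine (h x).
  by move=> Ax; rewrite /f patchE mem_set//; exact: (hf0 _ Ax).2.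
have ihf : mu.-integrable setT (EFin \o (fun x => fine (h x))).
  apply/integrableP; split; first by apply/measurable_EFinP; exact: measurableT_comp.
  apply: le_lt_trans (_ : (\int[mu]_x h x < +oo)%E); last first.
    by apply: le_lt_trans ih _; rewrite ltry.
  apply: ge0_le_integral => //.
    by apply: measurableT_comp => //; apply/measurable_EFinP; exact: measurableT_comp.
  move=> x _ /=; rewrite ger0_norm ?fine_ge0//.
  by case: (h x) (h0 x) => //= r r0; rewrite leey.
have aeA : {ae mu, forall x, A x}.
  by have := integrable_ae measurableT inth; apply: filterS => x /(_ I).
pose I := \int[mu]_x fine (h x).
pose w k := (fun x => v k x - f x) \_ A.
have mw k : measurable_fun setT (w k).
  apply/(measurable_restrictT _ _).1 => //; apply: measurable_funTS.
  exact: measurable_funB.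
have wle k x : w k x ^+ 2 <= 4 * 4^-1 ^+ k * fine (h x).
  rewrite /w patchE; case: ifPn => [/set_mem/bnd//|_].
  by rewrite expr0n/= !mulr_ge0 ?exprn_ge0// ?invr_ge0// fine_ge0.
have ibw k : mu.-integrable setT (EFin \o (fun x => 4 * 4^-1 ^+ k * fine (h x))).
  have := integrableZl measurableT (4 * 4^-1 ^+ k) ihf.
  by apply: eq_integrable => // x _ /=; rewrite -EFinM.
have w2 k : w k \in Lfun mu 2%:E.
  apply/Lfun2P; split=> //; apply: le_integrable (ibw k) => //.
    by apply/measurable_EFinP; exact: measurable_funX.
  move=> x _ /=; rewrite lee_fin !ger0_norm ?sqr_ge0//.
  by apply: le_trans (wle k x); exact: sqr_ge0.
have f2 : f \in Lfun mu 2%:E.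
  have vA2 : v 0%N \_ A \in Lfun mu 2%:E.
    apply: (Lfun2_le _ (hu (nk 0%N))).
      by apply/(measurable_restrictT _ _).1 => //; exact: measurable_funTS.
    by move=> x; rewrite patchE; case: ifPn; rewrite ?normr0.
  rewrite (_ : f = (fun x => (-1) * w 0%N x + (v 0%N \_ A) x)).
    exact: Lfun2_lin.
  apply/funext => x; rewrite /w /f !patchE; case: ifPn => _; last by rewrite mulr0 addr0.
  ring.
exists f => //.
have vf k : \int[mu]_x (v k x - f x) ^+ 2 <= 4 * 4^-1 ^+ k * I.
  have -> : \int[mu]_x (v k x - f x) ^+ 2 = \int[mu]_x (w k x) ^+ 2.
    congr fine; apply: ae_eq_integral => //.
    - by apply/measurable_EFinP; apply: measurable_funX; exact: measurable_funB.
    - by apply/measurable_EFinP; exact: measurable_funX.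
    - by apply: filterS aeA => x Ax _; rewrite /w patchE mem_set.
  rewrite /I -RintegralZl//; apply: le_Rintegral => //.
  by have /Lfun2P[] := w2 k.
have I0 : 0 <= I by apply: Rintegral_ge0 => x _; rewrite fine_ge0.
have fB g1 g2 : g1 \in Lfun mu 2%:E -> g2 \in Lfun mu 2%:E ->
    (fun x => g1 x - g2 x) \in Lfun mu 2%:E.
  move=> h1 h2; rewrite (_ : (fun _ => _) = (fun x => (-1) * g2 x + g1 x)).
    exact: Lfun2_lin.
  by apply/funext => x; rewrite mulN1r addrC.
apply/cvgrPdist_lt => e e0.
have ce : 2 * 8^-1 ^+ k + 8 * 4^-1 ^+ k * I @[k --> \oo] --> (0 : R).
  rewrite -[X in _ --> X](_ : 2 * 0 + 8 * 0 * I = _); last by ring.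
  apply: cvgD; first by apply: cvgMr; apply: cvg_expr; rewrite ger0_norm// invf_lt1// ltr1n.
  apply: cvgMl; apply: cvgMr; apply: cvg_expr.
  by rewrite ger0_norm ?invr_ge0// invf_lt1// ltr1n.
have /cvgr_lt/(_ _ e0)[k _ /(_ k (leqnn _))/= hk] := ce.
exists (nk k) => // n /= hn.
rewrite sub0r normrN ger0_norm; last by apply: Rintegral_ge0 => x _; exact: sqr_ge0.
apply: le_lt_trans hk.
have i1 : mu.-integrable setT (EFin \o (fun x => 2 * (u n x - v k x) ^+ 2)).
  have /Lfun2P[_ i] := uB n (nk k).
  by have := integrableZl measurableT 2 i; apply: eq_integrable => // x _ /=; rewrite -EFinM.
have i2 : mu.-integrable setT (EFin \o (fun x => 2 * (v k x - f x) ^+ 2)).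
  have /Lfun2P[_ i] := fB _ _ (hu (nk k)) f2.
  by have := integrableZl measurableT 2 i; apply: eq_integrable => // x _ /=; rewrite -EFinM.
(* Back from the subsequence to [u]: (a + b)^2 <= 2 a^2 + 2 b^2 through [v k], the first part being
   small by the Cauchy property. *)
apply: (@le_trans _ _ (\int[mu]_x (2 * (u n x - v k x) ^+ 2 + 2 * (v k x - f x) ^+ 2))).
  apply: le_Rintegral => //.
  - by have /Lfun2P[] := fB _ _ (hu n) f2.
  - by have := integrableD measurableT i1 i2; apply: eq_integrable => // x _ /=; rewrite EFinD.
  - move=> x _; rewrite -subr_ge0.
    have -> : 2 * (u n x - v k x) ^+ 2 + 2 * (v k x - f x) ^+ 2 - (u n x - f x) ^+ 2 =
      (u n x - v k x - (v k x - f x)) ^+ 2 by ring.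
    exact: sqr_ge0.
rewrite RintegralD// !RintegralZl//; last 2 first.
- by have /Lfun2P[] := fB _ _ (hu (nk k)) f2.
- by have /Lfun2P[] := uB n (nk k).
apply: lerD.
  rewrite ler_wpM2l//; apply/ltW/hN0; last exact: nkge.
  exact: leq_trans (nkge k) hn.
have -> : 8 * 4^-1 ^+ k * I = 2 * (4 * 4^-1 ^+ k * I) by ring.
by rewrite ler_wpM2l.
Qed.

End Lfun2.

Section Rintegral_sum.
Context d (T : measurableType d) (R : realType) (mu : {measure set T -> \bar R}).
Variables (D : set T) (mD : measurable D).

Lemma integrable_EFin_sum (I : Type) (s : seq I) (F : I -> T -> R) :
  (forall i, mu.-integrable D (EFin \o F i)) ->
  mu.-integrable D (EFin \o (fun x => \sum_(i <- s) F i x)).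
Proof.
move=> hF; have := @integrable_sum _ _ _ mu _ mD _ s xpredT _ (fun i _ => hF i).
by apply: eq_integrable => // x _ /=; rewrite sumEFin.
Qed.

Lemma Rintegral_sum (I : Type) (s : seq I) (F : I -> T -> R) :
  (forall i, mu.-integrable D (EFin \o F i)) ->
  \int[mu]_(x in D) (\sum_(i <- s) F i x) = \sum_(i <- s) \int[mu]_(x in D) F i x.
Proof.
move=> hF; elim: s => [|i s ih].
  under eq_Rintegral do rewrite big_nil.
  by rewrite big_nil Rintegral_cst// mul0r.
under eq_Rintegral do rewrite big_cons.
by rewrite big_cons RintegralD// ?ih//; exact: integrable_EFin_sum.
Qed.

Lemma ae_eq_Rintegral (f g : T -> R) :
  measurable_fun D f -> measurable_fun D g ->
  {ae mu, forall x, D x -> f x = g x} ->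
  \int[mu]_(x in D) f x = \int[mu]_(x in D) g x.
Proof.
move=> mf mg fg; congr fine; apply: ae_eq_integral => //.
- exact/measurable_EFinP.
- exact/measurable_EFinP.
- by apply: filterS fg => x /[apply] ->.
Qed.

Lemma Rintegral_eq0 (f : T -> R) : (forall x, D x -> 0 <= f x) ->
  mu.-integrable D (EFin \o f) -> \int[mu]_(x in D) f x = 0 ->
  {ae mu, forall x, D x -> f x = 0}.
Proof.
move=> f0 intf I0.
have mf := measurable_int _ intf.
have : (\int[mu]_(x in D) `|(EFin \o f) x| = 0)%E.
  rewrite (eq_integral (EFin \o f)); last first.
    by move=> x /set_mem Dx; rewrite gee0_abs// lee_fin f0.
  by rewrite -[LHS]fineK ?[fine _]I0//; exact: integrable_fin_num.
move/(ae_eq_integral_abs mu mD mf); apply: filterS => x /[apply].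
by case.
Qed.

End Rintegral_sum.

Section frobenius.
Context {R : realType} {m n : nat}.
Implicit Types A B C : 'M[R]_(m, n).

Lemma frobC A B : frob A B = frob B A.
Proof. by apply: eq_bigr => i _; apply: eq_bigr => j _; rewrite mulrC. Qed.

Lemma frob_lin a A B C : frob (a *: A + B) C = a * frob A C + frob B C.
Proof.
rewrite /frob mulr_sumr -big_split; apply: eq_bigr => i _ /=.
rewrite mulr_sumr -big_split; apply: eq_bigr => j _ /=.
by rewrite !mxE mulrDl mulrA.
Qed.

Lemma frobZl a A C : frob (a *: A) C = a * frob A C.
Proof. by rewrite -[_ *: _]addr0 frob_lin /frob [X in _ + X]big1 ?addr0// => i _; rewrite big1// => j _; rewrite mxE mul0r. Qed.

Lemma frobDl A B C : frob (A + B) C = frob A C + frob B C.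
Proof. by rewrite -[A]scale1r frob_lin mul1r scale1r. Qed.

Lemma frobBl A B C : frob (A - B) C = frob A C - frob B C.
Proof. by rewrite addrC -scaleN1r frob_lin mulN1r addrC. Qed.

Lemma frobDr A B C : frob C (A + B) = frob C A + frob C B.
Proof. by rewrite !(frobC C) frobDl. Qed.

Lemma frobBr A B C : frob C (A - B) = frob C A - frob C B.
Proof. by rewrite !(frobC C) frobBl. Qed.

Lemma frobZr a A C : frob C (a *: A) = a * frob C A.
Proof. by rewrite !(frobC C) frobZl. Qed.

Lemma frob0l A : frob 0 A = 0.
Proof. by rewrite -(scale0r A) frobZl mul0r. Qed.

Lemma frob_ge0 A : 0 <= frob A A.
Proof. by apply: sumr_ge0 => i _; apply: sumr_ge0 => j _; rewrite -expr2 sqr_ge0. Qed.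

Lemma frob_entry A i j : A i j ^+ 2 <= frob A A.
Proof.
rewrite /frob (bigD1 i)//= (bigD1 j)//= -expr2 -addrA lerDl addr_ge0//.
  by apply: sumr_ge0 => k _; rewrite -expr2 sqr_ge0.
by apply: sumr_ge0 => k _; apply: sumr_ge0 => l _; rewrite -expr2 sqr_ge0.
Qed.

Lemma frob_eq0 A : frob A A = 0 -> A = 0.
Proof.
move=> A0; apply/matrixP => i j; rewrite mxE; apply/eqP.
by rewrite -sqrf_eq0 eq_le sqr_ge0 -A0 frob_entry.
Qed.

Lemma frob_CS A B : frob A B ^+ 2 <= frob A A * frob B B.
Proof.
apply: quadratic_ge0 => t.
have -> : frob A A + 2 * t * frob A B + t ^+ 2 * frob B B =
  frob (t *: B + A) (t *: B + A).
  by rewrite frob_lin !frobDr !frobZr (frobC B A); ring.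
exact: frob_ge0.
Qed.

Lemma frob_normE A : frob_norm A ^+ 2 = frob A A.
Proof. by rewrite sqr_sqrtr// frob_ge0. Qed.

End frobenius.

Section L2.
Context {R : realType} {N : nat} (Omega : set 'rV[R]_N).
Hypothesis mO : measurable Omega.
Local Notation leb := (@lebesgue_rV R N).


Lemma Lfun2_restrictP (f : 'rV[R]_N -> R) : f \_ Omega \in Lfun leb 2%:E <->
  measurable_fun Omega f /\ leb.-integrable Omega (EFin \o (fun x => f x ^+ 2)).
Proof.
have E : (EFin \o (fun x => f x ^+ 2)) \_ Omega = EFin \o (fun x => (f \_ Omega) x ^+ 2).
  by apply/funext => x /=; rewrite !patchE; case: ifPn => //=; rewrite expr0n.
split=> [/Lfun2P[mf if2]|[mf if2]].
  split; first exact/(measurable_restrictT _ _).2.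
  by apply/integrable_mkcond => //; rewrite E.
apply/Lfun2P; split; first exact/(measurable_restrictT _ _).1.
by rewrite -E; move/integrable_mkcond : if2; exact.
Qed.

Lemma Lfun2_restrict_mul (f g : 'rV[R]_N -> R) :
  f \_ Omega \in Lfun leb 2%:E -> g \_ Omega \in Lfun leb 2%:E ->
  leb.-integrable Omega (EFin \o (fun x => f x * g x)).
Proof.
move=> hf hg; apply/integrable_mkcond => //; have := Lfun2_mul hf hg.
apply: eq_integrable => // x _ /=; rewrite !patchE.
by case: ifPn => //; rewrite mul0r.
Qed.

Section matrix_valued.
Context {m n : nat}.
Implicit Types f g h : 'rV[R]_N -> 'M[R]_(m, n).

Lemma L2_measurable f i j : L2 Omega f -> measurable_fun Omega (fun x => f x i j).
Proof. by move=> /(_ i j)/Lfun2_restrictP[]. Qed.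

Lemma frob_integrable f g : L2 Omega f -> L2 Omega g ->
  leb.-integrable Omega (EFin \o (fun x => frob (f x) (g x))).
Proof.
move=> hf hg; rewrite /frob.
apply: (@integrable_EFin_sum _ _ _ _ _ mO _ _ (fun i x => \sum_j f x i j * g x i j)) => // i.
apply: (@integrable_EFin_sum _ _ _ _ _ mO _ _ (fun j x => f x i j * g x i j)) => // j.
exact: Lfun2_restrict_mul.
Qed.

Lemma L2_dotE f g : L2 Omega f -> L2 Omega g ->
  L2_dot Omega f g = \sum_i \sum_j \int[leb]_(x in Omega) (f x i j * g x i j).
Proof.
move=> hf hg; rewrite /L2_dot /frob.
rewrite (@Rintegral_sum _ _ _ _ _ mO _ _ (fun i x => \sum_j f x i j * g x i j)).
  apply: eq_bigr => i _.
  rewrite (@Rintegral_sum _ _ _ _ _ mO _ _ (fun j x => f x i j * g x i j))// => j.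
  exact: Lfun2_restrict_mul.
move=> i; apply: (@integrable_EFin_sum _ _ _ _ _ mO _ _ (fun j x => f x i j * g x i j)) => // j.
exact: Lfun2_restrict_mul.
Qed.

Lemma measurable_frob f g : (forall i j, measurable_fun Omega (fun x => f x i j)) ->
  (forall i j, measurable_fun Omega (fun x => g x i j)) ->
  measurable_fun Omega (fun x => frob (f x) (g x)).
Proof.
move=> mf mg; apply: measurable_sum => i; apply: measurable_sum => j.
exact: measurable_funM.
Qed.

End matrix_valued.

Lemma L2_le m n p q (f : 'rV[R]_N -> 'M[R]_(m, n)) (g : 'rV[R]_N -> 'M[R]_(p, q)) :
  (forall i j, measurable_fun Omega (fun x => f x i j)) ->
  L2 Omega g -> (forall x, Omega x -> frob (f x) (f x) <= frob (g x) (g x)) ->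
  L2 Omega f.
Proof.
move=> mf hg fg i j; apply/Lfun2_restrictP; split=> //.
apply: le_integrable (frob_integrable hg hg) => //.
  by apply/measurable_EFinP; exact: measurable_funX.
move=> x Ox /=; rewrite lee_fin !ger0_norm ?sqr_ge0 ?frob_ge0//.
by apply: le_trans (fg _ Ox); exact: frob_entry.
Qed.


Section hilbert_structure.
Context {m n : nat}.
Implicit Types f g h : 'rV[R]_N -> 'M[R]_(m, n).

Lemma L2_0 : L2 Omega (0 : 'rV[R]_N -> 'M[R]_(m, n)).
Proof.
move=> i j; rewrite (_ : _ \_ _ = cst 0).
  apply/Lfun2P; split=> //.
  rewrite (_ : EFin \o _ = cst 0%E); first exact: integrable0.
  by apply/funext => x /=; rewrite expr0n.
by apply/funext => x; rewrite patchE mxE; case: ifPn.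
Qed.

Lemma L2_lin a f g : L2 Omega f -> L2 Omega g -> L2 Omega (a *: f + g).
Proof.
move=> hf hg i j.
rewrite (_ : _ \_ _ = (fun x => a * ((fun x => f x i j) \_ Omega) x +
                               ((fun x => g x i j) \_ Omega) x)).
  exact: Lfun2_lin (hf i j) (hg i j).
apply/funext => x; rewrite !patchE; case: ifPn => _; rewrite ?mxE//.
by rewrite mulr0 addr0.
Qed.

Lemma L2_dot_ae f g f' g' : L2 Omega f -> L2 Omega g -> L2 Omega f' -> L2 Omega g' ->
  {ae leb, forall x, Omega x -> f x = f' x} ->
  {ae leb, forall x, Omega x -> g x = g' x} ->
  L2_dot Omega f g = L2_dot Omega f' g'.
Proof.
move=> hf hg hf' hg' ff' gg'; apply: ae_eq_Rintegral => //.
- by apply: measurable_frob => i j; exact: L2_measurable.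
- by apply: measurable_frob => i j; exact: L2_measurable.
- by apply: filterS2 ff' gg' => x h1 h2 Ox; rewrite h1// h2.
Qed.

Lemma L2_dot_eq0 f : L2 Omega f -> L2_dot Omega f f = 0 ->
  {ae leb, forall x, Omega x -> f x = 0}.
Proof.
move=> hf f0.
have := Rintegral_eq0 mO (fun x _ => frob_ge0 (f x)) (frob_integrable hf hf) f0.
by apply: filterS => x /[apply]; exact: frob_eq0.
Qed.

Lemma hilbert_L2 : hilbert (@L2 R N Omega m n) (@L2_dot R N Omega m n).
Proof.
split.
- exact: L2_0.
- exact: L2_lin.
- move=> a u v w hu hv hw; rewrite /L2_dot.
  under eq_Rintegral do rewrite frob_lin.
  have iu := frob_integrable hu hw; have iv := frob_integrable hv hw.
  rewrite RintegralD ?RintegralZl//.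
  by have := integrableZl mO a iu; apply: eq_integrable => // x _ /=; rewrite EFinM.
- by move=> u v _ _; apply: eq_Rintegral => x _; rewrite frobC.
- by move=> u _; apply: Rintegral_ge0 => x _; exact: frob_ge0.
move=> u hu cau.
have hB p q : L2 Omega (u p - u q).
  by rewrite addrC -scaleN1r; exact: L2_lin.
have E i j p q : \int[leb]_x (((fun x => u p x i j) \_ Omega) x -
    ((fun x => u q x i j) \_ Omega) x) ^+ 2 =
    \int[leb]_(x in Omega) ((u p - u q) x i j * (u p - u q) x i j).
  rewrite [RHS]Rintegral_mkcond; apply: eq_Rintegral => x _.
  by rewrite !patchE; case: ifPn => _; rewrite ?subr0 ?expr0n// -expr2 !mxE.
have ent i j p q : \int[leb]_(x in Omega) ((u p - u q) x i j * (u p - u q) x i j)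
   <= L2_dot Omega (u p - u q) (u p - u q).
  apply: le_Rintegral => //; first exact: (Lfun2_restrict_mul (hB p q i j) (hB p q i j)).
    exact: frob_integrable.
  by move=> x _; rewrite -expr2; exact: frob_entry.
have cv i j : exists F : 'rV[R]_N -> R, F \_ Omega \in Lfun leb 2%:E /\
    \int[leb]_(x in Omega) (u p x i j - F x) ^+ 2 @[p --> \oo] --> (0 : R).
  have cauij (e : R) : 0 < e -> exists n0, forall p q, (n0 <= p)%N -> (n0 <= q)%N ->
      \int[leb]_x (((fun x => u p x i j) \_ Omega) x -
        ((fun x => u q x i j) \_ Omega) x) ^+ 2 < e.
    move=> e0; have [n0 hn0] := cau _ e0; exists n0 => p q hp hq.
    by rewrite E; apply: le_lt_trans (hn0 _ _ hp hq).
  have [F hF cF] := Lfun2_complete (fun p => hu p i j) cauij.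
  have FO : F \_ Omega \in Lfun leb 2%:E.
    apply: (Lfun2_le _ hF).
      have /Lfun2P[mF _] := hF.
      by apply/(measurable_restrictT _ _).1 => //; exact: measurable_funTS.
    by move=> x; rewrite patchE; case: ifPn; rewrite ?normr0.
  (* Completeness was applied to the extensions by 0, and [F] need not vanish off [Omega]; the
     integral over [Omega] is still below the one over the whole space. *)
  exists F; split => //; apply: (squeeze_cvgr _ (@cvg_cst _ 0 _ _ _) cF).
  apply: nearW => p; rewrite Rintegral_ge0//=; last by move=> x _; exact: sqr_ge0.
  rewrite [leLHS]Rintegral_mkcond; apply: le_Rintegral => //.
  - have h : (fun x => (-1) * F x + u p x i j) \_ Omega \in Lfun leb 2%:E.
      rewrite (_ : _ \_ _ = (fun x => -1 * (F \_ Omega) x +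
                               ((fun x => u p x i j) \_ Omega) x)).
        exact: Lfun2_lin FO (hu p i j).
      by apply/funext => x; rewrite !patchE; case: ifPn => //; rewrite mulr0 addr0.
    have /Lfun2_restrictP[_] := h.
    move/integrable_mkcond => /(_ mO); apply: eq_integrable => // x _ /=.
    rewrite !patchE; case: ifPn => //= _; congr EFin; ring.
  - have h := Lfun2_lin (-1) hF (hu p i j).
    have /Lfun2P[_] := h.
    by apply: eq_integrable => // x _ /=; congr EFin; ring.
  - move=> x _; rewrite !patchE; case: ifPn => //_; exact: sqr_ge0.
have /choice[F hF] : forall ij : 'I_m * 'I_n, exists F : 'rV[R]_N -> R,
    F \_ Omega \in Lfun leb 2%:E /\
    \int[leb]_(x in Omega) (u p x ij.1 ij.2 - F x) ^+ 2 @[p --> \oo] --> (0 : R).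
  by move=> [i j]; exact: cv.
pose v : 'rV[R]_N -> 'M[R]_(m, n) := fun x => \matrix_(i, j) F (i, j) x.
have hv : L2 Omega v.
  move=> i j; have := (hF (i, j)).1.
  rewrite (_ : F (i, j) \_ Omega = (fun x => v x i j) \_ Omega)//.
  by apply/funext => x; rewrite !patchE mxE.
exists v => //.
have -> : (fun p => L2_dot Omega (u p - v) (u p - v)) = (fun p => \sum_i \sum_j 
    \int[leb]_(x in Omega) (u p x i j - F (i, j) x) ^+ 2).
  apply/funext => p; rewrite L2_dotE.
  - apply: eq_bigr => i _; apply: eq_bigr => j _; apply: eq_Rintegral => x _.
    by rewrite !mxE expr2.
  - by rewrite addrC -scaleN1r; exact: L2_lin.
  - by rewrite addrC -scaleN1r; exact: L2_lin.
rewrite -[X in _ --> X](_ : \sum_(i < m) \sum_(j < n) 0 = 0 :> R); last first.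
  by rewrite big1// => i _; rewrite big1.
apply: cvg_sumr => i; apply: cvg_sumr => j; exact: (hF (i, j)).2.
Qed.

Lemma L2_dominated (f_ : nat -> 'rV[R]_N -> 'M[R]_(m, n)) f g :
  (forall k i j, measurable_fun Omega (fun x => f_ k x i j)) -> L2 Omega g ->
  (forall k x, Omega x -> frob (f_ k x) (f_ k x) <= frob (g x) (g x)) ->
  (forall x i j, Omega x -> f_ k x i j @[k --> \oo] --> f x i j) ->
  [/\ forall k, L2 Omega (f_ k), L2 Omega f &
    L2_dot Omega (f_ k - f) (f_ k - f) @[k --> \oo] --> (0 : R)].
Proof.
move=> mf_ hg fg cf.
have mf i j : measurable_fun Omega (fun x => f x i j).
  by apply: (measurable_fun_cvg (fun k => mf_ k i j)) => x Ox; exact: cf.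
have L2f_ k : L2 Omega (f_ k) by apply: L2_le (mf_ k) hg (fg k).
have cfrob (h_ : nat -> 'M[R]_(m, n)) (h : 'M[R]_(m, n)) :
    (forall i j, h_ k i j @[k --> \oo] --> h i j) ->
    frob (h_ k) (h_ k) @[k --> \oo] --> frob h h.
  move=> ch; rewrite /frob; apply: cvg_sumr => i; apply: cvg_sumr => j.
  by apply: cvgM; exact: ch.
have fle x : Omega x -> frob (f x) (f x) <= frob (g x) (g x).
  move=> Ox; apply: (cvgr_to_le (cfrob _ _ (fun i j => cf x i j Ox))).
  by apply: nearW => k; exact: fg.
have L2f : L2 Omega f by apply: L2_le mf hg fle.
have L2B k : L2 Omega (f_ k - f) by rewrite addrC -scaleN1r; exact: L2_lin.
split=> //.
(* The factor 4 comes from |a - b|^2 <= 2 |a|^2 + 2 |b|^2 with both terms below |g|^2. *)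
have ig : leb.-integrable Omega (EFin \o (fun x => 4 * frob (g x) (g x))).
  have := integrableZl mO 4 (frob_integrable hg hg).
  by apply: eq_integrable => // x _ /=; rewrite EFinM.
have [] := @dominated_convergence _ _ _ leb Omega mO
  (fun k x => (frob ((f_ k - f) x) ((f_ k - f) x))%:E) (cst 0%E)
  (EFin \o (fun x => 4 * frob (g x) (g x))).
- by move=> k; have /integrableP[] := frob_integrable (L2B k) (L2B k).
- exact: measurable_cst.
- apply: aeW => x Ox; apply: cvg_EFin; first exact: nearW.
  rewrite -[X in _ --> X](frob0l (0 : 'M[R]_(m, n))); apply: cfrob => i j.
  rewrite mxE -[X in _ --> X](subrr (f x i j)).
  rewrite (_ : (fun k => _) = (fun k => f_ k x i j - f x i j)); last first.
    by apply/funext => k; rewrite !mxE.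
  by apply: cvgB; [exact: cf|exact: cvg_cst].
- exact: ig.
- apply: aeW => x k Ox /=; rewrite lee_fin ger0_norm ?frob_ge0//.
  rewrite frobBl !frobBr (frobC (f x) (f_ k x)).
  have := frob_ge0 (f_ k x + f x); rewrite frobDl !frobDr (frobC (f x) (f_ k x)).
  by have := fg k _ Ox; have := fle _ Ox; lra.
move=> _ _; rewrite integral0 => /fine_cvgP[_].
by apply: cvg_trans; apply: near_eq_cvg; exact: nearW.
Qed.

End hilbert_structure.
End L2.

(** * Calculus for test functions *)

Section boxes.
Context {R : realType} {n : nat}.
Implicit Types (a b x : 'rV[R]_n) (U : set 'rV[R]_n).

Definition obox a b : set 'rV[R]_n := [set x | forall i, a ord0 i < x ord0 i < b ord0 i].
Definition cbox a b : set 'rV[R]_n := [set x | forall i, a ord0 i <= x ord0 i <= b ord0 i].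

Lemma measurable_box a b (s t : bool) :
  measurable [set x : 'rV[R]_n | forall i,
    x ord0 i \in Interval (BSide s (a ord0 i)) (BSide t (b ord0 i))].
Proof.
rewrite (_ : [set _ | _] = \bigcap_(i in [set: 'I_n])
    ((fun x : 'rV[R]_n => x ord0 i) @^-1`
      [set` Interval (BSide s (a ord0 i)) (BSide t (b ord0 i))])).
  apply: fin_bigcap_measurable => // i _.
  by rewrite -[X in measurable X]setTI; exact: measurable_coord.
by apply/seteqP; split => x /= h i; [move=> _; exact: h|exact: (h i I)].
Qed.

Lemma measurable_obox a b : measurable (obox a b).
Proof.
rewrite (_ : obox a b = [set x | forall i, x ord0 i \in `]a ord0 i, b ord0 i[]).
  exact: measurable_box.
by apply/seteqP; split => x h i; have := h i; rewrite in_itv.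
Qed.

Lemma measurable_cbox a b : measurable (cbox a b).
Proof.
rewrite (_ : cbox a b = [set x | forall i, x ord0 i \in `[a ord0 i, b ord0 i]]).
  exact: measurable_box.
by apply/seteqP; split => x h i; have := h i; rewrite in_itv.
Qed.

Lemma compact_cbox a b : compact (cbox a b).
Proof.
rewrite (_ : cbox a b = [set x | forall i, x ord0 i \in `[a ord0 i, b ord0 i]]).
  apply: (@rV_compact R n (fun i => `[a ord0 i, b ord0 i]%classic)) => i.
  exact: segment_compact.
by apply/seteqP; split => x h i; have := h i; rewrite in_itv.
Qed.

(** Countably many boxes suffice: rational centres and half-widths 1/(k+1). Keeping the closed boxes
    inside [U] leaves room for bump functions supported in [U]. *)
Lemma open_boxes U : open U -> U !=set0 -> exists a b : nat -> 'rV[R]_n,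
  (forall k, cbox (a k) (b k) `<=` U) /\ U = \bigcup_k obox (a k) (b k).
Proof.
move=> oU [x0 Ux0].
pose lo (p : 'rV[rat]_n * nat) : 'rV[R]_n := \row_i (ratr (p.1 ord0 i) - p.2.+1%:R^-1).
pose hi (p : 'rV[rat]_n * nat) : 'rV[R]_n := \row_i (ratr (p.1 ord0 i) + p.2.+1%:R^-1).
pose g p := cbox (lo p) (hi p) `<=` U.
(* Codes of no box, or of a box that leaves [U], get the degenerate box at [x0], which still lies in
   [U]. *)
pose ab k : 'rV[R]_n * 'rV[R]_n := if unpickle k is Some p then
  if `[< g p >] then (lo p, hi p) else (x0, x0) else (x0, x0).
exists (fun k => (ab k).1), (fun k => (ab k).2).
have gU k : cbox (ab k).1 (ab k).2 `<=` U.
  have h0 : cbox x0 x0 `<=` U.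
    move=> x h; suff -> : x = x0 by [].
    by apply/rowP => i; apply/le_anti; rewrite andbC; exact: h.
  by rewrite /ab; case: unpickle => [p|]//; case: asboolP.
split=> //; apply/seteqP; split=> [x Ux|x [k _ hk]]; last first.
  by apply: (gU k) => i; have /andP[/ltW -> /ltW ->] := hk i.
have /nbhs_ballP[e /= e0 he] : nbhs x U by exact: open_nbhs_nbhs.
(* A point of the box is within 1/(k+1) of the centre in each coordinate, and so is x: together
   2/(k+1). *)
have [k hk] : exists k : nat, 2 * k.+1%:R^-1 < e :> R.
  have e20 : 0 < e / 2 by lra.
  have /cvgr_lt/(_ _ e20)[k _ /(_ k (leqnn _)) /= hk] := @cvg_harmonic R.
  exists k; move: hk; rewrite /harmonic; move: (k.+1%:R^-1) => h *; lra.
have k0 : 0 < k.+1%:R^-1 :> R by rewrite invr_gt0.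
have /choice[q hq] : forall i : 'I_n, exists q : rat,
    (x ord0 i - k.+1%:R^-1 < ratr q < x ord0 i + k.+1%:R^-1).
  move=> i; have : x ord0 i - k.+1%:R^-1 < x ord0 i + k.+1%:R^-1 by move: (k.+1%:R^-1) k0 => h ?; lra.
  by move=> /rat_in_itvoo[q]; rewrite in_itv/= => ?; exists q.
pose p : 'rV[rat]_n * nat := (\row_i q i, k).
have gp : g p.
  move=> y hy; apply: he; split=> // i j; rewrite (ord1 i) /ball/=.
  move: (hy j) (hq j) hk; rewrite !mxE/=; move: (k.+1%:R^-1) => h *.
  by rewrite ltr_norml; lra.
exists (pickle p) => // i.
rewrite /ab pickleK; case: asboolP => // _; rewrite !mxE/=.
by move: (hq i); move: (k.+1%:R^-1) => h *; lra.
Qed.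

Lemma open_measurable_rV U : open U -> measurable U.
Proof.
move=> oU; have [->|/set0P U0] := eqVneq U set0; first exact: measurable0.
have [a [b [_ ->]]] := open_boxes oU U0.
by apply: bigcupT_measurable => k; exact: measurable_obox.
Qed.

Lemma continuous_measurable_rV (f : 'rV[R]_n -> R) : continuous f ->
  measurable_fun setT f.
Proof.
move=> /continuousP cf; apply: (measurability _ (RGenOpens.measurableE R)).
move=> _ [_ [a [b ->] <-]]; rewrite setTI; apply: open_measurable_rV.
by apply: cf; exact: interval_open.
Qed.

Lemma cbox_finite (a b : 'rV[R]_n) : (lebesgue_rV n (cbox a b) < +oo)%E.
Proof.
pose c : 'rV[R]_n := \row_i Num.min (a ord0 i) (b ord0 i).
pose d : 'rV[R]_n := \row_i Num.max (a ord0 i) (b ord0 i).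
apply: (@le_lt_trans _ _ (lebesgue_rV n (cbox c d))).
  apply: le_measure; rewrite ?inE; [exact: measurable_cbox|exact: measurable_cbox|].
  by move=> x h i; have /andP[h1 h2] := h i; rewrite !mxE ge_min le_max h1 h2 orbT.
by rewrite lebesgue_rV_box ?ltry// => i; rewrite !mxE le_max ge_min lexx.
Qed.

Lemma continuous_compact_support_integrable (f : 'rV[R]_n -> R) (a b : 'rV[R]_n) :
  continuous f -> (forall x, ~ cbox a b x -> f x = 0) ->
  (lebesgue_rV n).-integrable setT (EFin \o f).
Proof.
move=> cf f0; have mf := continuous_measurable_rV cf.
have [M [_ hM]] := compact_bounded (continuous_compact (continuous_subspaceT cf) (compact_cbox (a := a) (b := b))).
have {}hM x : `|f x| <= Num.max 0 (M + 1).
  have [bx|/f0 ->] := pselect (cbox a b x); last by rewrite normr0 le_max lexx.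
  rewrite le_max; apply/orP; right; apply: (hM (M + 1)); first by rewrite ltrDl.
  by exists x.
have ic : (lebesgue_rV n).-integrable setT
    (EFin \o (cst (Num.max 0 (M + 1)) \_ (cbox a b))).
  rewrite -restrict_EFin; apply/(integrable_mkcond _ (measurable_cbox a b)).1.
  apply/integrableP; split; first by apply/measurable_EFinP; exact: measurable_cst.
  under eq_integral do rewrite /= ger0_norm ?le_max ?lexx//.
  rewrite integral_cst ?lte_mul_pinfty ?lee_fin ?le_max ?lexx//.
    exact: cbox_finite.
  exact: measurable_cbox.
apply: le_integrable ic => //; first exact/measurable_EFinP.
move=> x _ /=; rewrite lee_fin patchE; case: ifPn => [_|/negP nb].
  by apply: le_trans (hM x) _; exact: ler_norm.
by rewrite f0 ?normr0// => bx; apply: nb; rewrite inE.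
Qed.

End boxes.

(** * Derivatives of compactly supported functions have integral zero *)

Section integral_of_derivative.
Context {R : realType}.

Lemma line_integral_derive0 (psi chi : R -> R) (a b : R) : continuous chi ->
  (forall t : R, is_derive t 1 psi (chi t)) ->
  (forall t, ~ (a <= t <= b) -> psi t = 0 /\ chi t = 0) ->
  (\int[lebesgue_measure]_t (chi t)%:E = 0)%E.
Proof.
move=> cchi dpsi supp.
(* The order of [a] and [b] is not assumed, hence min and max; the margin 1 puts the endpoints
   outside the support, where [psi] vanishes. *)
pose c := Num.min a b - 1; pose d := Num.max a b + 1.
have h1 : Num.min a b <= a by rewrite ge_min lexx.
have h2 : b <= Num.max a b by rewrite le_max lexx orbT.
have h3 : Num.min a b <= Num.max a b by rewrite ge_min le_max lexx.
have ca : c < a by rewrite /c; lra.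
have bd : b < d by rewrite /d; lra.
have cd : c < d by rewrite /c /d; lra.
have out t : ~ (a <= t <= b) -> chi t = 0 by move=> /supp[].
transitivity (\int[lebesgue_measure]_(t in `[c, d]) (chi t)%:E)%E.
  rewrite [RHS]integral_mkcond; apply: eq_integral => t _.
  rewrite patchE; case: ifPn => // /negP; rewrite inE/= in_itv/= => h.
  by rewrite out// => /andP[? ?]; apply: h; lra.
rewrite (@continuous_FTC2 _ chi psi)//.
- by rewrite (supp c _).1 ?(supp d _).1 ?subee//; move=> /andP[]; lra.
- exact: continuous_subspaceT.
- have dp (t : R) : derivable psi t 1 by have := dpsi t; case.
  have cp (t : R) : {for t, continuous psi}.
    by apply/differentiable_continuous/derivable1_diffP.
  split; first by move=> t _.
    by apply: cvg_at_right_filter; exact: cp.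
  by apply: cvg_at_left_filter; exact: cp.
- by move=> t _; rewrite derive1E; have := dpsi t; case.
Qed.

Lemma continuous_rV_consr n (t : R) : continuous (fun x : 'rV[R]_n => rV_cons (t, x)).
Proof.
move=> x A /nbhs_ballP[e /= e0 eA]; apply/nbhs_ballP; exists e => // y [_ xy].
apply: eA; split=> // i j; rewrite !mxE/=.
by case: unliftP => [k _|_]/=; [exact: xy|exact: ballxx].
Qed.

Lemma rV_cons_line n (t s : R) (x : 'rV[R]_n) :
  rV_cons (t + s, x) = rV_cons (t, x) + s *: delta_mx ord0 ord0.
Proof.
apply/rowP => i; rewrite !mxE eqxx/=; case: unliftP => [k ->|->]/=.
  by rewrite mulr0 addr0.
by rewrite mulr1.
Qed.

Lemma rV_cons_liner n (t s : R) (x : 'rV[R]_n) (j : 'I_n) :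
  rV_cons (t, x + s *: delta_mx ord0 j) =
  rV_cons (t, x) + s *: delta_mx ord0 (lift ord0 j).
Proof.
apply/rowP => i; rewrite !mxE eqxx/=; case: unliftP => [k ->|->]/=.
  by rewrite !mxE eqxx/= (inj_eq lift_inj).
by rewrite mulr0 addr0.
Qed.

(** Fubini peels off the first coordinate. If [j] is that coordinate, each inner line integral
    vanishes by the fundamental theorem of calculus; otherwise it is frozen and the induction
    hypothesis applies to the slices. *)
Lemma integral_derive0 n (j : 'I_n) (psi chi : 'rV[R]_n -> R) (a b : 'rV[R]_n) :
  continuous chi ->
  (forall x (t : R), is_derive t 1 (fun s : R => psi (x + s *: delta_mx ord0 j))
     (chi (x + t *: delta_mx ord0 j))) ->
  (forall x, ~ cbox a b x -> psi x = 0 /\ chi x = 0) ->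
  (\int[lebesgue_rV n]_x (chi x)%:E = 0)%E.
Proof.
elim: n j psi chi a b => [[]//|n ih] j psi chi a b cchi dpsi supp.
have ichi : (lebesgue_rV n.+1).-integrable setT (EFin \o chi).
  by apply: (continuous_compact_support_integrable (a := a) (b := b)) => // x /supp[].
have mchi := measurable_int _ ichi.
pose f : measurableTypeR R * 'rV[R]_n -> \bar R := (EFin \o chi) \o @rV_cons R n.
have mf : measurable_fun setT f.
  by apply: measurableT_comp => //; exact: measurable_rV_cons.
have intf : (lebesgue_measure \x lebesgue_rV n)%E.-integrable setT f.
  apply/integrableP; split => //.
  have /integrableP[_] := ichi; rewrite [X in (X < _)%E -> _](_ : _ =
    \int[pushforward (lebesgue_measure \x lebesgue_rV n)%E (@rV_cons R n)]_x `|(chi x)%:E|)%E//.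
  rewrite ge0_integral_pushforward//.
  - exact: measurable_rV_cons.
  - exact: measurableT_comp.
transitivity (\int[(lebesgue_measure \x lebesgue_rV n)%E]_z f z)%E.
  rewrite [LHS](_ : _ = \int[pushforward (lebesgue_measure \x lebesgue_rV n)%E 
     (@rV_cons R n)]_x (chi x)%:E)%E// integral_pushforward//.
  exact: measurable_rV_cons.
have [j0|[k jk]] : j = ord0 \/ exists k, j = lift ord0 k.
  by case: (unliftP ord0 j) => [k ->|->]; [right; exists k|left].
- rewrite -(integral21_prod_meas1 intf); apply: integral0_eq => x _.
  apply: (@line_integral_derive0 (fun t => psi (rV_cons (t, x))) _
    (a ord0 ord0) (b ord0 ord0)).
  + move=> t.
    rewrite (_ : (fun t => _) = chi \o (fun t => rV_cons (0, x) + t *: delta_mx ord0 ord0)).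
      apply: continuous_comp; last exact: cchi.
      by apply: cvgD; [exact: cvg_cst|apply: cvgZr_tmp; exact: cvg_id].
    by apply/funext => s /=; rewrite -rV_cons_line add0r.
  + move=> t; have := dpsi (rV_cons (0, x)) t.
    rewrite j0 -rV_cons_line add0r.
    by under eq_fun do rewrite -rV_cons_line add0r.
  + move=> t h; apply: supp => /(_ ord0); rewrite !mxE unlift_none/=.
    exact: h.
- rewrite -(integral12_prod_meas1 intf); apply: integral0_eq => t _.
  apply: (ih k (fun x => psi (rV_cons (t, x))) _ (rV_uncons a).2 (rV_uncons b).2).
  + move=> x; apply: (@continuous_comp _ _ _ (fun x => rV_cons (t, x)) chi).
      exact: continuous_rV_consr.
    exact: cchi.
  + move=> x s; have := dpsi (rV_cons (t, x)) s.
    rewrite jk -rV_cons_liner.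
    by under eq_fun do rewrite -rV_cons_liner.
  + move=> x h; apply: supp => hc; apply: h => i; have := hc (lift ord0 i).
    by rewrite !mxE liftK.
Qed.

End integral_of_derivative.

(** * Product rule and symmetry of second derivatives *)

Section smooth_functions.
Context {R : realType} {N : nat}.
Implicit Types (f g : 'rV[R]_N -> R^o) (x v : 'rV[R]_N) (i j : 'I_N).

Lemma is_derive_line f x v t d : is_derive (x + t *: v) v f d ->
  is_derive t 1 (fun s : R => f (x + s *: v) : R^o) d.
Proof.
have E : (fun h : R => h^-1 *: (((fun s : R => f (x + s *: v)) \o shift t) (h *: 1) -
            f (x + t *: v))) =
         (fun h : R => h^-1 *: ((f \o shift (x + t *: v)) (h *: v) - f (x + t *: v))).
  apply/funext => h /=; congr (_ *: (f _ - _)).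
  by rewrite [_%:A]mulr1 scalerDl addrCA.
by case=> df <-; apply: DeriveDef; rewrite /derivable /derive E.
Qed.

(** What integration by parts in direction [j] asks of the other factor. A single product rule then
    covers the function x_j f of the Poincaré inequality. *)
Definition C1 j f := (forall x, differentiable f x) /\ continuous (partial j f).

Lemma smooth_partial f j : smooth f -> smooth (partial j f).
Proof. by move=> sf s x; have := sf (rcons s j) x; rewrite foldr_rcons. Qed.

Lemma smooth_differentiable f x : smooth f -> differentiable f x.
Proof. by move=> /(_ [::]). Qed.

Lemma smooth_continuous f : smooth f -> continuous f.
Proof. by move=> sf x; exact/differentiable_continuous/smooth_differentiable. Qed.

Lemma smooth_C1 j f : smooth f -> C1 j f.
Proof.
move=> sf; split=> [x|]; first exact: smooth_differentiable.
exact/smooth_continuous/smooth_partial.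
Qed.

Lemma partial_lin j (a : R) f g x : differentiable f x -> differentiable g x ->
  partial j (fun y => a * f y + g y) x = a * partial j f x + partial j g x.
Proof.
move=> df dg; rewrite /partial -[LHS]/('D_(delta_mx ord0 j) ((a *: f) + g) x).
by rewrite deriveD ?deriveZ//; try exact: diff_derivable; apply/diff_derivable/differentiableZ.
Qed.

Lemma smooth_lin (a : R) f g : smooth f -> smooth g -> smooth (fun x => a * f x + g x).
Proof.
move=> sf sg s.
have E : foldr partial (fun x => a * f x + g x : R^o) s =
    (fun x => a * foldr partial f s x + foldr partial g s x).
  elim: s => //= j s ->; apply/funext => x; exact: partial_lin.
move=> x; rewrite E.
by apply: (@differentiableD _ _ _ (a *: foldr partial f s)) => //; exact: differentiableZ.
Qed.

Lemma partialM j f g x : differentiable f x -> differentiable g x ->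
  partial j (fun y => f y * g y) x = f x * partial j g x + partial j f x * g x.
Proof.
move=> df dg; rewrite /partial -[LHS]/('D_(delta_mx ord0 j) (f * g) x).
rewrite deriveM; try exact: diff_derivable.
by rewrite /GRing.scale/= addrC mulrC addrC [_ * g x]mulrC.
Qed.

Lemma is_derive_partial j f x (t : R) : differentiable f (x + t *: delta_mx ord0 j) ->
  is_derive t 1 (fun s : R => f (x + s *: delta_mx ord0 j) : R^o)
    (partial j f (x + t *: delta_mx ord0 j)).
Proof. by move=> df; apply/is_derive_line/derivableP/diff_derivable. Qed.

(** The mean value theorem, first in direction [i] for the increment along [j], then in direction
    [j] for the i-th partial derivative. *)
Lemma second_difference f i j x (h : R) : smooth f -> 0 < h ->
  exists s t : R, [/\ 0 < s < h, 0 < t < h &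
    f (x + h *: delta_mx ord0 i + h *: delta_mx ord0 j)
    - f (x + h *: delta_mx ord0 i) - f (x + h *: delta_mx ord0 j) + f x =
    h ^+ 2 * partial j (partial i f) (x + s *: delta_mx ord0 i + t *: delta_mx ord0 j)].
Proof.
move=> sf h0.
pose e k : 'rV[R]_N := delta_mx ord0 k.
pose F (s : R) : R^o := f (x + h *: e j + s *: e i) - f (x + s *: e i).
have dF (s : R) : is_derive s 1 F (partial i f (x + h *: e j + s *: e i) -
    partial i f (x + s *: e i)).
  by apply: is_deriveB; apply: is_derive_partial; exact: smooth_differentiable.
have cF : {within `[0, h], continuous F}.
  apply: continuous_subspaceT => s; apply/differentiable_continuous/derivable1_diffP.
  by have := dF s; case.
have [s] := MVT h0 (fun s _ => dF s) cF; rewrite in_itv/= => sh Fs.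
pose G (t : R) : R^o := partial i f (x + s *: e i + t *: e j).
have dG (t : R) : is_derive t 1 G (partial j (partial i f) (x + s *: e i + t *: e j)).
  by apply: is_derive_partial; exact/smooth_differentiable/smooth_partial.
have cG : {within `[0, h], continuous G}.
  apply: continuous_subspaceT => t; apply/differentiable_continuous/derivable1_diffP.
  by have := dG t; case.
have [t] := MVT h0 (fun t _ => dG t) cG; rewrite in_itv/= => th Gt.
exists s, t; split=> //.
move: Fs Gt; rewrite /F /G !scale0r !addr0 !subr0 => Fs Gt.
rewrite [x + h *: e j + s *: e i]addrAC Gt in Fs.
rewrite [x + h *: _ + h *: _]addrAC expr2.
transitivity (f (x + h *: e j + h *: e i) - f (x + h *: e i) - (f (x + h *: e j) - f x)).
  by rewrite opprB; ring.
by rewrite Fs; ring.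
Qed.

(** The second difference is symmetric in [i] and [j], so the two mixed derivatives take a common
    value at points arbitrarily close to x; continuity of both concludes. *)
Lemma partial_comm f i j x : smooth f ->
  partial i (partial j f) x = partial j (partial i f) x.
Proof.
move=> sf; apply/eqP/negPn/negP => ne.
pose A := partial j (partial i f); pose B := partial i (partial j f).
have e0 : 0 < `|B x - A x| / 2 by rewrite divr_gt0// normr_gt0 subr_eq0.
set e := _ / _ in e0.
have cA : continuous A by do 2 (exact/smooth_continuous/smooth_partial/smooth_partial).
have cB : continuous B by do 2 (exact/smooth_continuous/smooth_partial/smooth_partial).
have /cvgrPdist_lt/(_ _ e0) nA := cA x.
have /cvgrPdist_lt/(_ _ e0) nB := cB x.
have /nbhs_ballP[d /= d0 hd] : \forall y \near x, `|A x - A y| < e /\ `|B x - B y| < e.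
  exact: filterI nA nB.
(* When the two directions coincide their increments add up in one coordinate, to less than 2 d /
   3. *)
have h0 : 0 < d / 3 by rewrite divr_gt0.
have inball (i' j' : 'I_N) (s t : R) : 0 < s < d / 3 -> 0 < t < d / 3 ->
    ball x d (x + s *: delta_mx ord0 i' + t *: delta_mx ord0 j').
  move=> /andP[s0 s1] /andP[t0 t1]; split=> // k l; rewrite /ball/= !mxE (ord1 k) eqxx/=.
  have H (r : R) (b : bool) : 0 < r -> 0 <= r * b%:R <= r.
    by move=> r0; case: b; rewrite ?mulr1 ?mulr0 lexx ltW.
  have /andP[s2 s3] := H s (l == i') s0; have /andP[t2 t3] := H t (l == j') t0.
  move: s2 s3 t2 t3; move: (s * _) (t * _) (x _ _) => u w z a1 a2 a3 a4.
  clear -s1 t1 d0 a1 a2 a3 a4.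
  by rewrite ltr_norml; lra.
have [s [t [hs ht]]] := second_difference i j x sf h0.
have [s' [t' [hs' ht']]] := second_difference j i x sf h0.
have -> : f (x + d / 3 *: delta_mx ord0 j + d / 3 *: delta_mx ord0 i) -
  f (x + d / 3 *: delta_mx ord0 j) - f (x + d / 3 *: delta_mx ord0 i) + f x =
  f (x + d / 3 *: delta_mx ord0 i + d / 3 *: delta_mx ord0 j) -
  f (x + d / 3 *: delta_mx ord0 i) - f (x + d / 3 *: delta_mx ord0 j) + f x.
  by rewrite [x + _ + _]addrAC; ring.
have [_ h2] := hd _ (inball j i _ _ hs' ht').
have [h1 _] := hd _ (inball i j _ _ hs ht).
have d2 : (d / 3) ^+ 2 != 0 by rewrite expf_neq0// gt_eqF.
move=> E1 E2; have AB := mulfI d2 (etrans (esym E2) E1).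
move: h1; rewrite /A AB -/(B _) => h1.
move: h1 h2; rewrite -/(A x) /e.
move: (A x : R) (B x : R) (B _ : R) => p q r h1 h2.
have : `|q - p| < `|q - p| / 2 + `|q - p| / 2.
  apply: le_lt_trans (ltrD h2 h1); rewrite (distrC p); exact: ler_distD.
by rewrite -splitr ltxx.
Qed.

End smooth_functions.

(** * Integration by parts and the Poincaré inequality for test functions *)

Section test_functions.
Context {R : realType} {N : nat} (Omega : set 'rV[R]_N).
Hypothesis mO : measurable Omega.
Local Notation leb := (@lebesgue_rV R N).
Implicit Types (f g : 'rV[R]_N -> R^o) (x v : 'rV[R]_N) (i j : 'I_N).

Lemma partial_out f j x : ~ closure [set y | f y != 0] x -> partial j f x = 0.
Proof.
move=> nx; rewrite /partial -(derive_cst (0 : R^o) x (delta_mx ord0 j)).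
apply: near_eq_derive.
have : nbhs x (~` closure [set y | f y != 0]).
  by apply: open_nbhs_nbhs; split=> //; apply: closed_openC; exact: closed_closure.
apply: filterS => y /= ny; apply/eqP/negPn/negP => fy; apply: ny.
exact: subset_closure.
Qed.

Lemma test_out f x : test_function Omega f -> ~ Omega x -> f x = 0.
Proof.
case=> _ _ fO nx; apply/eqP/negPn/negP => fx; apply/nx/fO.
exact: subset_closure.
Qed.

Lemma test_partial f j : test_function Omega f -> test_function Omega (partial j f).
Proof.
case=> sf cf fO.
have sub : closure [set y | partial j f y != 0] `<=` closure [set y | f y != 0].
  rewrite ((closure_id _).1 (@closed_closure _ [set y | f y != 0])).
  apply: closure_subset => y /=; apply: contra_neqP => ny; exact: partial_out.
split; [exact: smooth_partial| |exact: subset_trans sub fO].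
by apply: subclosed_compact cf sub; exact: closed_closure.
Qed.

Lemma test_lin (a : R) f g : test_function Omega f -> test_function Omega g ->
  test_function Omega (fun x => a * f x + g x).
Proof.
move=> [sf cf fO] [sg cg gO].
pose F := closure [set y | f y != 0]; pose G := closure [set y | g y != 0].
have sub : closure [set y | a * f y + g y != 0] `<=` F `|` G.
  rewrite ((closure_id _).1 (_ : closed (F `|` G))); last first.
    by apply: closedU; exact: closed_closure.
  apply: closure_subset => y /= ne.
  have [f0|f0] := eqVneq (f y) 0; last by left; exact: subset_closure.
  by right; apply: subset_closure => /=; move: ne; rewrite f0 mulr0 add0r.
split; first exact: smooth_lin.
- by apply: subclosed_compact (compactU cf cg) sub; exact: closed_closure.
- by move=> x /sub[/fO|/gO].
Qed.

Lemma test_box f : test_function Omega f -> exists a b : 'rV[R]_N,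
  forall x, ~ cbox a b x -> f x = 0.
Proof.
case=> _ cf _; have [M [_ hM]] := compact_bounded cf.
exists (const_mx (- (M + 1))), (const_mx (M + 1)) => x nx.
apply/eqP/negPn/negP => fx; apply: nx => i; rewrite !mxE -ler_norml.
have /hM : M < M + 1 by rewrite ltrDl.
have cx : closure [set y | f y != 0] x by exact: subset_closure.
move=> /(_ x cx); apply: le_trans.
rewrite [leRHS]/Num.norm/= mx_normrE.
by apply/bigmax_geP; right => /=; exists (ord0, i).
Qed.

Lemma test_mul_integrable f (g : 'rV[R]_N -> R) : test_function Omega f -> continuous g ->
  leb.-integrable Omega (EFin \o (fun x => g x * f x)).
Proof.
move=> tf cg; have [a [b fab]] := test_box tf.
apply: (@integrableS _ _ _ _ setT) => //.
apply: (continuous_compact_support_integrable (a := a) (b := b)).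
  have cf : continuous f by case: tf => sf _ _; exact: smooth_continuous.
  by move=> x; exact: (cvgM (cg x) (cf x)).
by move=> x /fab ->; rewrite mulr0.
Qed.

Lemma test_Lfun2 f : test_function Omega f -> (f : _ -> R) \_ Omega \in Lfun leb 2%:E.
Proof.
move=> tf; have cf : continuous f by case: tf => sf _ _; exact: smooth_continuous.
apply/(Lfun2_restrictP mO); split.
  exact: measurable_funTS (continuous_measurable_rV cf).
exact: test_mul_integrable tf cf.
Qed.

(** The product g f inherits compact support from [f] alone, so its derivative integrates to zero
    whatever [g] does at the boundary. *)
Lemma integral_by_parts j f g : test_function Omega f -> C1 j g ->
  \int[leb]_(x in Omega) (g x * partial j f x) =
  - \int[leb]_(x in Omega) (partial j g x * f x).
Proof.
move=> tf [dg cpg]; have [sf _ _] := tf.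
have cg : continuous g by move=> x; exact: differentiable_continuous.
have tpf := test_partial j tf.
have i1 := test_mul_integrable tpf cg; have i2 := test_mul_integrable tf cpg.
apply/eqP; rewrite -addr_eq0 -RintegralD//; apply/eqP.
rewrite Rintegral_mkcond /Rintegral.
have [a [b fab]] := test_box tf; have [a' [b' fab']] := test_box tpf.
pose A : 'rV[R]_N := \row_k Num.min (a ord0 k) (a' ord0 k).
pose B : 'rV[R]_N := \row_k Num.max (b ord0 k) (b' ord0 k).
rewrite (_ : \int[_]_x _ = 0)%E//.
transitivity (\int[leb]_x ((g x * partial j f x + partial j g x * f x)%R)%:E)%E.
  apply: eq_integral => x _; rewrite patchE; case: ifPn => // /negP.
  rewrite inE => nx; rewrite (test_out tf nx) (test_out tpf nx) !mulr0 addr0//.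
apply: (@integral_derive0 _ _ j (fun x => g x * f x) _ A B).
- have cf := smooth_continuous sf; have cpf := smooth_continuous (smooth_partial j sf).
  by move=> x; exact: (cvgD (cvgM (cg x) (cpf x)) (cvgM (cpg x) (cf x))).
- move=> x t; rewrite -(partialM j (dg _) (smooth_differentiable _ sf)).
  apply: (@is_derive_partial _ _ j (fun x => g x * f x)).
  by apply: differentiableM => //; exact: smooth_differentiable.
- move=> x nx.
  have f0 : f x = 0.
    apply: fab => h; apply: nx => k; rewrite !mxE ge_min le_max.
    by have /andP[-> ->] := h k.
  have f1 : partial j f x = 0.
    apply: fab' => h; apply: nx => k; rewrite !mxE ge_min le_max.
    by have /andP[-> ->] := h k; rewrite !orbT.
  by rewrite f0 f1 !mulr0 addr0.
Qed.

(** Integrate by parts, exchange the second derivatives of [g], and integrate back. *)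
Lemma integral_partial_swap i j f g : test_function Omega f -> smooth g ->
  \int[leb]_(x in Omega) (partial i g x * partial j f x) =
  \int[leb]_(x in Omega) (partial j g x * partial i f x).
Proof.
move=> tf sg.
have ibp k l := integral_by_parts tf (smooth_C1 l (smooth_partial k sg)).
have E : partial j (partial i g) = partial i (partial j g).
  by apply/funext => x; exact: partial_comm.
by apply: (etrans (ibp i j)); rewrite E; exact: (esym (ibp j i)).
Qed.

Lemma poincare_test j f (M : R) : test_function Omega f ->
  (forall x, Omega x -> `|x ord0 j| <= M) ->
  \int[leb]_(x in Omega) (f x * f x) <=
  4 * M ^+ 2 * \int[leb]_(x in Omega) (partial j f x * partial j f x).
Proof.
move=> tf OM; have [sf _ _] := tf.
have cf : continuous f by exact: smooth_continuous.
have tpf := test_partial j tf; have [spf _ _] := tpf.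
pose X : 'rV[R]_N -> R^o := fun x => x ord0 j.
have dX x : differentiable X x by exact: differentiable_coord.
have pX x : partial j X x = 1.
  rewrite /partial /derive; apply: cvg_lim => //.
  apply: (cvg_trans _ (@cvg_cst _ (1 : R^o) _ (0 : R)^' _)).
  apply: near_eq_cvg; near=> h.
  have h0 : h != 0 by near: h; exact: nbhs_dnbhs_neq.
  by rewrite /X /= !mxE !eqxx/= mulr1 addrK /GRing.scale/= mulVf.
have c1 : C1 j (fun x => X x * f x).
  split=> [x|]; first by apply: differentiableM => //; exact: smooth_differentiable.
  have -> : partial j (fun x => X x * f x) = fun x => X x * partial j f x + f x.
    by apply/funext => x; rewrite partialM ?pX ?mul1r//; exact: smooth_differentiable.
  have cX x : {for x, continuous X} by exact: differentiable_continuous.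
  by move=> x; exact: (cvgD (cvgM (cX x) (smooth_continuous spf (x := x))) (cf x)).
have M0 x : Omega x -> x ord0 j ^+ 2 <= M ^+ 2.
  move=> /OM xM; rewrite -(@real_normK _ (x ord0 j)) ?num_real// lerXn2r ?nnegrE//.
  exact: le_trans xM.
have i1 := test_mul_integrable tf cf.
have i2 : leb.-integrable Omega (EFin \o (fun x => partial j f x * partial j f x)).
  by apply: test_mul_integrable tpf _; exact: smooth_continuous.
have c2 : continuous (fun x => X x * f x).
  by case: c1 => h _ x; exact: differentiable_continuous.
have i3 := test_mul_integrable tpf c2.
have c3 : continuous (partial j (fun x => X x * f x)) by case: c1.
have i4 := test_mul_integrable tf c3.
have E := integral_by_parts tf c1.
(* The weights are those of -2 q r p <= r^2 / 2 + 2 q^2 p^2; once half of f^2 is absorbed, 2 M^2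
   becomes the constant 4 M^2. *)
have i12 : leb.-integrable Omega (EFin \o (fun x => 2^-1 * (f x * f x))).
  have := integrableZl mO 2^-1 i1.
  by apply: eq_integrable => // x _ /=; rewrite EFinM.
have i22 : leb.-integrable Omega
    (EFin \o (fun x => 2 * M ^+ 2 * (partial j f x * partial j f x))).
  have := integrableZl mO (2 * M ^+ 2) i2.
  by apply: eq_integrable => // x _ /=; rewrite EFinM.
(* [f^2 = d_j(x_j f^2) - 2 x_j f d_j f], and the last term is absorbed by AM-GM. *)
have : \int[leb]_(x in Omega) (f x * f x) <=
    \int[leb]_(x in Omega) (X x * f x * partial j f x +
      partial j (fun x => X x * f x) x * f x +
      (2^-1 * (f x * f x) + 2 * M ^+ 2 * (partial j f x * partial j f x))).
  apply: le_Rintegral => //.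
    have := integrableD mO (integrableD mO i3 i4) (integrableD mO i12 i22).
    by apply: eq_integrable => // x _ /=; rewrite !EFinD.
  move=> x Ox; rewrite partialM ?pX//; last exact: smooth_differentiable.
  have := M0 _ Ox; rewrite -/(X x).
  set p := partial j f x; set q := X x; set r := f x => qM.
  have : q ^+ 2 * (p * p) <= M ^+ 2 * (p * p) by rewrite ler_wpM2r// -expr2 sqr_ge0.
  have := sqr_ge0 (r + 2 * q * p); rewrite sqrrD !exprMn; lra.
rewrite RintegralD//; last 2 first.
- by have := integrableD mO i3 i4; apply: eq_integrable => // x _ /=; rewrite EFinD.
- by have := integrableD mO i12 i22; apply: eq_integrable => // x _ /=; rewrite EFinD.
rewrite RintegralD// RintegralD// !RintegralZl// E.
by lra.
Unshelve. all: by end_near. Qed.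

End test_functions.

(** [eps] at a point is by definition [sym_part] of the gradient; the separate name also serves
    classical gradients of test fields and their L2 limits. *)
Definition sym_part {R : realType} {N : nat} (A : 'M[R]_N) : 'M[R]_N := 2^-1 *: (A + A^T).

Section sym_part.
Context {R : realType} {N : nat}.
Implicit Types A B : 'M[R]_N.

Lemma sym_part_lin a A B : sym_part (a *: A + B) = a *: sym_part A + sym_part B.
Proof. by apply/matrixP => i j; rewrite !mxE; ring. Qed.

Lemma frob_tr A B : frob A^T B^T = frob A B.
Proof.
rewrite /frob exchange_big; apply: eq_bigr => i _; apply: eq_bigr => j _.
by rewrite !mxE.
Qed.

Lemma frob_sym_part A : 2 * frob (sym_part A) (sym_part A) = frob A A + frob A A^T.
Proof.
rewrite /sym_part frobZl frobZr frobDl !frobDr frob_tr (frobC A^T A); by field.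
Qed.

Lemma frob_sym_part_le A : frob (sym_part A) (sym_part A) <= frob A A.
Proof.
have := frob_sym_part A; have := frob_ge0 (A - A^T).
rewrite frobBl !frobBr frob_tr (frobC A^T A); lra.
Qed.

End sym_part.

(** * Korn and Poincaré inequalities for test fields *)

Section test_fields.
Context {R : realType} {N : nat} (Omega : set 'rV[R]_N).
Hypothesis mO : measurable Omega.
Local Notation leb := (@lebesgue_rV R N).
Implicit Types phi : 'rV[R]_N -> 'rV[R]_N.

Definition test_field phi := forall i, test_function Omega (fun x => phi x ord0 i).

Definition tgrad phi : 'rV[R]_N -> 'M[R]_N :=
  fun x => \matrix_(i, j) partial j (fun y => phi y ord0 i) x.

Lemma L2_test_field phi : test_field phi -> L2 Omega phi.
Proof. by move=> tphi i j; rewrite (ord1 i); exact: test_Lfun2 (tphi j). Qed.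

Lemma L2_tgrad phi : test_field phi -> L2 Omega (tgrad phi).
Proof.
move=> tphi i j; have := test_Lfun2 mO (test_partial j (tphi i)).
rewrite (_ : _ \_ _ = (fun x => tgrad phi x i j) \_ Omega)//.
by apply/funext => x; rewrite !patchE mxE.
Qed.

Lemma test_field_lin a phi psi : test_field phi -> test_field psi ->
  test_field (a *: phi + psi).
Proof.
move=> tphi tpsi i; have := test_lin a (tphi i) (tpsi i).
by congr test_function; apply/funext => x; rewrite !mxE.
Qed.

Lemma tgrad_lin a phi psi : test_field phi -> test_field psi ->
  tgrad (a *: phi + psi) = a *: tgrad phi + tgrad psi.
Proof.
move=> tphi tpsi; apply/funext => x; apply/matrixP => i j.
have [si _ _] := tphi i; have [ti _ _] := tpsi i.
rewrite mxE; have -> : (fun y => (a *: phi + psi) y ord0 i) =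
    (fun y => a * phi y ord0 i + psi y ord0 i) by apply/funext => y; rewrite !mxE.
rewrite (partial_lin j a (smooth_differentiable x si) (smooth_differentiable x ti)).
by rewrite !mxE.
Qed.

Lemma weak_gradient_tgrad phi : test_field phi -> weak_gradient Omega phi (tgrad phi).
Proof.
move=> tphi; split; first exact: L2_tgrad.
move=> i j f tf; have [sf _ _] := tphi i.
rewrite (integral_by_parts mO tf (smooth_C1 j sf)).
by congr (- _); apply: eq_Rintegral => x _; rewrite mxE.
Qed.

Lemma L2_sym_part (G : 'rV[R]_N -> 'M[R]_N) : L2 Omega G -> L2 Omega (sym_part \o G).
Proof.
move=> hG; apply: (L2_le mO _ hG) => [i j|x _]; last exact: frob_sym_part_le.
under eq_fun do rewrite !mxE.
apply: measurable_funM => //; apply: measurable_funD; exact: L2_measurable hG.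
Qed.

(** Twice |sym A|^2 is |A|^2 + A : A^T. Entry by entry, swapping derivatives turns the integral of
    grad phi : (grad phi)^T into that of the squared divergence, which is nonnegative. *)
Lemma korn_test phi : test_field phi ->
  L2_dot Omega (tgrad phi) (tgrad phi) <=
  2 * L2_dot Omega (sym_part \o tgrad phi) (sym_part \o tgrad phi).
Proof.
move=> tphi; have hG := L2_tgrad tphi; have hS := L2_sym_part hG.
have hT : L2 Omega (trmx \o tgrad phi).
  apply: (L2_le mO _ hG) => [i j|x _]; last by rewrite /= frob_tr.
  by under eq_fun do rewrite !mxE; have := L2_measurable mO j i hG;
    under eq_fun do rewrite mxE.
have -> : 2 * L2_dot Omega (sym_part \o tgrad phi) (sym_part \o tgrad phi) =
    L2_dot Omega (tgrad phi) (tgrad phi) + L2_dot Omega (tgrad phi) (trmx \o tgrad phi).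
  rewrite /L2_dot -RintegralZl//; last exact: frob_integrable.
  rewrite -RintegralD//; try exact: frob_integrable.
  by apply: eq_Rintegral => x _; rewrite frob_sym_part.
rewrite lerDl.
pose p i j x := partial j (fun y => phi y ord0 i) x : R.
have ip i j k l : leb.-integrable Omega (EFin \o (fun x => p i j x * p k l x)).
  have [sp _ _] := test_partial j (tphi i).
  exact: (test_mul_integrable mO (test_partial l (tphi k)) (smooth_continuous sp)).
have -> : L2_dot Omega (tgrad phi) (trmx \o tgrad phi) =
    \int[leb]_(x in Omega) ((\sum_i p i i x) * (\sum_j p j j x)).
  transitivity (\sum_i \sum_j \int[leb]_(x in Omega) (p i i x * p j j x)).
    rewrite L2_dotE//; apply: eq_bigr => i _; apply: eq_bigr => j _.
    have [si _ _] := tphi i.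
    transitivity (\int[leb]_(x in Omega) (p i j x * p j i x)).
      by apply: eq_Rintegral => x _; rewrite !mxE.
    exact: (integral_partial_swap mO j i (tphi j) si).
  under eq_Rintegral do rewrite mulr_suml.
  under eq_Rintegral => x _.
    under eq_bigr do rewrite mulr_sumr.
    over.
  rewrite (@Rintegral_sum _ _ _ _ _ mO _ _ (fun i x => \sum_j p i i x * p j j x)).
    apply: eq_bigr => i _.
    by rewrite (@Rintegral_sum _ _ _ _ _ mO _ _ (fun j x => p i i x * p j j x)).
  move=> i.
  by apply: (@integrable_EFin_sum _ _ _ _ _ mO _ _ (fun j x => p i i x * p j j x)).
by apply: Rintegral_ge0 => x _; rewrite -expr2 sqr_ge0.
Qed.

Lemma poincare_test_field (k : 'I_N) (M : R) phi : test_field phi ->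
  (forall x, Omega x -> `|x ord0 k| <= M) ->
  L2_dot Omega phi phi <= 4 * M ^+ 2 * L2_dot Omega (tgrad phi) (tgrad phi).
Proof.
move=> tphi OM; have hp := L2_test_field tphi; have hG := L2_tgrad tphi.
rewrite !L2_dotE// big_ord1 mulr_sumr; apply: ler_sum => i _.
apply: le_trans (poincare_test mO (tphi i) OM) _.
have M0 : 0 <= 4 * M ^+ 2 by apply: mulr_ge0 => //; exact: sqr_ge0.
rewrite (ler_wpM2l M0)// (bigD1 k)//=.
have -> : \int[leb]_(x in Omega) (partial k (fun x => phi x ord0 i) x *
    partial k (fun x => phi x ord0 i) x) =
    \int[leb]_(x in Omega) (tgrad phi x i k * tgrad phi x i k).
  by apply: eq_Rintegral => x _; rewrite !mxE.
rewrite lerDl; apply: sumr_ge0 => l _; apply: Rintegral_ge0 => x _.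
by rewrite -expr2 sqr_ge0.
Qed.

End test_fields.

(** * Bump functions and the fundamental lemma *)

Section exp_inv.
Context {R : realType}.
Implicit Types (p : {poly R}) (t : R).

(** For n > 0, s/n <= 1 + s/n <= exp(s/n); raise to the n-th power. *)
Lemma expR_pow_le (n : nat) (s : R) : 0 <= s -> s ^+ n * expR (- s) <= n%:R ^+ n.
Proof.
move=> s0; rewrite expRN -ler_pdivlMr ?invr_gt0 ?expR_gt0// invrK.
case: n => [|n]; first by rewrite !expr0 mul1r -expR0 ler_expR.
have n0 : 0 < n.+1%:R :> R by rewrite ltr0n.
have -> : expR s = expR (s / n.+1%:R) ^+ n.+1.
  by rewrite -expRM_natl mulrC divfK// gt_eqF.
have m0 : 0 <= n.+1%:R * expR (s / n.+1%:R) by rewrite mulr_ge0 ?expR_ge0// ltW.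
rewrite -exprMn lerXn2r ?nnegrE//.
rewrite mulrC -ler_pdivrMr//; apply: le_trans (expR_ge1Dx _).
by rewrite lerDr.
Qed.

Lemma poly_expR_bounded p : exists K, 0 <= K /\
  forall s, 0 <= s -> `|p.[s]| * expR (- s) <= K.
Proof.
exists (\sum_(i < size p) `|p`_i| * i%:R ^+ i); split.
  by apply: sumr_ge0 => i _; rewrite mulr_ge0// exprn_ge0.
move=> s s0; rewrite horner_coef.
apply: le_trans (_ : (\sum_(i < size p) `|p`_i * s ^+ i|) * expR (- s) <= _).
  by rewrite ler_wpM2r ?expR_ge0// ler_norm_sum.
rewrite mulr_suml; apply: ler_sum => i _.
by rewrite normrM (ger0_norm (exprn_ge0 _ s0)) -mulrA ler_wpM2l// expR_pow_le.
Qed.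

(* The functions p(1/t) exp(-1/t), extended by 0 to t <= 0, are stable under
   differentiation. *)
Definition expinv p t : R := if 0 < t then p.[t^-1] * expR (- t^-1) else 0.

(** For t > 0 the derivative is t^-2 (p - p')(1/t) exp(-1/t). At 0 the difference quotient for h > 0
    is h times h^-2 p(1/h) exp(-1/h), and the second factor is bounded because X^2 p is again a
    polynomial. *)
Lemma is_derive_expinv p t :
  is_derive t 1 (expinv p : R -> R^o) (expinv ('X^2 * (p - p^`())) t).
Proof.
have [t0|t0|t0] := ltrgt0P t.
- pose g : R -> R^o := fun s => p.[s^-1] * expR (- s^-1).
  apply: (@near_eq_is_derive _ _ _ g).
    near=> s; rewrite /expinv ifT//; near: s; exact: lt_nbhsr.
  have tn0 : t != 0 by rewrite gt_eqF.
  have dV : is_derive t 1 (fun s : R => s^-1 : R^o) (- t ^- 2).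
    have := is_deriveV tn0 (@is_derive_id _ _ t 1).
    by rewrite [_%:A]mulr1.
  have d1 := @is_derive1_comp R (horner p) _ t _ _ (is_derive_poly p t^-1) dV.
  have d2 := @is_derive1_comp R expR _ t _ _ (is_derive_expR (- t^-1)) (is_deriveN dV).
  apply: (is_derive_eq (is_deriveM d1 d2)).
  rewrite /expinv t0 hornerM hornerXn hornerD hornerN.
  rewrite -[(expR \o _) t]/(expR (- t^-1)) -[(horner p \o _) t]/(p.[t^-1]).
  by rewrite /GRing.scale/=; field.
- rewrite [X in is_derive _ _ _ X](_ : _ = 0); last by rewrite /expinv ltNge ltW.
  apply: (near_eq_is_derive _ (@is_derive_cst _ _ _ (0 : R^o) t 1)).
  near=> s; rewrite /expinv ltNge ltW//=; near: s; exact: lt_nbhsl.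
rewrite t0 /expinv ltxx.
have [K [K0 hK]] := poly_expR_bounded ('X^2 * p).
suff cv : (fun h : R => h^-1 *: ((expinv p \o shift (0 : R)) (h *: 1) - expinv p 0 : R^o))
    @ 0^' --> (0 : R^o).
  by apply: DeriveDef; [apply/cvg_ex; exists 0|exact: cvg_lim].
apply/cvgrPdist_le => e e0; near=> h.
rewrite sub0r normrN /= addr0 /GRing.scale/= mulr1 /expinv ltxx subr0.
case: ifPn => h0; last by rewrite mulr0 normr0 ltW.
have hi0 : 0 <= h^-1 by rewrite invr_ge0 ltW.
rewrite normrM (normrM p.[_]) (ger0_norm (expR_ge0 _)) (ger0_norm hi0).
have := hK _ hi0; rewrite hornerM hornerXn normrM (ger0_norm (exprn_ge0 _ hi0)).
move=> hle; apply: le_trans (_ : h * K <= _).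
  apply: le_trans (_ : h * (h^-1 ^+ 2 * `|p.[h^-1]| * expR (- h^-1)) <= _).
    rewrite le_eqVlt; apply/orP; left; apply/eqP.
    by field; rewrite gt_eqF.
  by rewrite ler_wpM2l// ltW.
have K1 : 0 < K + 1 by rewrite ltr_wpDl.
apply: (@le_trans _ _ (h * (K + 1))); first by rewrite ler_wpM2l ?(ltW h0)// lerDl.
rewrite -ler_pdivlMr// -(gtr0_norm h0); near: h; apply: dnbhs0_le.
by rewrite divr_gt0// ltr_wpDl.
Unshelve. all: by end_near. Qed.

End exp_inv.

Section bumps.
Context {R : realType} {N : nat}.
Implicit Types (f g : 'rV[R]_N -> R^o) (a b x : 'rV[R]_N).

(** Smoothness speaks of all iterated partial derivatives, so it is proved for a class closed under
    them: the algebra generated by constants and [expinv] of affine functions of one coordinate. *)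
Inductive expinv_algebra : ('rV[R]_N -> R^o) -> Prop :=
| expinv_cst c : expinv_algebra (fun=> c)
| expinv_add f g : expinv_algebra f -> expinv_algebra g ->
    expinv_algebra (fun x => f x + g x)
| expinv_mul f g : expinv_algebra f -> expinv_algebra g ->
    expinv_algebra (fun x => f x * g x)
| expinv_gen p (c d : R) (i : 'I_N) :
    expinv_algebra (fun x => expinv p (c * x ord0 i + d)).

Lemma differentiable_affine_coord (c d : R) (i : 'I_N) x :
  differentiable (fun y : 'rV[R]_N => c * y ord0 i + d : R^o) x.
Proof.
apply: (@differentiableD _ _ _ (c *: (fun y : 'rV[R]_N => y ord0 i : R^o)) (cst d)).
  by apply: differentiableZ; exact: differentiable_coord.
exact: differentiable_cst.
Qed.

Lemma expinv_algebra_differentiable f : expinv_algebra f -> forall x, differentiable f x.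
Proof.
elim=> {f} [c|f g _ df _ dg|f g _ df _ dg|p c d i] x.
- exact: differentiable_cst.
- exact: differentiableD.
- exact: differentiableM.
- apply: (@differentiable_comp _ _ _ _ (fun y : 'rV[R]_N => c * y ord0 i + d : R^o) (expinv p)).
    exact: differentiable_affine_coord.
  by apply/derivable1_diffP; have [] := is_derive_expinv p (c * x ord0 i + d).
Qed.

Lemma expinv_algebra_partial f : expinv_algebra f ->
  forall j, expinv_algebra (partial j f).
Proof.
elim=> {f} [c|f g hf pf hg pg|f g hf pf hg pg|p c d i] j.
- rewrite (_ : partial j _ = fun=> 0); first exact: expinv_cst.
  by apply/funext => x; exact: derive_cst.
- rewrite (_ : partial j _ = fun x => partial j f x + partial j g x).
    exact: expinv_add.
  apply/funext => x; rewrite -[RHS]/('D__ f x + 'D__ g x) -deriveD//;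
    exact/diff_derivable/expinv_algebra_differentiable.
- rewrite (_ : partial j _ = fun x => f x * partial j g x + partial j f x * g x).
    by apply: expinv_add; exact: expinv_mul.
  by apply/funext => x; rewrite partialM//; exact: expinv_algebra_differentiable.
- rewrite (_ : partial j _ = fun x => expinv ('X^2 * (p - p^`())) (c * x ord0 i + d) *
      (c * (i == j)%:R)).
    by apply: expinv_mul; [exact: expinv_gen|exact: expinv_cst].
  apply/funext => x; rewrite /partial.
  pose v : 'rV[R]_N := delta_mx ord0 j.
  have df : differentiable (fun x : 'rV[R]_N => expinv p (c * x ord0 i + d) : R^o) x.
    exact: expinv_algebra_differentiable (expinv_gen p c d i) x.
  have h1 : is_derive (x + (0 : R) *: v) v
      (fun x : 'rV[R]_N => expinv p (c * x ord0 i + d) : R^o)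
      ('D_v (fun x : 'rV[R]_N => expinv p (c * x ord0 i + d) : R^o) x).
    by rewrite scale0r addr0; exact/derivableP/diff_derivable.
  have h2 := is_derive_line h1.
  have E : (fun s : R => expinv p (c * (x + s *: v) ord0 i + d) : R^o) =
      (expinv p) \o (fun s : R => (c * (i == j)%:R) * s + (c * x ord0 i + d)).
    by apply/funext => s /=; rewrite !mxE eqxx/=; congr expinv; ring.
  rewrite E in h2.
  have h3 : is_derive (0 : R) 1
      (fun s : R => (c * (i == j)%:R) * s + (c * x ord0 i + d) : R^o) (c * (i == j)%:R).
    have h := is_deriveD (is_deriveZ (c * (i == j)%:R) (@is_derive_id _ _ (0 : R) 1))
        (@is_derive_cst _ _ _ (c * x ord0 i + d : R^o) (0 : R) 1).
    by apply: (is_derive_eq h); rewrite addr0 [_%:A]mulr1.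
  have h4 : is_derive ((c * (i == j)%:R) * 0 + (c * x ord0 i + d) : R) 1 (expinv p : R -> R^o)
      (expinv ('X^2 * (p - p^`())) (c * x ord0 i + d)).
    by rewrite mulr0 add0r; exact: is_derive_expinv.
  have h5 := @is_derive1_comp R (expinv p) _ 0 _ _ h4 h3.
  by rewrite -(@derive_val _ _ _ _ _ _ _ h2) (@derive_val _ _ _ _ _ _ _ h5).
Qed.

Lemma expinv_algebra_smooth f : expinv_algebra f -> smooth f.
Proof.
move=> hf s; apply: expinv_algebra_differentiable.
by elim: s => //= j s ih; exact: expinv_algebra_partial.
Qed.

(** A product of exp(-1/s) over the distances to the faces, each scaled by k+1. As k grows it tends
    to the indicator of the open box, with values in [0, 1], as dominated convergence requires. *)
Definition bump a b (k : nat) : 'rV[R]_N -> R^o := fun x =>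
  \prod_(i < N) (expinv 1 (k.+1%:R * (x ord0 i - a ord0 i)) *
                 expinv 1 (k.+1%:R * (b ord0 i - x ord0 i))).

Lemma smooth_bump a b k : smooth (bump a b k).
Proof.
apply: expinv_algebra_smooth; rewrite /bump.
elim: (index_enum _) => [|i s ih].
  rewrite (_ : (fun _ => _) = fun=> 1); first exact: expinv_cst.
  by apply/funext => x; rewrite big_nil.
rewrite (_ : (fun _ => _) = fun x => (expinv 1 (k.+1%:R * x ord0 i + - (k.+1%:R * a ord0 i)) *
    expinv 1 (- k.+1%:R * x ord0 i + k.+1%:R * b ord0 i)) *
  \prod_(j <- s) (expinv 1 (k.+1%:R * (x ord0 j - a ord0 j)) *
                 expinv 1 (k.+1%:R * (b ord0 j - x ord0 j)))).
  by apply: expinv_mul => //; apply: expinv_mul; exact: expinv_gen.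
apply/funext => x; rewrite big_cons; congr (expinv _ _ * expinv _ _ * _); by ring.
Qed.

Lemma expinv1_bound (t : R) : 0 <= expinv 1 t <= 1.
Proof.
rewrite /expinv; case: ifPn => [t0|_]; last by rewrite lexx ler01.
rewrite hornerC mul1r expR_ge0/= -expR0 ler_expR oppr_le0 invr_ge0 ltW//.
Qed.

Lemma bump_bound a b k x : 0 <= bump a b k x <= 1.
Proof.
have h i : 0 <= expinv 1 (k.+1%:R * (x ord0 i - a ord0 i)) *
                 expinv 1 (k.+1%:R * (b ord0 i - x ord0 i)) <= 1.
  have /andP[h1 h2] := expinv1_bound (k.+1%:R * (x ord0 i - a ord0 i)).
  have /andP[h3 h4] := expinv1_bound (k.+1%:R * (b ord0 i - x ord0 i)).
  by rewrite mulr_ge0//= mulr_ile1.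
rewrite prodr_ge0/=; last by move=> i _; have /andP[] := h i.
by apply: prodr_ile1 => i _; exact: h.
Qed.

Lemma bump_out a b k x : ~ obox a b x -> bump a b k x = 0.
Proof.
move=> nx; apply/eqP/negPn/negP => h; apply: nx => i.
have k0 : 0 < k.+1%:R :> R by rewrite ltr0n.
move: h => /prodf_neq0/(_ i isT).
rewrite mulf_eq0 negb_or /expinv => /andP[].
rewrite pmulr_rgt0// subr_gt0 pmulr_rgt0// subr_gt0.
by case: ifP => [_ _|]; rewrite ?eqxx//; case: ifP => //; rewrite eqxx.
Qed.

Lemma expinv1_cvg (t : R) : 0 < t -> expinv 1 (k.+1%:R * t) @[k --> \oo] --> (1 : R).
Proof.
move=> t0; rewrite (_ : (fun _ => _) = fun k => expR (- (t^-1 * k.+1%:R^-1))).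
  rewrite -[X in _ --> X](expR0 R); apply: continuous_cvg; first exact: continuous_expR.
  rewrite -[X in _ --> X]oppr0 -[X in _ --> - X](mulr0 t^-1); apply: cvgN; apply: cvgMr.
  exact: cvg_harmonic.
by apply/funext => k; rewrite /expinv pmulr_rgt0 ?t0// hornerC mul1r invfM mulrC.
Qed.

Lemma bump_cvg a b x : obox a b x -> bump a b k x @[k --> \oo] --> (1 : R).
Proof.
move=> hx; rewrite /bump; elim: (index_enum _) => [|i s ih].
  by under eq_fun do rewrite big_nil; exact: cvg_cst.
under eq_fun do rewrite big_cons.
have /andP[h1 h2] := hx i; rewrite -subr_gt0 in h1; rewrite -subr_gt0 in h2.
have h := cvgM (cvgM (expinv1_cvg h1) (expinv1_cvg h2)) ih.
by rewrite !mulr1 in h; exact: h.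
Qed.

Lemma test_bump (Omega : set 'rV[R]_N) a b k : cbox a b `<=` Omega ->
  test_function Omega (bump a b k).
Proof.
move=> abO.
have sub : closure [set x | bump a b k x != 0] `<=` cbox a b.
  have cl : closed (cbox a b).
    exact: (compact_closed (@norm_hausdorff _ _) (@compact_cbox _ _ a b)).
  rewrite ((closure_id _).1 cl); apply: closure_subset => x /= nx.
  have : obox a b x by apply: contrapT => /(bump_out k)/eqP; rewrite (negbTE nx).
  by move=> h i; have /andP[/ltW -> /ltW ->] := h i.
split; [exact: smooth_bump| |exact: subset_trans sub abO].
by apply: subclosed_compact (@compact_cbox _ _ a b) sub; exact: closed_closure.
Qed.

End bumps.

(** Open boxes are stable under intersection, so this generation statement is the input of Dynkin
    induction in the fundamental lemma. *)
Lemma measurable_rV_generated (R : realType) (n : nat) :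
  @measurable _ 'rV[R]_n = <<s [set A : set 'rV[R]_n | exists a b, A = obox a b] >>.
Proof.
set G := [set A | _].
apply/seteqP; split; last first.
  apply: smallest_sub; first exact: sigma_algebra_measurable.
  by move=> _ [a [b ->]]; exact: measurable_obox.
have openG (U : set 'rV[R]_n) : open U -> <<s G >> U.
  move=> oU; have [->|/set0P U0] := eqVneq U set0; first exact: sigma_algebra0.
  have [a [b [_ ->]]] := open_boxes oU U0.
  apply: sigma_algebra_bigcup => k; apply: sub_sigma_algebra.
  by exists (a k), (b k).
apply: smallest_sub; first exact: smallest_sigma_algebra.
rewrite -bigcup_seq; apply: bigcup_sub => i _ B [C mC <-].
have mi : measurable_fun setT ((fun x => x ord0 i) : g_sigma_algebraType G -> R).
  apply: (measurability _ (RGenOpens.measurableE R)).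
  move=> _ [_ [a [b ->] <-]]; rewrite setTI; apply: openG.
  have /continuousP : continuous (fun x : 'rV[R]_n => x ord0 i) by exact: coord_continuous.
  by apply; exact: interval_open.
exact: mi.
Qed.

Section fundamental_lemma.
Context {R : realType} {N : nat} (Omega : set 'rV[R]_N).
Hypothesis oO : open Omega.
Local Notation leb := (@lebesgue_rV R N).

Let mO : measurable Omega. Proof. exact: open_measurable_rV. Qed.

Variable g : 'rV[R]_N -> R.
Hypothesis g2 : g \_ Omega \in Lfun leb 2%:E.
Hypothesis g0 : forall phi, test_function Omega phi ->
  \int[leb]_(x in Omega) (g x * phi x) = 0.

Let g_box a b : cbox a b `<=` Omega -> leb.-integrable (cbox a b) (EFin \o g).
Proof.
move=> abO; have mb := measurable_cbox a b.
have h1 : g \_ (cbox a b) \in Lfun leb 2%:E.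
  apply: (Lfun2_le _ g2).
    apply/(measurable_restrictT _ _).1 => //.
    have /(Lfun2_restrictP mO)[mg _] := g2.
    exact: measurable_funS mg.
  move=> x; rewrite !patchE; case: ifPn => [/set_mem/abO|_].
    by move=> Ox; rewrite mem_set.
  by rewrite normr0.
have h2 : (cst 1 : _ -> R) \_ (cbox a b) \in Lfun leb 2%:E.
  apply/(Lfun2_restrictP mb); split; first exact: measurable_cst.
  apply/integrableP; split.
    by apply/measurable_EFinP; apply: measurable_funX; exact: measurable_cst.
  under eq_integral do rewrite /= expr1n normr1.
  by rewrite integral_cst// mul1e; exact: cbox_finite.
have := Lfun2_restrict_mul mb h1 h2.
by apply: eq_integrable => // x _ /=; rewrite mulr1.
Qed.

Let obox_sub (a b : 'rV[R]_N) : obox a b `<=` cbox a b.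
Proof. by move=> x h i; have /andP[/ltW -> /ltW ->] := h i. Qed.

(** Bumps on the box are admissible test functions, and they converge to its indicator under the
    dominating function |g| on the closed box. *)
Let integral_obox a b : cbox a b `<=` Omega -> (\int[leb]_(x in obox a b) (g x)%:E = 0)%E.
Proof.
move=> abO; have oab : obox a b `<=` Omega by exact: subset_trans (@obox_sub a b) abO.
have /(Lfun2_restrictP mO)[mg _] := g2.
have mb := measurable_cbox a b; have mob := measurable_obox a b.
have [] := @dominated_convergence _ _ _ leb Omega mO
  (fun k x => (g x * bump a b k x)%:E) (EFin \o (g \_ (obox a b)))
  (EFin \o (fun x => `|(g \_ (cbox a b)) x|)).
- move=> k; apply/measurable_EFinP; apply: measurable_funM => //.
  apply: measurable_funTS; apply: continuous_measurable_rV.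
  exact: smooth_continuous (smooth_bump a b k).
- apply/measurable_EFinP; apply: measurable_funTS.
  apply/(measurable_restrictT _ _).1 => //; exact: measurable_funS mg.
- apply: aeW => x Ox; apply: cvg_EFin; first exact: nearW.
  rewrite patchE; case: ifPn => [/set_mem hx|/negP].
    by rewrite -[X in _ --> X]mulr1; apply: cvgMr; exact: bump_cvg.
  rewrite inE => hx; under eq_fun do rewrite (bump_out _ hx) mulr0.
  exact: cvg_cst.
- apply: (@integrableS _ _ _ _ setT) => //.
  have := (integrable_mkcond _ mb).1 (g_box abO); rewrite restrict_EFin => h.
  exact: integrable_norm h.
- apply: aeW => x k Ox /=; rewrite lee_fin patchE; case: ifPn => [_|/negP].
    have /andP[h1 h2] := bump_bound a b k x.
    by rewrite normrM (ger0_norm h1) ler_piMr.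
  rewrite inE => hx; rewrite (@bump_out _ _ a b k) ?mulr0 ?normr0//.
  by move=> /obox_sub.
move=> _ _ cv.
have E k : (\int[leb]_(x in Omega) (g x * bump a b k x)%:E = 0)%E.
  have tb := test_bump k abO.
  have h := g0 tb.
  rewrite -[LHS]fineK; first by rewrite -[fine _]/(Rintegral _ _ _) h.
  apply: integrable_fin_num => //.
  exact: (@Lfun2_restrict_mul _ _ _ mO g (bump a b k : _ -> R) g2 (test_Lfun2 mO tb)).
have -> : (\int[leb]_(x in obox a b) (g x)%:E = 
  \int[leb]_(x in Omega) (EFin \o (g \_ (obox a b))) x)%E.
  rewrite -restrict_EFin -integral_mkcondr; congr integral.
  by rewrite setIidr.
apply/esym/(cvg_unique _ _ cv) => //=.
by under eq_fun do rewrite E; exact: cvg_cst.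
Qed.

(** On each box Q of a countable cover, the sets E for which g has zero integral over E and Q form a
    Dynkin system. It contains the open boxes, their intersection with Q being a box, hence all
    measurable sets; so g vanishes a.e. on Q. *)
Lemma fundamental_lemma : {ae leb, forall x, Omega x -> g x = 0}.
Proof.
have [->|/set0P O0] := eqVneq Omega set0; first exact: aeW.
have [a [b [abO OE]]] := open_boxes oO O0.
have Q0 k (E : set 'rV[R]_N) : measurable E ->
    (\int[leb]_(x in E `&` obox (a k) (b k)) (g x)%:E = 0)%E.
  set Q := obox _ _; have mQ : measurable Q by exact: measurable_obox.
  have iQ : leb.-integrable Q (EFin \o g).
    by apply: integrableS (g_box (abO k)) => //; [exact: measurable_cbox|exact: obox_sub].
  rewrite measurable_rV_generated.
  apply: (@dynkin_induction _ 'rV[R]_N _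
    (fun E => \int[leb]_(x in E `&` Q) (g x)%:E = 0)%E (measurable_rV_generated R N)).
  - move=> _ _ [a1 [b1 ->]] [a2 [b2 ->]].
    exists (\row_i Num.max (a1 ord0 i) (a2 ord0 i)), (\row_i Num.min (b1 ord0 i) (b2 ord0 i)).
    apply/seteqP; split => [x [h1 h2] i|x h].
      have := h1 i; have := h2 i; rewrite !mxE gt_max lt_min.
      by move=> /andP[-> ->] /andP[-> ->].
    split=> i; have := h i; rewrite !mxE gt_max lt_min => /andP[/andP[h1 h2] /andP[h3 h4]].
      by rewrite h1 h3.
    by rewrite h2 h4.
  - by rewrite setTI; exact: integral_obox.
  - move=> _ [a1 [b1 ->]].
    have -> : obox a1 b1 `&` Q = obox (\row_i Num.max (a1 ord0 i) (a k ord0 i))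
        (\row_i Num.min (b1 ord0 i) (b k ord0 i)).
      apply/seteqP; split => [x [h1 h2] i|x h].
        have := h1 i; have := h2 i; rewrite !mxE gt_max lt_min.
        by move=> /andP[-> ->] /andP[-> ->].
      split=> i; have := h i; rewrite !mxE gt_max lt_min => /andP[/andP[h1 h2] /andP[h3 h4]].
        by rewrite h1 h3.
      by rewrite h2 h4.
    apply: integral_obox; apply: subset_trans (abO k) => x h i.
    have := h i; rewrite !mxE ge_max le_min => /andP[/andP[h1 h2] /andP[h3 h4]].
    by rewrite h2 h4.
  - move=> S mS S0.
    have : (\int[leb]_(x in Q) (g x)%:E = 0)%E by exact: integral_obox.
    have QE : Q = (S `&` Q) `|` (~` S `&` Q) by rewrite -setIUl setUv setTI.
    rewrite {1}QE integral_setU_EFin.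
    + by rewrite S0 add0e.
    + exact: measurableI.
    + by apply: measurableI => //; exact: measurableC.
    + apply/measurable_EFinP; apply: measurable_funS (measurable_int _ iQ) => //.
      by move=> x [[]|[]].
    + by apply/disj_setPS => x [[Sx _] [nSx _]].
  - move=> F mF tF F0; rewrite setI_bigcupl integral_bigcup.
    + by apply: eseries0 => i _ _; exact: F0.
    + exact: trivIset_setIr.
    + by move=> i; exact: measurableI.
    + apply: integrableS iQ => //.
      * by apply: bigcupT_measurable => i; exact: measurableI.
      * by move=> x [i _ []].
have aeQ k : {ae leb, forall x, obox (a k) (b k) x -> g x = 0}.
  have mQ := measurable_obox (a k) (b k).
  have iQ : leb.-integrable (obox (a k) (b k)) (EFin \o g).
    by apply: integrableS (g_box (abO k)) => //; exact: measurable_cbox.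
  have : ae_eq leb (obox (a k) (b k)) (EFin \o g) (cst 0%E).
    apply: (integral_ae_eq mQ iQ) => [|E EQ mE]; first exact: measurable_cst.
    by rewrite integral0 -(Q0 k E mE) setIidl.
  by apply: filterS => x /[apply] -[].
have := ae_foralln aeQ; apply: filterS => x h; rewrite OE => -[k _]; exact: h.
Qed.

End fundamental_lemma.

(** * The space of solenoidal fields *)

Section weak_gradients.
Context {R : realType} {N : nat} (Omega : set 'rV[R]_N).
Hypothesis oO : open Omega.
Local Notation leb := (@lebesgue_rV R N).
Implicit Types (y z : 'rV[R]_N -> 'rV[R]_N) (G H : 'rV[R]_N -> 'M[R]_N).

Let mO : measurable Omega. Proof. exact: open_measurable_rV. Qed.

Lemma frob_delta m n (A : 'M[R]_(m, n)) c i j : frob A (c *: delta_mx i j) = A i j * c.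
Proof.
rewrite /frob (bigD1 i)//= (bigD1 j)//= !mxE !eqxx mulr1.
rewrite big1 ?addr0 => [|l lj]; last by rewrite !mxE (negbTE lj) andbF !mulr0.
rewrite big1 ?addr0// => k ki; rewrite big1// => l _.
by rewrite !mxE (negbTE ki) !mulr0.
Qed.

Lemma L2_delta m n (f : 'rV[R]_N -> R) (i : 'I_m) (j : 'I_n) :
  f \_ Omega \in Lfun leb 2%:E -> L2 Omega (fun x => f x *: delta_mx i j).
Proof.
move=> f2 k l.
rewrite (_ : _ \_ _ = (fun x => (delta_mx i j k l : R) * (f \_ Omega) x + (cst 0 : _ -> R) x)).
  apply: Lfun2_lin => //.
  apply/Lfun2P; split=> //; rewrite (_ : EFin \o _ = cst 0%E); first exact: integrable0.
  by apply/funext => x /=; rewrite expr0n.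
apply/funext => x; rewrite !patchE !mxE addr0.
by case: ifPn => _; rewrite ?mulr0// mulrC.
Qed.

Lemma L2B m n (f g : 'rV[R]_N -> 'M[R]_(m, n)) : L2 Omega f -> L2 Omega g ->
  L2 Omega (f - g).
Proof. exact: (hilbertB_in (hilbert_L2 mO)). Qed.

Lemma L2_dot_le m n p q (c : R) (f : 'rV[R]_N -> 'M[R]_(m, n))
    (g : 'rV[R]_N -> 'M[R]_(p, q)) : L2 Omega f -> L2 Omega g ->
  (forall x, frob (f x) (f x) <= c * frob (g x) (g x)) ->
  L2_dot Omega f f <= c * L2_dot Omega g g.
Proof.
move=> hf hg fg; rewrite /L2_dot -RintegralZl//; last exact: frob_integrable.
apply: le_Rintegral => //; first exact: frob_integrable.
have := integrableZl mO c (frob_integrable mO hg hg).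
by apply: eq_integrable => // x _ /=; rewrite EFinM.
Qed.

Lemma L2_dotBC m n (f g : 'rV[R]_N -> 'M[R]_(m, n)) :
  L2_dot Omega (f - g) (f - g) = L2_dot Omega (g - f) (g - f).
Proof.
apply: eq_Rintegral => x _; rewrite -[(f - g) x]/(f x - g x) -[(g - f) x]/(g x - f x).
by rewrite -opprB -scaleN1r frobZl frobZr mulrA mulrNN !mul1r.
Qed.

(** Pairing with multiples of matrix units turns the scalar identities into L2 products, so that
    linearity and passage to the limit come from the Hilbert space lemmas. *)
Lemma weak_gradientP y G : L2 Omega y -> (weak_gradient Omega y G <->
  L2 Omega G /\ forall i j phi, test_function Omega phi ->
    L2_dot Omega y (fun x => partial j phi x *: delta_mx ord0 i) =
    - L2_dot Omega G (fun x => phi x *: delta_mx i j)).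
Proof.
move=> hy; split=> -[hG h]; split=> // i j phi tphi; have := h i j phi tphi.
  move=> e; rewrite /L2_dot; under eq_Rintegral do rewrite frob_delta.
  by rewrite e; congr (- _); apply: eq_Rintegral => x _; rewrite frob_delta.
rewrite /L2_dot; under eq_Rintegral do rewrite frob_delta.
by move=> ->; congr (- _); apply: eq_Rintegral => x _; rewrite frob_delta.
Qed.

Lemma weak_gradient_lin a y z G H : L2 Omega y -> L2 Omega z ->
  weak_gradient Omega y G -> weak_gradient Omega z H ->
  weak_gradient Omega (a *: y + z) (a *: G + H).
Proof.
move=> hy hz /(weak_gradientP _ hy)[hG yG] /(weak_gradientP _ hz)[hH zH].
have hyz : L2 Omega (a *: y + z) by exact: L2_lin.
apply/(weak_gradientP _ hyz); split; first exact: L2_lin.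
move=> i j phi tphi; have h1 := L2_delta (ord0 : 'I_1) i (test_Lfun2 mO (test_partial j tphi)).
have h2 := L2_delta i j (test_Lfun2 mO tphi).
rewrite (hilbert_form (hilbert_L2 mO))// (hilbert_form (hilbert_L2 mO))//.
by rewrite yG// zH//; ring.
Qed.

Lemma weak_gradient_unique y G H : L2 Omega y ->
  weak_gradient Omega y G -> weak_gradient Omega y H ->
  {ae leb, forall x, Omega x -> G x = H x}.
Proof.
move=> hy [hG yG] [hH yH].
have h i j : {ae leb, forall x, Omega x -> G x i j - H x i j = 0}.
  apply: (fundamental_lemma oO (g := fun x => G x i j - H x i j)) => [|phi tphi].
    rewrite (_ : (fun x => G x i j - H x i j) = (fun x => (G - H) x i j)).
      exact: L2B.
    by apply/funext => x; rewrite !mxE.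
  have p2 := test_Lfun2 mO tphi.
  transitivity (\int[leb]_(x in Omega) (G x i j * phi x - H x i j * phi x)).
    by apply: eq_Rintegral => x _; rewrite mulrBl.
  rewrite RintegralB//; last 2 first.
  - exact: (@Lfun2_restrict_mul _ _ _ mO (fun x => G x i j) _ (hG i j) p2).
  - exact: (@Lfun2_restrict_mul _ _ _ mO (fun x => H x i j) _ (hH i j) p2).
  by apply/eqP; rewrite subr_eq0 -eqr_opp -yG// -yH.
have : {ae leb, forall x, forall i j, Omega x -> G x i j - H x i j = 0}.
  by apply: filter_forall => i; apply: filter_forall => j; exact: h.
apply: filterS => x e Ox; apply/matrixP => i j; apply/eqP; rewrite -subr_eq0.
by rewrite e.
Qed.

Lemma weak_gradient_grad y G : weak_gradient Omega y G -> weak_gradient Omega y (grad Omega y).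
Proof. by move=> yG; exact: (@xgetPex _ _ [set G | weak_gradient Omega y G]) (ex_intro _ G yG). Qed.

Lemma grad_ae y G : L2 Omega y -> weak_gradient Omega y G ->
  {ae leb, forall x, Omega x -> grad Omega y x = G x}.
Proof.
by move=> hy yG; apply: (weak_gradient_unique hy _ yG); exact: weak_gradient_grad yG.
Qed.

(* The graph of the gradient on the H1-closure of the test fields. *)
Definition approx y G := [/\ L2 Omega y, L2 Omega G &
  exists phi : nat -> 'rV[R]_N -> 'rV[R]_N, [/\ forall k, test_field Omega (phi k),
    L2_dot Omega (phi k - y) (phi k - y) @[k --> \oo] --> (0 : R) &
    L2_dot Omega (tgrad (phi k) - G) (tgrad (phi k) - G) @[k --> \oo] --> (0 : R)]].

Lemma approx_weak_gradient y G : approx y G -> weak_gradient Omega y G.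
Proof.
case=> hy hG [phi [tphi cy cG]]; apply/weak_gradientP => //; split=> // i j psi tpsi.
have h1 := L2_delta (ord0 : 'I_1) i (test_Lfun2 mO (test_partial j tpsi)).
have h2 := L2_delta i j (test_Lfun2 mO tpsi).
have c1 := hilbert_cvg (hilbert_L2 mO) (fun k => L2_test_field mO (tphi k)) hy h1 cy.
have c2 := hilbert_cvg (hilbert_L2 mO) (fun k => L2_tgrad mO (tphi k)) hG h2 cG.
apply: (cvg_unique _ c1) => //.
have E k : L2_dot Omega (phi k) (fun x => partial j psi x *: delta_mx ord0 i) =
    - L2_dot Omega (tgrad (phi k)) (fun x => psi x *: delta_mx i j).
  have /weak_gradientP := weak_gradient_tgrad mO (tphi k).
  by move=> /(_ (L2_test_field mO (tphi k)))[_]; apply.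
apply: cvg_trans (cvgN c2); apply: near_eq_cvg; apply: nearW => k.
by rewrite E.
Qed.

Lemma approxP y G : L2 Omega y -> L2 Omega G ->
  (forall e, 0 < e -> exists phi, [/\ test_field Omega phi,
    L2_dot Omega (phi - y) (phi - y) < e &
    L2_dot Omega (tgrad phi - G) (tgrad phi - G) < e]) -> approx y G.
Proof.
move=> hy hG h; split=> //.
have /choice[phi hphi] : forall k : nat, exists phi, [/\ test_field Omega phi,
    L2_dot Omega (phi - y) (phi - y) < k.+1%:R^-1 &
    L2_dot Omega (tgrad phi - G) (tgrad phi - G) < k.+1%:R^-1].
  by move=> k; apply: h; rewrite invr_gt0.
exists phi; split => [k||]; first by have [] := hphi k.
- apply: (squeeze_cvgr _ (@cvg_cst _ 0 _ _ _) (@cvg_harmonic R)).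
  apply: nearW => k; have [tk h1 _] := hphi k.
  apply/andP; split; last exact: ltW.
  by apply: (hilbert_ge0 (hilbert_L2 mO)); apply: L2B => //; exact: L2_test_field.
- apply: (squeeze_cvgr _ (@cvg_cst _ 0 _ _ _) (@cvg_harmonic R)).
  apply: nearW => k; have [tk _ h1] := hphi k.
  apply/andP; split; last exact: ltW.
  by apply: (hilbert_ge0 (hilbert_L2 mO)); apply: L2B => //; exact: L2_tgrad.
Qed.

Lemma L2_dot_sq2 m n (f g h : 'rV[R]_N -> 'M[R]_(m, n)) :
  L2 Omega f -> L2 Omega g -> L2 Omega h ->
  L2_dot Omega (f - h) (f - h) <=
  2 * L2_dot Omega (f - g) (f - g) + 2 * L2_dot Omega (g - h) (g - h).
Proof.
move=> hf hg hh; have L := hilbert_L2 mO (m := m) (n := n).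
have h1 := L2B hf hg; have h2 := L2B hg hh.
have -> : f - h = (f - g) + (1 : R) *: (g - h) by rewrite scale1r addrA subrK.
rewrite (hilbert_sqD L)//.
have := hilbert_ge0 L (L2B h1 h2); rewrite (hilbert_sqB L)//; lra.
Qed.

(** Diagonal argument: choose k, then a test field close to the k-th pair. *)
Lemma approx_closed (y_ : nat -> 'rV[R]_N -> 'rV[R]_N) (G_ : nat -> 'rV[R]_N -> 'M[R]_N) y G :
  (forall k, approx (y_ k) (G_ k)) -> L2 Omega y -> L2 Omega G ->
  L2_dot Omega (y_ k - y) (y_ k - y) @[k --> \oo] --> (0 : R) ->
  L2_dot Omega (G_ k - G) (G_ k - G) @[k --> \oo] --> (0 : R) ->
  approx y G.
Proof.
move=> ap hy hG cy cG; apply: approxP => // e e0.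
(* Squared distances add up with a factor 2 each, and 2 e/4 + 2 e/4 = e. *)
have e4 : 0 < e / 4 by lra.
have [k [k1 k2]] : exists k, L2_dot Omega (y_ k - y) (y_ k - y) < e / 4 /\
    L2_dot Omega (G_ k - G) (G_ k - G) < e / 4.
  have /cvgr_lt/(_ _ e4) n1 := cy; have /cvgr_lt/(_ _ e4) n2 := cG.
  by have [k _ /(_ k (leqnn _))] := filterI n1 n2; exists k.
have [hyk hGk [phi [tphi cp cq]]] := ap k.
have [l [l1 l2]] : exists l, L2_dot Omega (phi l - y_ k) (phi l - y_ k) < e / 4 /\
    L2_dot Omega (tgrad (phi l) - G_ k) (tgrad (phi l) - G_ k) < e / 4.
  have /cvgr_lt/(_ _ e4) n1 := cp; have /cvgr_lt/(_ _ e4) n2 := cq.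
  by have [l _ /(_ l (leqnn _))] := filterI n1 n2; exists l.
exists (phi l); split => //.
  by have := L2_dot_sq2 (L2_test_field mO (tphi l)) hyk hy; lra.
by have := L2_dot_sq2 (L2_tgrad mO (tphi l)) hGk hG; lra.
Qed.

Lemma approx_lin a y z G H : approx y G -> approx z H -> approx (a *: y + z) (a *: G + H).
Proof.
case=> hy hG [phi [tphi cy cG]] [hz hH [psi [tpsi cz cH]]].
have bound m n (f_ g_ : nat -> 'rV[R]_N -> 'M[R]_(m, n)) (f g : 'rV[R]_N -> 'M[R]_(m, n)) :
    (forall k, L2 Omega (f_ k)) -> (forall k, L2 Omega (g_ k)) -> L2 Omega f -> L2 Omega g ->
    L2_dot Omega (f_ k - f) (f_ k - f) @[k --> \oo] --> (0 : R) ->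
    L2_dot Omega (g_ k - g) (g_ k - g) @[k --> \oo] --> (0 : R) ->
    L2_dot Omega ((a *: f_ k + g_ k) - (a *: f + g)) ((a *: f_ k + g_ k) - (a *: f + g))
      @[k --> \oo] --> (0 : R).
  move=> hf_ hg_ hf hg cf cg; have L := hilbert_L2 mO (m := m) (n := n).
  have c0 : 2 * (a ^+ 2 * L2_dot Omega (f_ k - f) (f_ k - f)) +
      2 * L2_dot Omega (g_ k - g) (g_ k - g) @[k --> \oo] --> (0 : R).
    rewrite -[X in _ --> X](_ : 2 * (a ^+ 2 * 0) + 2 * 0 = _); last by ring.
    by apply: cvgD; apply: cvgMr => //; exact: cvgMr.
  apply: (squeeze_cvgr _ (@cvg_cst _ 0 _ _ _) c0); apply: nearW => k.
  have hF := L2_lin a (hf_ k) (hg_ k); have hM := L2_lin a hf (hg_ k).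
  have hL := L2_lin a hf hg.
  apply/andP; split; first by apply: (hilbert_ge0 L); exact: L2B.
  apply: le_trans (L2_dot_sq2 hF hM hL) _.
  have -> : (a *: f_ k + g_ k) - (a *: f + g_ k) = a *: (f_ k - f).
    by rewrite scalerBr opprD addrACA subrr addr0.
  have -> : (a *: f + g_ k) - (a *: f + g) = g_ k - g.
    by rewrite opprD addrACA subrr add0r.
  have h1 := L2B (hf_ k) hf.
  rewrite (hilbertZl L)//; last exact: hilbertZ_in L _ _ h1.
  by rewrite (hilbertZr L)// [a * (a * _)]mulrA -expr2.
split; [exact: L2_lin|exact: L2_lin|].
exists (fun k => a *: phi k + psi k); split.
- by move=> k; exact: test_field_lin.
- by apply: bound => // k; exact: L2_test_field.
- rewrite (_ : (fun k => _) = fun k => L2_dot Omega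
     ((a *: tgrad (phi k) + tgrad (psi k)) - (a *: G + H))
     ((a *: tgrad (phi k) + tgrad (psi k)) - (a *: G + H))).
    by apply: bound => // k; exact: L2_tgrad.
  by apply/funext => k; rewrite (tgrad_lin a (tphi k) (tpsi k)).
Qed.

End weak_gradients.

(** * Hilbert structure of the solenoidal fields under the symmetric gradient *)

Section Y_space.
Context {R : realType} {N : nat} (Omega : set 'rV[R]_N).
Hypothesis oO : open Omega.
Variables (k0 : 'I_N) (M : R).
Hypothesis OM : forall x, Omega x -> `|x ord0 k0| <= M.
Local Notation leb := (@lebesgue_rV R N).
Implicit Types (y z : 'rV[R]_N -> 'rV[R]_N) (G H : 'rV[R]_N -> 'M[R]_N).

Let mO : measurable Omega. Proof. exact: open_measurable_rV. Qed.

Lemma korn y G : approx Omega y G ->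
  L2_dot Omega G G <= 2 * L2_dot Omega (sym_part \o G) (sym_part \o G).
Proof.
case=> hy hG [phi [tphi cy cG]].
have L := hilbert_L2 mO (m := N) (n := N).
have hT k := L2_tgrad mO (tphi k).
have c1 := hilbert_cvg_sq L hT hG cG.
have c2 : L2_dot Omega (sym_part \o tgrad (phi k)) (sym_part \o tgrad (phi k))
    @[k --> \oo] --> L2_dot Omega (sym_part \o G) (sym_part \o G).
  apply: (hilbert_cvg_sq L) => [k||]; [exact: L2_sym_part|exact: L2_sym_part|].
  apply: (squeeze_cvgr _ (@cvg_cst _ 0 _ _ _) cG); apply: nearW => k.
  have hB := L2B oO (hT k) hG; have hS := L2_sym_part mO hB.
  have -> : (sym_part \o tgrad (phi k)) - (sym_part \o G) =
      sym_part \o (tgrad (phi k) - G).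
    apply/funext => x; apply/matrixP => i j; rewrite !mxE; ring.
  apply/andP; split; first exact: (hilbert_ge0 L).
  rewrite -[leRHS]mul1r; apply: L2_dot_le => // x.
  by rewrite mul1r; exact: frob_sym_part_le.
apply: (ler_cvg_to c1 (cvgMr c2)); apply: nearW => k /=.
exact: korn_test.
Qed.

Lemma poincare y G : approx Omega y G ->
  L2_dot Omega y y <= 4 * M ^+ 2 * L2_dot Omega G G.
Proof.
case=> hy hG [phi [tphi cy cG]].
have c1 := hilbert_cvg_sq (hilbert_L2 mO) (fun k => L2_test_field mO (tphi k)) hy cy.
have c2 := hilbert_cvg_sq (hilbert_L2 mO) (fun k => L2_tgrad mO (tphi k)) hG cG.
apply: (ler_cvg_to c1 (cvgMr c2)); apply: nearW => k /=.
exact: poincare_test_field (tphi k) OM.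
Qed.

(** [H1_norm] sees y - phi k through its own chosen gradient; uniqueness of weak gradients
    identifies it a.e. with the difference of gradients, and the norm splits into the two required
    convergences. *)
Lemma Y_approx y : Y Omega y -> approx Omega y (grad Omega y).
Proof.
case=> -[[hy [G yG]] [phi [tphi cphi]]] _.
have wg := weak_gradient_grad yG; have [hG _] := wg.
split=> //; exists phi.
have tf k : test_field Omega (phi k) by move=> i; exact: tphi.
have hp k := L2_test_field mO (tf k); have hT k := L2_tgrad mO (tf k).
have wt k := weak_gradient_tgrad mO (tf k).
have hB k := L2B oO hy (hp k).
have wB k : weak_gradient Omega (y - phi k) (grad Omega y - tgrad (phi k)).
  have := weak_gradient_lin oO (-1) (hp k) hy (wt k) wg.
  by rewrite !scaleN1r ![- _ + _]addrC.
have hgB k : L2 Omega (grad Omega (y - phi k)).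
  by have [] := weak_gradient_grad (wB k).
have aB k := grad_ae oO (hB k) (wB k).
have hGT k := L2B oO hG (hT k).
have E k : H1_norm Omega (y \- phi k) ^+ 2 = L2_dot Omega (phi k - y) (phi k - y) +
    L2_dot Omega (tgrad (phi k) - grad Omega y) (tgrad (phi k) - grad Omega y).
  rewrite sqr_sqrtr; last first.
    by apply: addr_ge0; apply: (hilbert_ge0 (hilbert_L2 mO)); [exact: hB|exact: hgB].
  rewrite -[y \- phi k]/(y - phi k) (L2_dotBC Omega (phi k) y).
  rewrite (L2_dotBC Omega (tgrad (phi k)) (grad Omega y)); congr (_ + _).
  exact: (L2_dot_ae mO (hgB k) (hgB k) (hGT k) (hGT k) (aB k) (aB k)).
have c2 : H1_norm Omega (y \- phi k) ^+ 2 @[k --> \oo] --> (0 : R).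
  by rewrite -[X in _ --> X](mulr0 0); exact: cvgM.
split=> //.
- apply: (squeeze_cvgr _ (@cvg_cst _ 0 _ _ _) c2); apply: nearW => k.
  rewrite E; apply/andP; split; first by apply: (hilbert_ge0 (hilbert_L2 mO)); exact: L2B.
  by rewrite lerDl; apply: (hilbert_ge0 (hilbert_L2 mO)); exact: L2B.
- apply: (squeeze_cvgr _ (@cvg_cst _ 0 _ _ _) c2); apply: nearW => k.
  rewrite E; apply/andP; split; first by apply: (hilbert_ge0 (hilbert_L2 mO)); exact: L2B.
  by rewrite lerDr; apply: (hilbert_ge0 (hilbert_L2 mO)); exact: L2B.
Qed.

Lemma approx_Y y G : approx Omega y G ->
  {ae leb, forall x, Omega x -> \tr (G x) = 0} -> Y Omega y.
Proof.
move=> ap trG; have wG := approx_weak_gradient oO ap.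
have [hy hG [phi [tphi cy cG]]] := ap.
have aeG := grad_ae oO hy wG.
split; last by apply: filterS2 aeG trG => x h1 h2 Ox; rewrite h1// h2.
split; first by split=> //; exists G.
exists phi; split; first by move=> k i; exact: tphi.
have hp k := L2_test_field mO (tphi k); have hT k := L2_tgrad mO (tphi k).
have wB k : weak_gradient Omega (phi k - y) (tgrad (phi k) - G).
  have := weak_gradient_lin oO (-1) hy (hp k) wG (weak_gradient_tgrad mO (tphi k)).
  by rewrite !scaleN1r ![- _ + _]addrC.
have wB' k : weak_gradient Omega (y - phi k) (G - tgrad (phi k)).
  have := weak_gradient_lin oO (-1) (hp k) hy (weak_gradient_tgrad mO (tphi k)) wG.
  by rewrite !scaleN1r ![- _ + _]addrC.
have hB k := L2B oO hy (hp k); have hGT k := L2B oO hG (hT k).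
have hgB k : L2 Omega (grad Omega (y - phi k)).
  by have [] := weak_gradient_grad (wB' k).
have -> : (fun k => H1_norm Omega (y \- phi k)) = (fun k => Num.sqrt (
    L2_dot Omega (phi k - y) (phi k - y) + L2_dot Omega (tgrad (phi k) - G) (tgrad (phi k) - G))).
  apply/funext => k; rewrite /H1_norm; congr Num.sqrt.
  rewrite -[y \- phi k]/(y - phi k) (L2_dotBC Omega (phi k) y).
  rewrite (L2_dotBC Omega (tgrad (phi k)) G); congr (_ + _).
  have aB := grad_ae oO (hB k) (wB' k).
  exact: (L2_dot_ae mO (hgB k) (hgB k) (hGT k) (hGT k) aB aB).
rewrite -(sqrtr0 R); apply: (@continuous_cvg _ _ _ _ _ _ _ _ (@sqrt_continuous R 0)).
by rewrite -[X in _ --> X](addr0 0); exact: cvgD.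
Qed.

(** By Korn and Poincaré its seminorm is equivalent to the H1 norm on Y, and the viscous term of the
    state equation is [mu] times it. *)
Definition Ydot y z := L2_dot Omega (eps Omega y) (eps Omega z).

Lemma Y_L2 y : Y Omega y -> L2 Omega y. Proof. by move=> /Y_approx[]. Qed.

Lemma Y_L2_grad y : Y Omega y -> L2 Omega (grad Omega y).
Proof. by move=> /Y_approx[]. Qed.

Lemma Y_L2_eps y : Y Omega y -> L2 Omega (eps Omega y).
Proof. by move=> Yy; exact (L2_sym_part mO (Y_L2_grad Yy)). Qed.

Lemma Y_grad_lin a y z : Y Omega y -> Y Omega z ->
  {ae leb, forall x, Omega x ->
     grad Omega (a *: y + z) x = a *: grad Omega y x + grad Omega z x}.
Proof.
move=> Yy Yz; have wy := approx_weak_gradient oO (Y_approx Yy).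
have wz := approx_weak_gradient oO (Y_approx Yz).
have := weak_gradient_lin oO a (Y_L2 Yy) (Y_L2 Yz) wy wz.
by apply: grad_ae => //; apply: L2_lin; exact: Y_L2.
Qed.

Lemma Y_eps_lin a y z : Y Omega y -> Y Omega z ->
  {ae leb, forall x, Omega x ->
     eps Omega (a *: y + z) x = (a *: eps Omega y + eps Omega z) x}.
Proof.
move=> Yy Yz; apply: filterS (Y_grad_lin a Yy Yz) => x e Ox.
by rewrite /eps e// -!/(sym_part _) sym_part_lin.
Qed.

Lemma Y_lin a y z : Y Omega y -> Y Omega z -> Y Omega (a *: y + z).
Proof.
move=> Yy Yz; apply: (approx_Y (approx_lin oO a (Y_approx Yy) (Y_approx Yz))).
apply: filterS2 Yy.2 Yz.2 => x h1 h2 Ox.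
by rewrite -[(_ + _) x]/(a *: grad Omega y x + grad Omega z x) linearD linearZ /= h1// h2// mulr0 addr0.
Qed.

Lemma Y_0 : Y Omega 0.
Proof.
have ap : approx Omega 0 0.
  split; [exact: L2_0|exact: L2_0|].
  have t0 : test_field Omega 0.
    move=> i; rewrite (_ : (fun _ => _) = fun=> 0); last by apply/funext => x; rewrite mxE.
    have s0 : closure [set x : 'rV[R]_N | (0 : R) != 0] = set0.
      by rewrite (_ : [set _ | _] = set0) ?closure0//; apply/seteqP; split => // x /=; rewrite eqxx.
    split; [|by rewrite s0; exact: compact0|by rewrite s0].
    exact: expinv_algebra_smooth (expinv_cst 0).
  have tg0 : tgrad (0 : 'rV[R]_N -> 'rV[R]_N) = 0.
    have := tgrad_lin (-1) t0 t0; rewrite scaler0 addr0 => ->.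
    by rewrite scaleN1r addrC subrr.
  have d0 m n : L2_dot Omega (0 - 0 : 'rV[R]_N -> 'M[R]_(m, n)) (0 - 0) = 0.
    by rewrite subr0 (hilbert0l (hilbert_L2 mO)); [|exact: L2_0].
  by exists (fun=> 0); split => //; rewrite ?tg0 d0; exact: cvg_cst.
by apply: (approx_Y ap); apply: aeW => x _; rewrite mxtrace0.
Qed.

Lemma Y_korn y : Y Omega y -> L2_dot Omega (grad Omega y) (grad Omega y) <= 2 * Ydot y y.
Proof. by move=> /Y_approx/korn. Qed.

Lemma Y_poincare y : Y Omega y -> L2_dot Omega y y <= 8 * M ^+ 2 * Ydot y y.
Proof.
move=> Yy; apply: le_trans (poincare (Y_approx Yy)) _.
have M2 : 0 <= 4 * M ^+ 2 by apply: mulr_ge0 => //; exact: sqr_ge0.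
apply: le_trans (_ : 4 * M ^+ 2 * (2 * Ydot y y) <= _).
  by rewrite ler_wpM2l//; exact: Y_korn.
by rewrite le_eqVlt; apply/orP; left; apply/eqP; ring.
Qed.

(** For completeness, a Cauchy sequence for [eps] has Cauchy gradients by Korn and is Cauchy in L2
    by Poincaré. The limit pair stays in the closure of the test fields, and the divergence
    constraint passes to L2 limits. *)
Lemma hilbert_Y : hilbert (Y Omega) Ydot.
Proof.
have L m n := hilbert_L2 mO (m := m) (n := n).
have YB u v : Y Omega u -> Y Omega v -> Y Omega (u - v).
  by move=> Yu Yv; rewrite addrC -scaleN1r; exact: Y_lin.
split.
- exact: Y_0.
- exact: Y_lin.
- move=> a u v w Yu Yv Yw; rewrite /Ydot -(hilbert_form (L _ _)); try exact: Y_L2_eps.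
  have hw := Y_L2_eps Yw; have hl := L2_lin a (Y_L2_eps Yu) (Y_L2_eps Yv).
  exact: (L2_dot_ae mO (Y_L2_eps (Y_lin a Yu Yv)) hw hl hw (Y_eps_lin a Yu Yv)
    (aeW _ (fun x _ => erefl))).
- by move=> u v Yu Yv; apply: (hilbertC (L _ _)); exact: Y_L2_eps.
- by move=> u Yu; apply: (hilbert_ge0 (L _ _)); exact: Y_L2_eps.
move=> u Yu cau.
have gB p q : {ae leb, forall x, Omega x ->
    grad Omega (u p - u q) x = (grad Omega (u p) - grad Omega (u q)) x}.
  have := Y_grad_lin (-1) (Yu q) (Yu p); rewrite scaleN1r addrC.
  by apply: filterS => x h Ox; rewrite h// scaleN1r addrC.
have hg p := Y_L2_grad (Yu p).
have gE p q : L2_dot Omega (grad Omega (u p) - grad Omega (u q))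
     (grad Omega (u p) - grad Omega (u q)) =
    L2_dot Omega (grad Omega (u p - u q)) (grad Omega (u p - u q)).
  have h1 := L2B oO (hg p) (hg q); have h2 := Y_L2_grad (YB _ _ (Yu p) (Yu q)).
  by apply/esym; exact: (L2_dot_ae mO h2 h2 h1 h1 (gB p q) (gB p q)).
have [G hG cG] : exists2 G, L2 Omega G &
    L2_dot Omega (grad Omega (u n) - G) (grad Omega (u n) - G) @[n --> \oo] --> (0 : R).
  apply: (hilbert_complete (L _ _)) => // e e0; have e2 : 0 < e / 2 by lra.
  have [n0 hn0] := cau _ e2; exists n0 => p q hp hq; rewrite gE.
  by have := Y_korn (YB _ _ (Yu p) (Yu q)); have := hn0 _ _ hp hq; lra.
have [y hy cy] : exists2 y, L2 Omega y &
    L2_dot Omega (u n - y) (u n - y) @[n --> \oo] --> (0 : R).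
  apply: (hilbert_complete (L _ _)) => [n|e e0]; first exact: Y_L2.
  (* The added 1 allows the division when [M] is 0. *)
  have C0 : 0 < 8 * M ^+ 2 + 1 by rewrite ltr_wpDl// mulr_ge0// sqr_ge0.
  have e2 : 0 < e / (8 * M ^+ 2 + 1) by rewrite divr_gt0.
  have [n0 hn0] := cau _ e2; exists n0 => p q hp hq.
  have YBpq := YB _ _ (Yu p) (Yu q).
  apply: le_lt_trans (Y_poincare YBpq) _.
  have := hn0 _ _ hp hq; rewrite ltr_pdivlMr//; apply: le_lt_trans.
  rewrite [leRHS]mulrC ler_wpM2r// ?lerDl//.
  by apply: (hilbert_ge0 (L _ _)); exact: Y_L2_eps.
have ap := approx_closed oO (fun n => Y_approx (Yu n)) hy hG cy cG.
(* The trace as a 1 x 1 matrix field, so that the L2 product of matrix fields applies to it. *)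
pose tau (A : 'rV[R]_N -> 'M[R]_N) : 'rV[R]_N -> 'M[R]_1 := fun x => (\tr (A x))%:M.
have tauE (A : 'M[R]_N) : frob ((\tr A)%:M : 'M[R]_1) (\tr A)%:M = \tr A ^+ 2.
  by rewrite /frob !big_ord1 mxE eqxx mulr1n expr2.
have tau_le (A : 'M[R]_N) : frob ((\tr A)%:M : 'M[R]_1) (\tr A)%:M <= 
    frob (1%:M : 'M[R]_N) 1%:M * frob A A.
  rewrite tauE mulrC; apply: le_trans (frob_CS A 1%:M).
  suff -> : frob A 1%:M = \tr A by [].
  rewrite /frob /mxtrace; apply: eq_bigr => i _; rewrite (bigD1 i)//= mxE eqxx mulr1.
  by rewrite big1 ?addr0// => j ji; rewrite mxE eq_sym (negbTE ji) mulr0.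
have htau A : L2 Omega A -> L2 Omega (tau A).
  move=> hA.
  have hcA : L2 Omega (Num.sqrt (frob (1%:M : 'M[R]_N) 1%:M) *: A).
    exact: hilbertZ_in (L _ _) _ _ hA.
  apply: (L2_le mO _ hcA) => [i j|x _].
    rewrite (_ : (fun _ => _) = fun x => \sum_k A x k k).
      by apply: measurable_sum => k; exact: L2_measurable hA.
    by apply/funext => x; rewrite !ord1 mxE eqxx.
  rewrite -[(_ *: A) x]/(_ *: (A x)) frobZl frobZr mulrA -expr2 sqr_sqrtr ?frob_ge0//.
  exact: tau_le.
have hGn n := L2B oO (hg n) hG.
(* The gradients of the sequence are trace free, so the trace of G is up to sign that of grad u_n -
   G, which tends to 0 in L2. *)
have tG0 : L2_dot Omega (tau G) (tau G) = 0.
  apply/le_anti; rewrite (hilbert_ge0 (L _ _)) ?andbT; last exact: htau.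
  have cc : frob (1%:M : 'M[R]_N) 1%:M * L2_dot Omega (grad Omega (u n) - G)
      (grad Omega (u n) - G) @[n --> \oo] --> (0 : R).
    by rewrite -[X in _ --> X](mulr0 (frob (1%:M : 'M[R]_N) 1%:M)); exact: cvgMr.
  apply: (cvgr_to_ge cc); apply: nearW => n.
  have -> : L2_dot Omega (tau G) (tau G) =
      L2_dot Omega (tau (grad Omega (u n) - G)) (tau (grad Omega (u n) - G)).
    rewrite /L2_dot; apply: ae_eq_Rintegral => //.
    - by apply: measurable_frob => i j; apply: L2_measurable => //; exact: htau.
    - by apply: measurable_frob => i j; apply: L2_measurable => //; apply: htau.
    - apply: filterS (Yu n).2 => x tx Ox; rewrite !tauE.
      by rewrite -[(_ - G) x]/(grad Omega (u n) x - G x) linearB/= tx// sub0r sqrrN.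
  by apply: (L2_dot_le oO (htau _ (hGn n)) (hGn n)) => x; exact: tau_le.
have trG : {ae leb, forall x, Omega x -> \tr (G x) = 0}.
  apply: filterS (L2_dot_eq0 mO (htau _ hG) tG0) => x h Ox.
  by have := tauE (G x); rewrite -/(tau G x) h// frob0l => /esym/eqP; rewrite sqrf_eq0 => /eqP.
have Yy := approx_Y ap trG; exists y => //.
have c2 : 1 * L2_dot Omega (grad Omega (u n) - G) (grad Omega (u n) - G) @[n --> \oo] --> (0 : R).
  by under eq_fun do rewrite mul1r.
apply: (squeeze_cvgr _ (@cvg_cst _ 0 _ _ _) c2); apply: nearW => n.
have YBn := YB _ _ (Yu n) Yy; have hgB := Y_L2_grad YBn.
apply/andP; split; first by apply: (hilbert_ge0 (L _ _)); exact: Y_L2_eps.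
have gn : {ae leb, forall x, Omega x -> grad Omega (u n - y) x = (grad Omega (u n) - G) x}.
  have := Y_grad_lin (-1) Yy (Yu n); rewrite scaleN1r addrC.
  have gG := grad_ae oO hy (approx_weak_gradient oO ap).
  by apply: filterS2 gG => x h1 h2 Ox; rewrite h2// h1// scaleN1r addrC.
rewrite -(L2_dot_ae mO hgB hgB (hGn n) (hGn n) gn gn).
apply: L2_dot_le => //; first exact: Y_L2_eps.
by move=> x; rewrite mul1r; exact: frob_sym_part_le.
Qed.

(** A field that vanishes a.e. has weak gradient 0. This injectivity of Y into L2 makes L2 dense in
    the dual of Y. *)
Lemma Y_ae0 y : Y Omega y -> L2_dot Omega y y = 0 -> Ydot y y = 0.
Proof.
move=> Yy y0; have hy := Y_L2 Yy; have ae0 := L2_dot_eq0 mO hy y0.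
have w0 : weak_gradient Omega y 0.
  apply/weak_gradientP => //; split; first exact: L2_0.
  move=> i j phi tphi.
  have h1 := L2_delta (ord0 : 'I_1) i (test_Lfun2 mO (test_partial j tphi)).
  have h2 := L2_delta i j (test_Lfun2 mO tphi).
  rewrite (hilbert0l (hilbert_L2 mO) h2) oppr0 -(hilbert0l (hilbert_L2 mO) h1).
  by apply: (L2_dot_ae mO) => //; [exact: L2_0|exact: aeW].
have g0 := grad_ae oO hy w0; have hg := Y_L2_grad Yy.
have Y0 := hilbert_ge0 hilbert_Y Yy.
apply/le_anti; rewrite Y0 andbT.
have z : L2 Omega (0 : 'rV[R]_N -> 'M[R]_N) by exact: L2_0.
rewrite -(hilbert0l (hilbert_L2 mO) z) -(L2_dot_ae mO hg hg z z g0 g0).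
rewrite -[leRHS]mul1r; apply: L2_dot_le => //; first exact: Y_L2_eps.
by move=> x; rewrite mul1r; exact: frob_sym_part_le.
Qed.

End Y_space.

(** * Shrinkage by the yield stress *)

Section mreg_pointwise.
Context {R : realType} {N : nat}.
Variable g : R.
Hypothesis g0 : 0 < g.
Implicit Types E F W Z P : 'M[R]_N.
Local Notation m := (@mreg R N g).

Lemma frob_norm_ge0 E : 0 <= frob_norm E. Proof. exact: sqrtr_ge0. Qed.

Lemma frob_norm_CS E F : frob E F <= frob_norm E * frob_norm F.
Proof.
apply: le_trans (ler_norm _) _.
rewrite -ler_sqr ?nnegrE ?mulr_ge0 ?frob_norm_ge0// exprMn !frob_normE real_normK ?num_real//.
exact: frob_CS.
Qed.

Lemma frob_norm_eq0 E : frob_norm E = 0 -> E = 0.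
Proof. by move=> e; apply: frob_eq0; rewrite -frob_normE e expr0n. Qed.

Lemma mreg_pos E : m E = Num.max 0 (1 - g / frob_norm E) *: E.
Proof.
rewrite /mreg; case: eqVneq => [->|E0]; first by rewrite scaler0.
have n0 : 0 < frob_norm E.
  by rewrite lt_neqAle frob_norm_ge0 andbT eq_sym; apply: contra_neq E0 => /frob_norm_eq0.
congr (_ *: _); have -> : 1 - g / frob_norm E = (frob_norm E - g) / frob_norm E by field; exact: lt0r_neq0.
by rewrite -[in RHS](mul0r (frob_norm E)^-1) maxr_pMl// invr_ge0 ltW.
Qed.

(** A formula without cases whose denominator is at least [g]: the factor is continuous in |E|,
    which gives measurability of m composed with a field. *)
Lemma mreg_max E : m E = (1 - g / Num.max (frob_norm E) g) *: E.
Proof.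
rewrite mreg_pos; case: (leP (frob_norm E) g) => h; last first.
  rewrite max_r// subr_ge0 ler_pdivrMr ?mul1r ?ltW//; exact: lt_trans h.
rewrite divff ?gt_eqF// subrr scale0r; have [n0|n0] := eqVneq (frob_norm E) 0.
  by rewrite (frob_norm_eq0 n0) scaler0.
rewrite max_l ?scale0r// subr_le0 ler_pdivlMr ?mul1r//.
by rewrite lt_neqAle frob_norm_ge0 andbT eq_sym.
Qed.

Lemma mreg_in E : frob_norm E <= g -> m E = 0.
Proof. by move=> h; rewrite mreg_max max_r// divff ?gt_eqF// subrr scale0r. Qed.

Lemma mreg_out E : g < frob_norm E -> m E = (1 - g / frob_norm E) *: E.
Proof. by move=> h; rewrite mreg_max max_l// ltW. Qed.

Lemma mreg0 : m 0 = 0.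
Proof. by rewrite /mreg eqxx. Qed.

Lemma frob_norm_proj E : frob_norm (E - m E) <= g.
Proof.
have [h|h] := leP (frob_norm E) g; first by rewrite mreg_in// subr0.
have n0 := lt_trans g0 h.
rewrite mreg_out// scalerBl scale1r subKr -ler_sqr ?nnegrE ?frob_norm_ge0 ?(ltW g0)//.
rewrite frob_normE frobZl frobZr -frob_normE le_eqVlt; apply/orP; left; apply/eqP.
by field; exact: lt0r_neq0.
Qed.

(* [E - m E] is the projection of [E] onto the ball of radius [g]. *)
Lemma mreg_proj E Z : frob_norm Z <= g -> frob (m E) (Z - (E - m E)) <= 0.
Proof.
move=> hZ; have [h|h] := leP (frob_norm E) g; first by rewrite mreg_in// frob0l.
have n0 := lt_trans g0 h.
rewrite mreg_out// frobZl mulr_ge0_le0//.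
  by rewrite subr_ge0 ler_pdivrMr// mul1r ltW.
rewrite scalerBl scale1r subKr frobBr frobZr -frob_normE subr_le0.
apply: le_trans (frob_norm_CS E Z) _.
rewrite (_ : g / _ * _ = frob_norm E * g); last by field; exact: lt0r_neq0.
by rewrite ler_wpM2l// ltW.
Qed.

(** Firm nonexpansiveness: add the two obtuse-angle inequalities, each projection tested against the
    other. As E - F is the sum of the two differences, Lipschitz bounds for both parts and
    monotonicity follow. *)
Lemma mreg_split_ge0 E F : 0 <= frob (m E - m F) ((E - m E) - (F - m F)).
Proof.
have h1 := mreg_proj E (frob_norm_proj F); have h2 := mreg_proj F (frob_norm_proj E).
rewrite frobBl; move: h1 h2; rewrite !frobBr; lra.
Qed.

Lemma frob_sqD E F : frob (E + F) (E + F) = frob E E + 2 * frob E F + frob F F.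
Proof. by rewrite frobDl !frobDr (frobC F E); ring. Qed.

Let split_sum E F : E - F = (m E - m F) + ((E - m E) - (F - m F)).
Proof. by apply/matrixP => i j; rewrite !mxE; ring. Qed.

Lemma mreg_lip E F : frob (m E - m F) (m E - m F) <= frob (E - F) (E - F).
Proof.
rewrite [in leRHS](split_sum E F).
rewrite [leRHS](frob_sqD (m E - m F)); have := mreg_split_ge0 E F.
have := frob_ge0 ((E - m E) - (F - m F)); lra.
Qed.

Lemma mproj_lip E F : frob ((E - m E) - (F - m F)) ((E - m E) - (F - m F)) <= frob (E - F) (E - F).
Proof.
rewrite [in leRHS](split_sum E F).
rewrite [leRHS](frob_sqD (m E - m F)); have := mreg_split_ge0 E F.
have := frob_ge0 (m E - m F); lra.
Qed.

Lemma mreg_mono E F : 0 <= frob (m E - m F) (E - F).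
Proof.
rewrite [X in frob _ X](split_sum E F) frobDr; have := mreg_split_ge0 E F.
have := frob_ge0 (m E - m F); lra.
Qed.

(* The one-sided directional derivative of [m] at [E] in direction [W]. *)
Definition dmreg E W : 'M[R]_N :=
  let n := frob_norm E in
  if n < g then 0
  else if g < n then W + (g / n ^+ 3 * frob E W) *: E - (g / n) *: W
  else Num.max 0 (frob E W / g ^+ 2) *: E.

Definition qmreg t E W : 'M[R]_N := t^-1 *: (m (E + t *: W) - m E).

Lemma qmreg_le t E W : t != 0 -> frob (qmreg t E W) (qmreg t E W) <= frob W W.
Proof.
move=> t0; rewrite /qmreg frobZl frobZr mulrA.
have h := mreg_lip (E + t *: W) E.
have -> : frob W W = t^-1 * t^-1 * frob (t *: W) (t *: W).
  by rewrite frobZl frobZr; field.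
rewrite ler_wpM2l//; first by rewrite -expr2 sqr_ge0.
by apply: le_trans h _; rewrite addrC addKr.
Qed.

Local Notation t_ k := ((k.+1%:R : R)^-1).

Lemma frob_norm_line_cvg E W : frob_norm (E + t_ k *: W) @[k --> \oo] --> frob_norm E.
Proof.
rewrite /frob_norm.
apply: (@continuous_cvg _ _ _ _ _ _ _ _ (@sqrt_continuous R (frob E E))).
have -> : (fun k : nat => frob (E + t_ k *: W) (E + t_ k *: W)) =
    (fun k : nat => frob E E + t_ k * (2 * frob E W) + t_ k * (t_ k * frob W W)).
  by apply/funext => k; rewrite frob_sqD !frobZr frobZl; ring.
have c0 := @cvg_harmonic R.
rewrite -[X in _ --> X](_ : frob E E + 0 * (2 * frob E W) + 0 * (0 * frob W W) = _); last by ring.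
apply: cvgD; last by apply: cvgM => //; exact: cvgMl.
by apply: cvgD; [exact: cvg_cst|exact: cvgMl].
Qed.

Lemma max0_cvg (a_ : nat -> R) (a : R) : a_ k @[k --> \oo] --> a ->
  Num.max 0 (a_ k) @[k --> \oo] --> Num.max 0 a.
Proof.
apply: (@continuous_cvg _ _ _ _ _ _ (fun x : R => Num.max 0 x)).
apply: (@continuous_max R R^o (cst 0) id a); first exact: cvg_cst.
exact: cvg_id.
Qed.

(** With a = |E + tW| and b = |E|, 1/b - 1/a = (a^2 - b^2) / (a b (a + b)), and a^2 - b^2 is a
    polynomial in t divisible by t. *)
Lemma inv_norm_line_cvg E W : 0 < frob_norm E ->
  (t_ k)^-1 * (g / frob_norm E - g / frob_norm (E + t_ k *: W)) @[k --> \oo] -->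
  g * frob E W / frob_norm E ^+ 3.
Proof.
move=> n0; have cn := @frob_norm_line_cvg E W; have ne := lt0r_neq0 n0.
have nn : frob_norm E + frob_norm E != 0 by rewrite gt_eqF// addr_gt0.
have c0 := @cvg_harmonic R.
have c : g * (2 * frob E W + t_ k * frob W W) *
    (frob_norm E * (frob_norm (E + t_ k *: W) * (frob_norm (E + t_ k *: W) + frob_norm E)))^-1
    @[k --> \oo] --> g * frob E W / frob_norm E ^+ 3.
  have -> : g * frob E W / frob_norm E ^+ 3 = g * (2 * frob E W + 0 * frob W W) *
     (frob_norm E * (frob_norm E * (frob_norm E + frob_norm E)))^-1.
    by field; rewrite nn ne.
  apply: cvgM; first by apply: cvgMr; apply: cvgD; [exact: cvg_cst|exact: cvgMl].
  apply: cvgV; first by rewrite !mulf_neq0.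
  by apply: cvgMr; apply: cvgM => //; apply: cvgD => //; exact: cvg_cst.
apply: cvg_trans c; apply: near_eq_cvg.
have /cvgr_gt/(_ _ n0) := cn; apply: filterS => k nk.
have h1 : frob_norm (E + t_ k *: W) ^+ 2 - frob_norm E ^+ 2 = t_ k * (2 * frob E W + t_ k * frob W W).
  by rewrite !frob_normE frob_sqD !frobZr frobZl; ring.
have tk : t_ k != 0 by rewrite invr_eq0.
move: (t_ k) (frob_norm (E + t_ k *: W)) (frob_norm E) tk nk h1 n0 {ne cn} => t a b tk a0 h1 b0.
have a' := lt0r_neq0 a0; have b' := lt0r_neq0 b0; have ab : a + b != 0 by rewrite gt_eqF// addr_gt0.
have -> : 2 * frob E W + t * frob W W = (a ^+ 2 - b ^+ 2) / t by rewrite h1; field.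
by field; rewrite b' ab a' tk.
Qed.

Lemma qmreg_cvg E W i j : qmreg (t_ k) E W i j @[k --> \oo] --> dmreg E W i j.
Proof.
have cn := @frob_norm_line_cvg E W; rewrite /dmreg.
(* Outside the ball and on the sphere the quotient is a combination of W and E, so scalar limits
   suffice. *)
have ce (a_ b_ : nat -> R) (a b : R) : a_ k @[k --> \oo] --> a -> b_ k @[k --> \oo] --> b ->
    (a_ k *: W + b_ k *: E) i j @[k --> \oo] --> (a *: W + b *: E) i j.
  move=> ca cb; rewrite !mxE.
  have -> : (fun k => (a_ k *: W + b_ k *: E) i j) = (fun k => a_ k * W i j + b_ k * E i j).
    by apply/funext => k; rewrite !mxE.
  by apply: cvgD; exact: cvgMl.
have [Eg|gE|Eg] := ltgtP (frob_norm E) g.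
- apply: (@cvg_trans _ (@cst nat R (0 : R) @ \oo)); last by rewrite mxE; exact: cvg_cst.
  apply: near_eq_cvg; have /cvgr_lt/(_ _ Eg) := cn; apply: filterS => k nk.
  by rewrite /qmreg mreg_in ?(ltW nk)// mreg_in ?(ltW Eg)// subrr scaler0 mxE.
- have n0 := lt_trans g0 gE; have cs := @inv_norm_line_cvg E W n0.
  have -> : W + (g / frob_norm E ^+ 3 * frob E W) *: E - (g / frob_norm E) *: W =
     (1 - g / frob_norm E) *: W + (g * frob E W / frob_norm E ^+ 3) *: E.
    by apply/matrixP => a b; rewrite !mxE; field; exact: lt0r_neq0.
  have ca : 1 - g / frob_norm (E + t_ k *: W) @[k --> \oo] --> 1 - g / frob_norm E.
    apply: cvgB; first exact: cvg_cst.
    by apply: cvgMr; apply: cvgV => //; exact: lt0r_neq0.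
  apply: cvg_trans (ce _ _ _ _ ca cs); apply: near_eq_cvg.
  have /cvgr_gt/(_ _ gE) := cn; apply: filterS => k nk.
  rewrite /qmreg !mreg_out// !mxE.
  have := lt0r_neq0 (lt_trans g0 nk); have : t_ k != 0 by rewrite invr_eq0.
  move: (t_ k) (frob_norm (E + t_ k *: W)) => t a t1 a1.
  by field; rewrite a1 t1 lt0r_neq0.
(* On the sphere m E = 0: the coefficient of W tends to 0, while that of E is the positive part of
   the quotient of -g/|.|, whence the max in the limit. *)
- have n0 : 0 < frob_norm E by rewrite Eg.
  have cs := @inv_norm_line_cvg E W n0.
  have -> : Num.max 0 (frob E W / g ^+ 2) *: E = 0 *: W +
      Num.max 0 (g * frob E W / frob_norm E ^+ 3) *: E.
    rewrite scale0r add0r; congr (Num.max _ _ *: _); rewrite Eg; field; exact: lt0r_neq0.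
  have ca : Num.max 0 (1 - g / frob_norm (E + t_ k *: W)) @[k --> \oo] --> (0 : R).
    rewrite -[X in _ --> X](_ : Num.max 0 (1 - g / frob_norm E) = 0); last first.
      by rewrite Eg divff ?lt0r_neq0// subrr maxxx.
    apply: max0_cvg.
    apply: cvgB; first exact: cvg_cst.
    by apply: cvgMr; apply: cvgV => //; exact: lt0r_neq0.
  have cb := max0_cvg cs.
  apply: cvg_trans (ce _ _ _ _ ca cb); apply: near_eq_cvg; apply: nearW => k.
  rewrite /qmreg (mreg_in (E := E)) ?Eg// subr0 mreg_pos !mxE.
  have t1 : 0 < t_ k by rewrite invr_gt0.
  have -> : (t_ k)^-1 * (g / g - g / frob_norm (E + t_ k *: W)) =
     (t_ k)^-1 * (1 - g / frob_norm (E + t_ k *: W)) by rewrite divff ?lt0r_neq0.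
  move: (t_ k) t1 (frob_norm _) => t t1 a.
  have -> : Num.max 0 (t^-1 * (1 - g / a)) = t^-1 * Num.max 0 (1 - g / a).
    by rewrite maxr_pMr ?mulr0// invr_ge0 ltW.
  by field; exact: lt0r_neq0.
Qed.

Lemma dmreg_le_eq E W : frob_norm E = g -> frob (dmreg E W) (dmreg E W) <= frob W W.
Proof.
move=> Eg; rewrite /dmreg Eg ltxx frobZl frobZr -frob_normE Eg mulrA -expr2.
have : Num.max 0 (frob E W / g ^+ 2) ^+ 2 <= (frob E W / g ^+ 2) ^+ 2.
  by case: (leP 0 (frob E W / g ^+ 2)) => // _; rewrite expr0n sqr_ge0.
have := frob_CS E W; rewrite -(frob_normE E) Eg.
have g2 : 0 < g ^+ 2 by rewrite exprn_gt0.
move=> h1 h2; rewrite -ler_pdivlMr//; apply: le_trans h2 _.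
rewrite expr_div_n ler_pdivrMr ?exprn_gt0//; apply: le_trans h1 _.
by rewrite le_eqVlt; apply/orP; left; apply/eqP; field; exact: lt0r_neq0.
Qed.

Lemma dmreg_lt E W : frob_norm E < g -> dmreg E W = 0.
Proof. by rewrite /dmreg => ->. Qed.

Lemma dmreg_gt E W : g < frob_norm E -> dmreg E W =
  W + (g / frob_norm E ^+ 3 * frob E W) *: E - (g / frob_norm E) *: W.
Proof. by move=> h; rewrite /dmreg h; case: ltP => // /(lt_trans h); rewrite ltxx. Qed.

(** Where m is differentiable its derivative is self-adjoint, so the direction can be exchanged with
    the adjoint state. *)
Lemma dmreg_sym E W P : g < frob_norm E -> frob (dmreg E W) P = frob (dmreg E P) W.
Proof.
move=> h; rewrite !dmreg_gt// !frobBl !frobDl !frobZl (frobC W P); ring.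
Qed.

End mreg_pointwise.

(** * The state equation *)

Section state_operator.
Context {R : realType} {N : nat} (Omega : set 'rV[R]_N).
Hypothesis oO : open Omega.
Variables (k0 : 'I_N) (M : R).
Hypothesis OM : forall x, Omega x -> `|x ord0 k0| <= M.
Variables mu nu g : R.
Hypotheses (mu0 : 0 < mu) (nu0 : 0 <= nu) (g0 : 0 < g).
Local Notation leb := (@lebesgue_rV R N).
Local Notation dot := (L2_dot Omega).
Local Notation B := (Ydot Omega).
Local Notation ep := (eps Omega).
Local Notation stress := ('rV[R]_N -> 'M[R]_N).
Local Notation field := ('rV[R]_N -> 'rV[R]_N).
Implicit Types (y z v w u h : 'rV[R]_N -> 'rV[R]_N) (E F W : 'rV[R]_N -> 'M[R]_N).

Let mO : measurable Omega. Proof. exact: open_measurable_rV. Qed.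
Let HY : hilbert (Y Omega) B := hilbert_Y oO OM.
Let HF : hilbert (@L2 R N Omega 1 N) (@L2_dot R N Omega 1 N) := hilbert_L2 mO.
Let HS : hilbert (@L2 R N Omega N N) (@L2_dot R N Omega N N) := hilbert_L2 mO.

Lemma mreg_L2 F : L2 Omega F -> L2 Omega (mreg g \o F).
Proof.
move=> hF; apply: (L2_le mO _ hF) => [i j|x _ /=]; last first.
  by have := mreg_lip g0 (F x) 0; rewrite mreg0 !subr0.
have mF := measurable_frob (fun i j => L2_measurable mO i j hF) (fun i j => L2_measurable mO i j hF).
pose c (t : R) : R := 1 - g / Num.max (Num.sqrt t) g.
have cc : continuous c.
  move=> t; apply: cvgB; first exact: cvg_cst.
  apply: cvgMr; apply: cvgV; first by rewrite gt_eqF// lt_max g0 orbT.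
  apply: (@continuous_max R R^o (@Num.sqrt R) (cst g) t); last exact: cvg_cst.
  exact: sqrt_continuous.
have -> : (fun x => (mreg g \o F) x i j) =
    (c \o (fun x => frob (F x) (F x))) \* (fun x => F x i j).
  by apply/funext => x /=; rewrite mreg_max// mxE.
apply: measurable_funM; last exact: L2_measurable hF.
by apply: (measurableT_comp (continuous_measurable_fun cc)).
Qed.

Lemma qmreg_L2 t E W : L2 Omega E -> L2 Omega W ->
  L2 Omega (fun x => qmreg g t (E x) (W x)).
Proof.
move=> hE hW; apply: (hilbertZ_in HS); apply: (hilbertB_in HS); last exact: mreg_L2.
rewrite (_ : (fun _ => _) = mreg g \o (t *: W + E)); last first.
  by apply/funext => x /=; rewrite addrC.
by apply: mreg_L2; exact: L2_lin.
Qed.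

(** The quotients are bounded by |W| because m is 1-Lipschitz, so their pointwise convergence is
    convergence in L2. *)
Lemma dmreg_L2 E W : L2 Omega E -> L2 Omega W ->
  L2 Omega (fun x => dmreg g (E x) (W x)) /\
  dot ((fun x => qmreg g k.+1%:R^-1 (E x) (W x)) - (fun x => dmreg g (E x) (W x)))
      ((fun x => qmreg g k.+1%:R^-1 (E x) (W x)) - (fun x => dmreg g (E x) (W x)))
    @[k --> \oo] --> (0 : R).
Proof.
move=> hE hW.
have [] := @L2_dominated _ _ _ mO _ _ (fun k x => qmreg g k.+1%:R^-1 (E x) (W x))
  (fun x => dmreg g (E x) (W x)) W _ hW _ _ => //.
- by move=> k i j; apply: L2_measurable => //; exact: qmreg_L2.
- by move=> k x _; apply: qmreg_le => //; rewrite invr_eq0.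
- by move=> x i j _; exact: qmreg_cvg.
Qed.

Lemma dot_lin m n (f h k : 'rV[R]_N -> 'M[R]_(m, n)) a : L2 Omega f -> L2 Omega h ->
  L2 Omega k -> dot f (a *: h + k) = a * dot f h + dot f k.
Proof.
move=> hf hh hk; have H := hilbert_L2 mO (m := m) (n := n).
rewrite (hilbertC H hf (L2_lin a hh hk)) (hilbert_form H a hh hk hf).
by rewrite (hilbertC H hh hf) (hilbertC H hk hf).
Qed.

Lemma dot_eps_lin F a v w : L2 Omega F -> Y Omega v -> Y Omega w ->
  dot F (ep (a *: v + w)) = a * dot F (ep v) + dot F (ep w).
Proof.
move=> hF Yv Yw; have hv := Y_L2_eps oO Yv; have hw := Y_L2_eps oO Yw.
have hl := L2_lin a hv hw; have Yl := Y_lin oO a Yv Yw.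
rewrite -dot_lin//.
exact: (L2_dot_ae mO hF (Y_L2_eps oO Yl) hF hl (aeW _ (fun x _ => erefl)) (Y_eps_lin oO a Yv Yw)).
Qed.

Lemma load_bound h v : L2 Omega h -> Y Omega v ->
  dot h v ^+ 2 <= 8 * M ^+ 2 * dot h h * B v v.
Proof.
move=> hh Yv; apply: le_trans (hilbert_CS HF hh (Y_L2 oO Yv)) _.
rewrite [8 * _ * _]mulrC -mulrA ler_wpM2l//; first exact: (hilbert_ge0 HF).
exact: (Y_poincare oO OM).
Qed.

Lemma load_riesz h : L2 Omega h ->
  exists2 z, Y Omega z & forall v, Y Omega v -> dot h v = B z v.
Proof.
move=> hh; have hh0 := hilbert_ge0 HF hh.
have [|||||||z [Yz zE _]] := @riesz_pullback _ _ _ _ HY _ (Y Omega) id (dot h) (8 * M ^+ 2 * dot h h).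
- exact: (Y_0 oO).
- by move=> a y z; exact: (Y_lin oO).
- by [].
- by move=> a y z v Yy Yz Yv; exact: (hilbert_form HY).
- by move=> a y z Yy Yz; apply: dot_lin => //; exact: (Y_L2 oO).
- by rewrite mulr_ge0// mulr_ge0// sqr_ge0.
- by move=> v Yv; exact: load_bound.
by exists z.
Qed.

Lemma stress_riesz F : L2 Omega F ->
  exists2 z, Y Omega z & forall v, Y Omega v -> dot F (ep v) = B z v.
Proof.
move=> hF; have hF0 := hilbert_ge0 HS hF.
have [|||||||z [Yz zE _]] := @riesz_pullback _ _ _ _ HY _ (Y Omega) id (fun v => dot F (ep v)) (dot F F).
- exact: (Y_0 oO).
- by move=> a y z; exact: (Y_lin oO).
- by [].
- by move=> a y z v Yy Yz Yv; exact: (hilbert_form HY).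
- by move=> a y z Yy Yz; exact: dot_eps_lin.
- by [].
- by move=> v Yv; apply: (hilbert_CS HS) => //; exact: (Y_L2_eps oO).
by exists z.
Qed.

Lemma Y_epsB y z : Y Omega y -> Y Omega z ->
  {ae leb, forall x, Omega x -> ep (y - z) x = (ep y - ep z) x}.
Proof.
move=> Yy Yz; have := Y_eps_lin oO (-1) Yz Yy.
by rewrite !scaleN1r ![- _ + _]addrC.
Qed.

Lemma Ydot_epsB y z : Y Omega y -> Y Omega z ->
  B (y - z) (y - z) = dot (ep y - ep z) (ep y - ep z).
Proof.
move=> Yy Yz; have h1 := Y_L2_eps oO (hilbertB_in HY Yy Yz).
have h2 := hilbertB_in HS (Y_L2_eps oO Yy) (Y_L2_eps oO Yz).
exact: (L2_dot_ae mO h1 h1 h2 h2 (Y_epsB Yy Yz) (Y_epsB Yy Yz)).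
Qed.

(* [y] solves the state equation iff it is a fixed point of the map sending [y]
   to the Riesz representative of [v |-> (u, v) + nu (P (eps y), eps v)] for
   [(mu + nu) B], where [P E = E - mreg g E] is nonexpansive. *)
Lemma state_exists u : L2 Omega u -> exists y, is_state Omega mu nu g y u.
Proof.
move=> hu; pose P E : stress := fun x => E x - mreg g (E x).
have hP E : L2 Omega E -> L2 Omega (P E).
  by move=> hE; apply: (hilbertB_in HS hE); exact: mreg_L2.
have mn0 : 0 < mu + nu by rewrite ltr_pwDl.
have [zu Yzu zuE] := load_riesz hu.
have /choice[K hK] : forall y, exists z, Y Omega y -> Y Omega z /\
    forall v, Y Omega v -> dot (P (ep y)) (ep v) = B z v.
  move=> y; have [Yy|nY] := pselect (Y Omega y); last by exists 0.
  by have [z Yz zE] := stress_riesz (hP _ (Y_L2_eps oO Yy)); exists z.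
pose T (y : field) : field := (mu + nu)^-1 *: (nu *: K y + zu).
have YT y : Y Omega y -> Y Omega (T y).
  by move=> /hK[YK _]; apply: (hilbertZ_in HY); exact: (Y_lin oO).
have TE y v : Y Omega y -> Y Omega v ->
    B (T y) v = (mu + nu)^-1 * (nu * dot (P (ep y)) (ep v) + dot u v).
  move=> Yy Yv; have [YK KE] := hK _ Yy.
  rewrite /T (hilbertZl HY _ (Y_lin oO nu YK Yzu) Yv) (hilbert_form HY nu YK Yzu Yv).
  by rewrite KE// zuE.
have c01 : 0 <= nu / (mu + nu) < 1.
  by rewrite divr_ge0//= ?(ltW mn0)// ltr_pdivrMr// mul1r ltrDr.
have alg (a b c : R) : (mu + nu)^-1 * (nu * a + c) - (mu + nu)^-1 * (nu * b + c) =
    nu / (mu + nu) * (a - b) by ring.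
have contr (y z : field) : Y Omega y -> Y Omega z ->
    Num.sqrt (B (T y - T z) (T y - T z)) <= nu / (mu + nu) * Num.sqrt (B (y - z) (y - z)).
  move=> Yy Yz; have hy := Y_L2_eps oO Yy; have hz := Y_L2_eps oO Yz.
  have [d Ed] : exists d : field, d = T y - T z by exists (T y - T z).
  have Yd : Y Omega d by rewrite Ed; exact (hilbertB_in HY (YT _ Yy) (YT _ Yz)).
  have hd := Y_L2_eps oO Yd; have hD := hilbertB_in HS (hP _ hy) (hP _ hz).
  have dE : B d d = nu / (mu + nu) * dot (P (ep y) - P (ep z)) (ep d).
    have -> : B d d = B (T y) d - B (T z) d.
      by rewrite {1}Ed; exact (hilbertBl HY (YT _ Yy) (YT _ Yz) Yd).
    rewrite (TE _ _ Yy Yd) (TE _ _ Yz Yd) (hilbertBl HS (hP _ hy) (hP _ hz) hd).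
    exact: alg.
  rewrite -Ed.
  have h1 : dot (P (ep y) - P (ep z)) (ep d) <= Num.sqrt (B (y - z) (y - z)) * Num.sqrt (B d d).
    apply: le_trans (ler_norm _) _; apply: le_trans (hilbert_CS_norm HS hD hd) _.
    rewrite ler_wpM2r ?sqrtr_ge0// ler_wsqrtr// (Ydot_epsB Yy Yz) -[leRHS]mul1r.
    apply: (L2_dot_le oO hD (hilbertB_in HS hy hz)) => x; rewrite mul1r.
    exact: mproj_lip.
  have [d0|d0] := eqVneq (B d d) 0.
    by rewrite d0 sqrtr0 mulr_ge0 ?sqrtr_ge0//; case/andP: c01.
  have sd : 0 < Num.sqrt (B d d).
    by rewrite sqrtr_gt0 lt_neqAle eq_sym d0 (hilbert_ge0 HY Yd).
  rewrite -(ler_pM2r sd) -expr2 sqr_sqrtr ?(hilbert_ge0 HY Yd)// [leLHS]dE -[leRHS]mulrA.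
  by rewrite ler_wpM2l//; case/andP: c01.
have alg2 (a b c : R) : (mu + nu) * a = nu * (a - b) + c -> mu * a + nu * b = c by nra.
have [y [Yy y0]] : exists y : field, Y Omega y /\ B (T y - y) (T y - y) = 0.
  by have [y Yy y0] := contraction_fixpoint HY YT c01 contr; exists y.
exists y; split=> // v Yv.
(* T y and y differ by a null vector, which Cauchy-Schwarz makes invisible to every v. *)
have Ty : B (T y) v = B y v.
  apply/eqP; rewrite -subr_eq0 -(hilbertBl HY (YT _ Yy) Yy Yv) -sqrf_eq0.
  have := hilbert_CS HY (hilbertB_in HY (YT _ Yy) Yy) Yv.
  by rewrite y0 mul0r => h; apply/eqP/le_anti; rewrite h sqr_ge0.
move: Ty; rewrite (TE _ _ Yy Yv).
have hy := Y_L2_eps oO Yy; have hv := Y_L2_eps oO Yv; have hm := mreg_L2 hy.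
have -> : dot (P (ep y)) (ep v) = B y v - dot (mreg g \o ep y) (ep v).
  exact: (hilbertBl HS hy hm hv).
move=> h; have : (mu + nu) * B y v =
    nu * (B y v - dot (mreg g \o ep y) (ep v)) + dot u v.
  by rewrite -[X in _ * X = _]h mulrA mulfV ?mul1r// lt0r_neq0.
exact: alg2.
Qed.

End state_operator.

(** * Optimality conditions *)

Section real_algebra.
Context {R : realFieldType}.
Implicit Types mu nu alpha t K r : R.

Lemma difference_quotient_eq mu nu t (a b c d e a' c' u u' : R) : t != 0 ->
  mu * a' + nu * c' = u' -> mu * a + nu * c = u ->
  a' = a + t * b -> c' = c + t * d -> u' = u + t * e -> mu * b + nu * d = e.
Proof. by move=> t0 <- <- -> -> H; apply: (mulfI t0); lra. Qed.

(** Used with d = w' - w and s its norm: [b1], [b2] are B w' d and B w d; [q1], [q2] the quotient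
    stresses at w' and w, [q3] the directional derivative at w, all paired with d; [c] is (h, d). *)
Lemma strong_monotonicity_bound mu nu K r (b1 b2 q1 q2 q3 c s : R) :
  0 <= nu -> 0 <= K -> 0 <= r -> mu * b1 + nu * q1 = c -> 0 <= q1 - q2 ->
  q3 - q2 <= r * s -> c - (mu * b2 + nu * q3) <= K * s -> b1 - b2 = s ^+ 2 -> 0 <= s ->
  mu * s <= K + nu * r.
Proof.
move=> nu0 K0 r0 e1 e3 e4 e5 e6 s0.
have [->|sn] := eqVneq s 0; first by rewrite mulr0 addr_ge0// mulr_ge0.
have sp : 0 < s by rewrite lt_neqAle eq_sym sn.
rewrite -(ler_pM2r sp).
have : nu * (q3 - q2) <= nu * (r * s) by rewrite ler_wpM2l.
have : 0 <= nu * (q1 - q2) by rewrite mulr_ge0.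
have : mu * (s * s) = mu * b1 - mu * b2 by rewrite -expr2 -e6 mulrBr.
lra.
Qed.

Lemma first_order_gap alpha t (rr rw ww uu uh hh : R) : 0 < t ->
  2^-1 * rr + alpha / 2 * uu <=
  2^-1 * (rr + 2 * t * rw + t ^+ 2 * ww) + alpha / 2 * (uu + 2 * t * uh + t ^+ 2 * hh) ->
  0 <= rw + alpha * uh + t / 2 * (ww + alpha * hh).
Proof.
move=> t0 h; rewrite -(pmulr_rge0 _ t0).
have -> : t * (rw + alpha * uh + t / 2 * (ww + alpha * hh)) =
   2^-1 * (rr + 2 * t * rw + t ^+ 2 * ww) + alpha / 2 * (uu + 2 * t * uh + t ^+ 2 * hh)
   - (2^-1 * rr + alpha / 2 * uu) by field.
by rewrite subr_ge0.
Qed.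

Lemma square_sum_le (ss ww wd dd c : R) : ss = ww + 2 * 1 * wd + 1 ^+ 2 * dd ->
  0 <= ww - 2 * wd + dd -> dd <= c -> ss <= 2 * ww + 2 * c.
Proof. lra. Qed.

Lemma gap_le (a1 a2 a3 a4 a5 a6 : R) : a1 + a3 <= a2 + a4 + a5 -> 0 <= a1 + a6 + a3 ->
  - (a2 + a6) <= a4 + a5.
Proof. lra. Qed.

Lemma le_gap mu nu (a b c d e : R) : mu * b + nu * (c + d) <= a -> e <= nu * d ->
  e <= a - mu * b - nu * c.
Proof. lra. Qed.

Lemma sum_gap (a b c : R) : b + (c + (a - b - c)) = a.
Proof. ring. Qed.

Lemma gap_lin mu nu (a b b1 b2 c c1 c2 d d1 d2 : R) :
  b = a * b1 + b2 -> c = a * c1 + c2 -> d = a * d1 + d2 ->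
  b - mu * c - nu * d = a * (b1 - mu * c1 - nu * d1) + (b2 - mu * c2 - nu * d2).
Proof. move=> -> -> ->; ring. Qed.

Lemma mulN1_add (a b : R) : b = 0 -> -1 * a + b = - a.
Proof. by move=> ->; rewrite addr0 mulN1r. Qed.

End real_algebra.

Lemma dmreg0 {R : realType} {N : nat} (g : R) (E : 'M[R]_N) : dmreg g E 0 = 0.
Proof.
have f0 : frob E 0 = 0 by rewrite frobC frob0l.
rewrite /dmreg f0; case: ifP => // _; case: ifP => _.
  by rewrite mulr0 scale0r scaler0 !addr0 subr0.
by rewrite mul0r maxxx scale0r.
Qed.

Lemma L2_mask {R : realType} {N m n : nat} (Omega : set 'rV[R]_N) (b : 'rV[R]_N -> bool)
    (F : 'rV[R]_N -> 'M[R]_(m, n)) : measurable Omega -> measurable_fun Omega b ->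
  L2 Omega F -> L2 Omega (fun x => if b x then F x else 0).
Proof.
move=> mO mb hF; apply: (L2_le mO _ hF) => [i j|x _]; last first.
  by case: ifP => // _; rewrite frob0l frob_ge0.
have -> : (fun x => (if b x then F x else 0) i j) = (fun x => if b x then F x i j else 0).
  by apply/funext => x; case: ifP => // _; rewrite mxE.
apply: measurable_fun_if => //.
by apply: measurable_funS (L2_measurable mO i j hF) => // x [].
Qed.

(** * Comparison with nearby states, adjoint state and multiplier *)

Section optimality.
Context {R : realType} {N : nat} (Omega : set 'rV[R]_N).
Hypothesis oO : open Omega.
Variables (k0 : 'I_N) (M : R).
Hypothesis OM : forall x, Omega x -> `|x ord0 k0| <= M.
Variables mu nu g alpha : R.
Hypotheses (mu0 : 0 < mu) (nu0 : 0 <= nu) (g0 : 0 < g).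
Local Notation leb := (@lebesgue_rV R N).
Local Notation dot := (L2_dot Omega).
Local Notation B := (Ydot Omega).
Local Notation ep := (eps Omega).
Local Notation stress := ('rV[R]_N -> 'M[R]_N).
Local Notation field := ('rV[R]_N -> 'rV[R]_N).
Variables zd ybar ubar : field.
Hypotheses (hzd : L2 Omega zd).
Hypothesis hloc : local_solution Omega mu nu g alpha zd ybar ubar.
Implicit Types (y z v w u h p : 'rV[R]_N -> 'rV[R]_N) (F W : 'rV[R]_N -> 'M[R]_N).
Local Notation E := (ep ybar).

Let mO : measurable Omega. Proof. exact: open_measurable_rV. Qed.
Let HY : hilbert (Y Omega) B := hilbert_Y oO OM.
Let HF : hilbert (@L2 R N Omega 1 N) (@L2_dot R N Omega 1 N) := hilbert_L2 mO.
Let HS : hilbert (@L2 R N Omega N N) (@L2_dot R N Omega N N) := hilbert_L2 mO.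

Let hu : L2 Omega ubar. Proof. by case: hloc. Qed.
Let Yy : Y Omega ybar. Proof. by case: hloc => _ []. Qed.
Let hE : L2 Omega E := Y_L2_eps oO Yy.
Let hy : L2 Omega ybar := Y_L2 oO Yy.
Let hr : L2 Omega (ybar - zd) := hilbertB_in HF hy hzd.

Definition dstress F : stress := fun x => dmreg g (E x) (F x).
Definition qstress t F : stress := fun x => qmreg g t (E x) (F x).

(** The functional f_w of the overview: linear in [v], but not in [w]. *)
Definition linearized w v := mu * B w v + nu * dot (dstress (ep w)) (ep v).

Lemma dstress_L2 F : L2 Omega F -> L2 Omega (dstress F).
Proof. by move=> hF; have [] := dmreg_L2 oO g0 hE hF. Qed.

Lemma qstress_L2 (t : R) F : L2 Omega F -> L2 Omega (qstress t F).
Proof. exact: (qmreg_L2 oO g0 t hE). Qed.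

Lemma qstress_mono (t : R) F W : t != 0 -> L2 Omega F -> L2 Omega W ->
  0 <= dot (qstress t F - qstress t W) (F - W).
Proof.
move=> t0 hF hW; apply: Rintegral_ge0 => x _.
rewrite -[(qstress t F - _) x]/(qmreg g t (E x) (F x) - qmreg g t (E x) (W x)).
rewrite -[(F - W) x]/(F x - W x) /qmreg -scalerBr opprB addrA subrK frobZl.
have -> : F x - W x = t^-1 *: ((E x + t *: F x) - (E x + t *: W x)).
  by apply/matrixP => i j; rewrite !mxE; field.
rewrite frobZr mulrA mulr_ge0//; first by rewrite -expr2 sqr_ge0.
exact: mreg_mono.
Qed.

(** [w] is a difference quotient of states for the control direction [h] with step [t]. *)
Definition state_quotient (t : R) h w := Y Omega w /\
  is_state Omega mu nu g (ybar + t *: w) (ubar + t *: h).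

Lemma state_quotient_exists (t : R) h : t != 0 -> L2 Omega h -> exists w, state_quotient t h w.
Proof.
move=> t0 hh; have hut : L2 Omega (ubar + t *: h) by rewrite addrC; exact: L2_lin.
have [y yS] := state_exists oO OM mu0 nu0 g0 hut; exists (t^-1 *: (y - ybar)); split.
  by have [Yy' _] := yS; exact: (hilbertZ_in HY _ (hilbertB_in HY Yy' Yy)).
have -> // : ybar + t *: (t^-1 *: (y - ybar)) = y.
by apply/funext => x; apply/rowP => i; rewrite !mxE; field.
Qed.

Lemma state_quotient_eq (t : R) h w : t != 0 -> L2 Omega h -> state_quotient t h w ->
  forall v, Y Omega v -> mu * B w v + nu * dot (qstress t (ep w)) (ep v) = dot h v.
Proof.
move=> t0 hh [Yw [Ys /[swap] v /(_ v) eqs]] Yv; have {}eqs := eqs Yv.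
have [_ [_ /(_ v Yv) eq0] _] := hloc.
have hw := Y_L2_eps oO Yw; have hv := Y_L2_eps oO Yv; have hv1 := Y_L2 oO Yv.
have es : {ae leb, forall x, Omega x -> ep (ybar + t *: w) x = (E + t *: ep w) x}.
  by have := Y_eps_lin oO t Yw Yy; rewrite ![_ + E]addrC ![_ + ybar]addrC.
have e1 : B (ybar + t *: w) v = B ybar v + t * B w v.
  by rewrite addrC (hilbert_form HY t Yw Yy Yv) addrC.
have e3 : dot (ubar + t *: h) v = dot ubar v + t * dot h v.
  by rewrite addrC (hilbert_form HF t hh hu hv1) addrC.
have hm := mreg_L2 oO g0 (Y_L2_eps oO Ys); have hq := qstress_L2 t hw.
have hmE := mreg_L2 oO g0 hE; have hq' := L2_lin t hq hmE.
have e2 : dot (mreg g \o ep (ybar + t *: w)) (ep v) =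
    dot (mreg g \o E) (ep v) + t * dot (qstress t (ep w)) (ep v).
  rewrite [RHS]addrC -(hilbert_form HS t hq hmE hv).
  apply: (L2_dot_ae mO hm hv hq' hv _ (aeW _ (fun x _ => erefl))).
  apply: filterS es => x ex Ox; rewrite /= ex//.
  rewrite -[RHS]/(t *: (t^-1 *: (mreg g (E x + t *: ep w x) - mreg g (E x))) + mreg g (E x)).
  by rewrite [X in _ = X + _]scalerA divff// scale1r subrK.
exact: (difference_quotient_eq t0 eqs eq0 e1 e2 e3).
Qed.

(** Test the equation for w' with d = w' - w. Monotonicity discards the difference of the quotient
    stresses at w' and w; what remains is the residual, bounded by [K], and the error of the
    quotient at w, bounded by [r]. *)
Lemma state_quotient_close (t : R) h w w' (K r : R) : 0 < t -> L2 Omega h -> Y Omega w ->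
  state_quotient t h w' -> 0 <= K ->
  (forall v, Y Omega v -> (dot h v - linearized w v) ^+ 2 <= K ^+ 2 * B v v) ->
  dot (qstress t (ep w) - dstress (ep w)) (qstress t (ep w) - dstress (ep w)) <= r ^+ 2 ->
  0 <= r ->
  mu * Num.sqrt (B (w' - w) (w' - w)) <= K + nu * r.
Proof.
move=> t0 hh Yw sq K0 hK hr2 r0; have [Yw' _] := sq.
have [d Ed] : exists d : field, d = w' - w by exists (w' - w).
have Yd : Y Omega d by rewrite Ed; exact (hilbertB_in HY Yw' Yw).
rewrite -Ed; have tn := lt0r_neq0 t0.
have hw := Y_L2_eps oO Yw; have hw' := Y_L2_eps oO Yw'; have hd := Y_L2_eps oO Yd.
have e1 := state_quotient_eq tn hh sq Yd; have e2 := hK d Yd.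
have qw := qstress_L2 t hw; have qw' := qstress_L2 t hw'; have dw := dstress_L2 hw.
have e3 : 0 <= dot (qstress t (ep w')) (ep d) - dot (qstress t (ep w)) (ep d).
  rewrite -(hilbertBl HS qw' qw hd); apply: le_trans (qstress_mono tn hw' hw) _.
  have hq := hilbertB_in HS qw' qw; have hB := hilbertB_in HS hw' hw.
  rewrite le_eqVlt; apply/orP; left; apply/eqP.
  apply: (L2_dot_ae mO hq hB hq hd (aeW _ (fun x _ => erefl))).
  by rewrite Ed; apply: filterS (Y_epsB oO Yw' Yw) => x + Ox => ->.
have Bd0 := hilbert_ge0 HY Yd.
have sE : B d d = Num.sqrt (B d d) ^+ 2 by rewrite sqr_sqrtr.
have s0 := sqrtr_ge0 (B d d).
have e4 : dot (dstress (ep w)) (ep d) - dot (qstress t (ep w)) (ep d) <= r * Num.sqrt (B d d).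
  rewrite -(hilbertBl HS dw qw hd); apply: le_trans (ler_norm _) _.
  apply: le_trans (hilbert_CS_norm HS (hilbertB_in HS dw qw) hd) _.
  rewrite ler_wpM2r// L2_dotBC -[leRHS]ger0_norm// -sqrtr_sqr; exact: ler_wsqrtr.
have e5 : dot h d - linearized w d <= K * Num.sqrt (B d d).
  apply: le_trans (ler_norm _) _; rewrite -ler_sqr ?nnegrE ?mulr_ge0//.
  by rewrite real_normK ?num_real// exprMn sqr_sqrtr.
have e6 : B d d = B w' d - B w d by rewrite {1}Ed; exact (hilbertBl HY Yw' Yw Yd).
by apply: (strong_monotonicity_bound nu0 K0 r0 e1 e3 e4 e5) => //; rewrite -sE.
Qed.

(** Expand the quadratic cost at the control ubar + t h and divide by t; [rho] is the radius of
    local optimality. *)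
Lemma quotient_optimality : exists2 rho : R, 0 < rho & forall (t : R) h w, 0 < t ->
  L2 Omega h -> state_quotient t h w -> t * Num.sqrt (dot h h) <= rho ->
  0 <= dot (ybar - zd) w + alpha * dot ubar h + t / 2 * (dot w w + alpha * dot h h).
Proof.
have [_ _ [rho rho0 hopt]] := hloc; exists rho => // t h w t0 hh [Yw sw] hrho.
have hw := Y_L2 oO Yw.
have hut : L2 Omega (ubar + t *: h) by rewrite addrC; exact: L2_lin.
have hth : L2 Omega (t *: h) by exact: (hilbertZ_in HF _ hh).
have nsq u : L2 Omega u -> L2_norm Omega u ^+ 2 = dot u u.
  by move=> hu'; rewrite sqr_sqrtr// (hilbert_ge0 HF hu').
have hyw : L2 Omega (ybar - zd + t *: w).
  by rewrite addrC; exact: L2_lin.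
have e1 : (ubar + t *: h) \- ubar = t *: h.
  by apply/funext => x; apply/rowP => i; rewrite !mxE; ring.
have e2 : (ybar + t *: w) \- zd = ybar - zd + t *: w.
  by apply/funext => x; apply/rowP => i; rewrite !mxE; ring.
have hn : L2_norm Omega ((ubar + t *: h) \- ubar) <= rho.
  rewrite e1 /L2_norm (hilbertZl HF t hh hth) (hilbertZr HF t hh hh) mulrA -expr2.
  by rewrite sqrtrM ?sqr_ge0// sqrtr_sqr gtr0_norm.
have := hopt _ _ hut sw hn; rewrite /J e2.
have -> : ybar \- zd = ybar - zd by [].
rewrite (nsq _ hr) (nsq _ hu) (nsq _ hyw) (nsq _ hut).
rewrite (hilbert_sqD HF t hr hw) (hilbert_sqD HF t hu hh).
exact: first_order_gap.
Qed.

(** The constant C of the overview: a Poincaré bound for ybar - zd in the dual of Y, divided by the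
    monotonicity constant [mu]. *)
Definition adjoint_bound := Num.sqrt (8 * M ^+ 2 * dot (ybar - zd) (ybar - zd)) / mu.

(** Replaces w' by w. The first-order error costs [adjoint_bound]; the quadratic term carries a
    factor t, so a crude bound of w' through |w|^2 and |w' - w|^2 is enough. *)
Lemma quotient_optimality_le (t : R) h w w' (K r : R) : 0 < t -> L2 Omega h -> Y Omega w ->
  Y Omega w' ->
  mu * Num.sqrt (B (w' - w) (w' - w)) <= K + nu * r ->
  dot (ybar - zd) w' + t / 2 * (dot w' w' + alpha * dot h h) <=
  dot (ybar - zd) w + adjoint_bound * (K + nu * r) +
  t / 2 * (8 * M ^+ 2 * (2 * B w w + 2 * ((K + nu * r) / mu) ^+ 2) + alpha * dot h h).
Proof.
move=> t0 hh Yw Yw' hb.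
have [d Ed] : exists d : field, d = w' - w by exists (w' - w).
have Yd : Y Omega d by rewrite Ed; exact (hilbertB_in HY Yw' Yw).
have hw := Y_L2 oO Yw; have hw' := Y_L2 oO Yw'; have hd := Y_L2 oO Yd.
have Bd0 := hilbert_ge0 HY Yd; have M0 : 0 <= 8 * M ^+ 2 by rewrite mulr_ge0// sqr_ge0.
rewrite -Ed in hb.
have hb' : Num.sqrt (B d d) <= (K + nu * r) / mu by rewrite ler_pdivlMr// mulrC.
have e1 : dot (ybar - zd) w' - dot (ybar - zd) w = dot (ybar - zd) d.
  by rewrite Ed; exact/esym/(hilbertBr HF hw' hw hr).
have e2 : dot (ybar - zd) d <= adjoint_bound * (K + nu * r).
  apply: le_trans (_ : Num.sqrt (8 * M ^+ 2 * dot (ybar - zd) (ybar - zd) * B d d) <= _).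
    apply: le_trans (ler_norm _) _; rewrite -sqrtr_sqr; apply: ler_wsqrtr.
    exact: (load_bound oO OM hr Yd).
  rewrite sqrtrM; last by rewrite mulr_ge0// (hilbert_ge0 HF hr).
  by rewrite /adjoint_bound -[leRHS]mulrA [X in _ <= _ * X]mulrC ler_wpM2l// sqrtr_ge0.
have e3 : B w' w' <= 2 * B w w + 2 * ((K + nu * r) / mu) ^+ 2.
  have s1 : B w' w' = B w w + 2 * 1 * B w d + 1 ^+ 2 * B d d.
    by rewrite -(hilbert_sqD HY 1 Yw Yd) scale1r Ed addrC subrK.
  have s2 := hilbert_ge0 HY (hilbertB_in HY Yw Yd).
  rewrite (hilbert_sqB HY Yw Yd) in s2.
  have s3 : B d d <= ((K + nu * r) / mu) ^+ 2.
    by rewrite -[leLHS]sqr_sqrtr// lerXn2r ?nnegrE ?sqrtr_ge0// (le_trans _ hb')// sqrtr_ge0.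
  exact: (square_sum_le s1 s2 s3).
have e4 : dot w' w' <= 8 * M ^+ 2 * (2 * B w w + 2 * ((K + nu * r) / mu) ^+ 2).
  apply: le_trans (Y_poincare oO OM Yw') _; exact: ler_wpM2l.
rewrite -[dot (ybar - zd) w'](subrK (dot (ybar - zd) w)) e1 addrC [leRHS]addrC.
have t2 : 0 <= t / 2 by rewrite divr_ge0// ltW.
apply: lerD; first by apply: ler_wpM2l => //; rewrite lerD2r.
by rewrite addrC lerD2l.
Qed.

(** Let t = 1/(k+1) tend to 0 in the two previous estimates: the quotient error [r k] and the
    second-order terms vanish, and only the residual bound [K] survives. *)
Lemma variational_lower_bound h w (K : R) : L2 Omega h -> Y Omega w -> 0 <= K ->
  (forall v, Y Omega v -> (dot h v - linearized w v) ^+ 2 <= K ^+ 2 * B v v) ->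
  - (adjoint_bound * K) <= dot (ybar - zd) w + alpha * dot ubar h.
Proof.
move=> hh Yw K0 hK; have hw := Y_L2_eps oO Yw.
have [rho rho0 hopt] := quotient_optimality.
pose q (k : nat) := qstress k.+1%:R^-1 (ep w) - dstress (ep w).
pose r k := Num.sqrt (dot (q k) (q k)).
have hq k : L2 Omega (q k) := hilbertB_in HS (qstress_L2 _ hw) (dstress_L2 hw).
have cr : r k @[k --> \oo] --> (0 : R).
  rewrite -(sqrtr0 R); apply: (@continuous_cvg _ _ _ _ _ _ _ _ (@sqrt_continuous R 0)).
  by have [] := dmreg_L2 oO g0 hE hw.
pose b k : R := adjoint_bound * (K + nu * r k) + (k.+1%:R^-1 / 2) *
  (8 * M ^+ 2 * (2 * B w w + 2 * ((K + nu * r k) / mu) ^+ 2) + alpha * dot h h).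
have c0 := @cvg_harmonic R.
have cK : K + nu * r k @[k --> \oo] --> K.
  rewrite -[X in _ --> X](_ : K + nu * 0 = K); last by rewrite mulr0 addr0.
  by apply: cvgD; [exact: cvg_cst|exact: cvgMr].
have cb : b k @[k --> \oo] --> adjoint_bound * K.
  rewrite -[X in _ --> X](_ : adjoint_bound * K + (0 / 2) *
    (8 * M ^+ 2 * (2 * B w w + 2 * ((K / mu) * (K / mu))) + alpha * dot h h) = _); last first.
    by rewrite mul0r mul0r addr0.
  apply: cvgD; first exact: cvgMr.
  apply: cvgM; first exact: cvgMl.
  apply: cvgD; last exact: cvg_cst.
  apply: cvgMr; apply: cvgD; first exact: cvg_cst.
  by apply: cvgMr; apply: cvgM; exact: cvgMl.
rewrite lerNl; apply: (cvgr_to_ge cb).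
have ch : (k.+1%:R^-1 : R) * Num.sqrt (dot h h) @[k --> \oo] --> (0 : R).
  by rewrite -[X in _ --> X](mul0r (Num.sqrt (dot h h))); exact: cvgMl.
have /cvgr_lt/(_ _ rho0) := ch; apply: filterS => k hk.
have t0 : 0 < (k.+1%:R^-1 : R) by rewrite invr_gt0.
have [w' sw] := state_quotient_exists (lt0r_neq0 t0) hh.
have [Yw' _] := sw.
have cl := state_quotient_close t0 hh Yw sw K0 hK (r := r k).
have rq : dot (q k) (q k) <= r k ^+ 2 by rewrite sqr_sqrtr// (hilbert_ge0 HS (hq k)).
have h1 := quotient_optimality_le t0 hh Yw Yw' (cl rq (sqrtr_ge0 _)).
have h2 := hopt _ _ _ t0 hh sw (ltW hk).
exact: (gap_le h1 h2).
Qed.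

Lemma dstress0 F x : F x = 0 -> dstress F x = 0.
Proof. by rewrite /dstress => ->; exact: dmreg0. Qed.

Lemma linearized0 v : Y Omega v -> linearized 0 v = 0.
Proof.
move=> Yv; have Y0' : Y Omega 0 := Y_0 oO; have hv := Y_L2_eps oO Yv.
have h0 := Y_L2_eps oO Y0'; have z0 := @L2_0 R N Omega N N.
have b0 w : Y Omega w -> B 0 w = 0 by move=> Yw; exact: (hilbert0l HY).
have e0 := L2_dot_eq0 mO h0 (b0 _ Y0').
have d0 : {ae leb, forall x, Omega x -> dstress (ep 0) x = (0 : stress) x}.
  by apply: filterS e0 => x ex Ox; rewrite dstress0// ex.
rewrite /linearized b0// mulr0 add0r.
rewrite (L2_dot_ae mO (dstress_L2 h0) hv z0 hv d0 (aeW _ (fun x _ => erefl))).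
by rewrite (hilbert0l HS hv) mulr0.
Qed.

Lemma linearized_riesz w : Y Omega w ->
  exists2 z, Y Omega z & forall v, Y Omega v -> linearized w v = B z v.
Proof.
move=> Yw; have [z Yz zE] := stress_riesz oO OM (dstress_L2 (Y_L2_eps oO Yw)).
exists (nu *: z + mu *: w); first exact: (Y_lin oO nu Yz (hilbertZ_in HY mu Yw)).
move=> v Yv; rewrite (hilbert_form HY nu Yz (hilbertZ_in HY mu Yw) Yv).
by rewrite (hilbertZl HY mu Yw Yv) -zE// addrC.
Qed.

(** [Rz h] represents the load h in Y, so the residual norm is a distance in Y. The Riesz lemma is
    applied twice along [Rz]: to find p, and to approximate f_w by loads. *)
Lemma adjoint_exists : exists p, [/\ Y Omega p,
  {ae leb, forall x, Omega x -> alpha *: ubar x + p x = 0} &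
  forall w, Y Omega w -> linearized w p <= dot (ybar - zd) w].
Proof.
have Yz := Y_0 oO; have C0 : 0 <= adjoint_bound by rewrite divr_ge0 ?sqrtr_ge0// ltW.
have /choice[Rz hRz] : forall h, exists z, L2 Omega h -> Y Omega z /\
    forall v, Y Omega v -> dot h v = B z v.
  move=> h; have [hh|nh] := pselect (L2 Omega h); last by exists 0.
  by have [z Yz' zE] := load_riesz oO OM hh; exists z.
have YR h : L2 Omega h -> Y Omega (Rz h) by move=> /hRz[].
have RE h v : L2 Omega h -> Y Omega v -> dot h v = B (Rz h) v.
  by move=> /hRz[_]; apply.
have zN h : L2 Omega h -> dot ubar (- h) = - dot ubar h.
  by move=> hh; rewrite -scaleN1r (hilbertZr HF _ hh hu) mulN1r.
(* For w = 0 the functional f_w vanishes, and the residual norm is the norm of [Rz h]. *)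
have lb h : L2 Omega h -> - (adjoint_bound * Num.sqrt (B (Rz h) (Rz h))) <= alpha * dot ubar h.
  move=> hh; have := variational_lower_bound hh Yz (sqrtr_ge0 (B (Rz h) (Rz h))).
  rewrite (hilbertC HF hr (Y_L2 oO Yz)) (hilbert0l HF hr) add0r; apply => v Yv.
  rewrite linearized0// subr0 sqr_sqrtr ?(hilbert_ge0 HY (YR _ hh))// (RE _ _ hh Yv).
  exact: (hilbert_CS HY (YR _ hh) Yv).
have ub h : L2 Omega h -> `|alpha * dot ubar h| <= adjoint_bound * Num.sqrt (B (Rz h) (Rz h)).
  move=> hh; rewrite ler_norml lb//=.
  have hNh : L2 Omega (- h) by rewrite -scaleN1r; exact: (hilbertZ_in HF _ hh).
  have := variational_lower_bound hNh Yz (sqrtr_ge0 (B (Rz h) (Rz h))).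
  rewrite (hilbertC HF hr (Y_L2 oO Yz)) (hilbert0l HF hr) add0r zN// mulrN lerN2; apply => v Yv.
  have -> : dot (- h) v = - dot h v.
    by rewrite -scaleN1r (hilbertZl HF _ hh (Y_L2 oO Yv)) mulN1r.
  rewrite linearized0// subr0 sqrrN sqr_sqrtr ?(hilbert_ge0 HY (YR _ hh))// (RE _ _ hh Yv).
  exact: (hilbert_CS HY (YR _ hh) Yv).
have Rlin a h k v : L2 Omega h -> L2 Omega k -> Y Omega v ->
    B (Rz (a *: h + k)) v = a * B (Rz h) v + B (Rz k) v.
  move=> hh hk Yv; have hl := L2_lin a hh hk.
  by rewrite -(RE _ _ hl Yv) -(RE _ _ hh Yv) -(RE _ _ hk Yv) (hilbert_form HF a hh hk (Y_L2 oO Yv)).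
have l0 := @L2_0 R N Omega 1 N; have llin := fun a h k => @L2_lin R N Omega 1 N a h k.
(* By [ub] the functional -alpha (ubar, .) is bounded by the norm of [Rz h]; its representative p
   lies in Y and satisfies (h, p) = -alpha (ubar, h) for every h in L2. *)
have [|||p [Yp pE _]] := @riesz_pullback _ _ _ _ HY _ (@L2 R N Omega 1 N) Rz
  (fun h => - (alpha * dot ubar h)) (adjoint_bound ^+ 2) l0 llin YR Rlin.
- move=> a h k hh hk; rewrite (dot_lin oO a hu hh hk); ring.
- by rewrite sqr_ge0.
- move=> h hh; rewrite sqrrN -real_normK ?num_real// -[B _ _]sqr_sqrtr ?(hilbert_ge0 HY (YR _ hh))//.
  have S0 := mulr_ge0 C0 (sqrtr_ge0 (B (Rz h) (Rz h))).
  by rewrite -exprMn lerXn2r ?nnegrE ?normr_ge0 ?S0 ?ub.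
have hp := Y_L2 oO Yp.
have php h : L2 Omega h -> dot h p = - (alpha * dot ubar h).
  by move=> hh; rewrite pE// (RE _ _ hh Yp) (hilbertC HY Yp (YR _ hh)).
exists p; split=> //.
  have hs : L2 Omega (alpha *: ubar + p) by exact: L2_lin.
  have s0 : dot (alpha *: ubar + p) (alpha *: ubar + p) = 0.
    rewrite (hilbert_form HF alpha hu hp hs) (hilbertC HF hp hs) php//; ring.
  exact: (L2_dot_eq0 mO hs s0).
move=> w Yw; have [z Yz' zE] := linearized_riesz Yw.
(* Here z' is the projection of z, the representative of f_w, on the closure of the range of [Rz],
   and the loads [h_ n] approximate it. *)
have [|||z' [Yz'' zE' [h_ [hh_ ch]]]] := @riesz_pullback _ _ _ _ HY _ (@L2 R N Omega 1 N) Rz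
  (fun h => B z (Rz h)) (B z z) l0 llin YR Rlin.
- move=> a h k hh hk; have hl := L2_lin a hh hk.
  rewrite (hilbertC HY Yz' (YR _ hl)) (Rlin _ _ _ _ hh hk Yz').
  by rewrite (hilbertC HY Yz' (YR _ hh)) (hilbertC HY Yz' (YR _ hk)).
- exact: (hilbert_ge0 HY Yz').
- by move=> h hh; exact: (hilbert_CS HY Yz' (YR _ hh)).
have Yd := hilbertB_in HY Yz' Yz''; have hd := Y_L2 oO Yd.
(* z - z' is orthogonal to the range of [Rz], in particular to its own image, whose pairing with it
   is its squared L2 norm. So it is null in Y too, and the loads approximate z itself. *)
have d0 : dot (z - z') (z - z') = 0.
  rewrite (RE _ _ hd Yd) (hilbertC HY (YR _ hd) Yd) (hilbertBl HY Yz' Yz'' (YR _ hd)).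
  by rewrite (zE' _ hd) subrr.
have dd := Y_ae0 oO OM Yd d0.
have d1 v : Y Omega v -> B v (z - z') = 0.
  move=> Yv; apply/eqP; rewrite -sqrf_eq0; apply/eqP/le_anti; rewrite sqr_ge0 andbT.
  by apply: le_trans (hilbert_CS HY Yv Yd) _; rewrite dd mulr0.
pose K n := Num.sqrt (B (Rz (h_ n) - z) (Rz (h_ n) - z)).
have KE n : B (Rz (h_ n) - z) (Rz (h_ n) - z) = B (Rz (h_ n) - z') (Rz (h_ n) - z').
  have Yn := hilbertB_in HY (YR _ (hh_ n)) Yz''.
  have -> : Rz (h_ n) - z = (Rz (h_ n) - z') - (z - z') by rewrite opprB addrA subrK.
  by rewrite (hilbert_sqB HY Yn Yd) (d1 _ Yn) dd; ring.
have cK : K n @[n --> \oo] --> (0 : R).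
  rewrite /K -(sqrtr0 R); apply: (@continuous_cvg _ _ _ _ _ _ _ _ (@sqrt_continuous R 0)).
  have -> : (fun n => B (Rz (h_ n) - z) (Rz (h_ n) - z)) =
      (fun n => B (Rz (h_ n) - z') (Rz (h_ n) - z')) by apply/funext.
  exact: ch.
have lb' n : - (adjoint_bound * K n) <= dot (ybar - zd) w + alpha * dot ubar (h_ n).
  apply: variational_lower_bound => //; first exact: sqrtr_ge0.
  have Yn := hilbertB_in HY (YR _ (hh_ n)) Yz'.
  move=> v Yv; rewrite (zE _ Yv) (RE _ _ (hh_ n) Yv) -(hilbertBl HY (YR _ (hh_ n)) Yz' Yv).
  have -> : K n ^+ 2 = B (Rz (h_ n) - z) (Rz (h_ n) - z) := sqr_sqrtr (hilbert_ge0 HY Yn).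
  exact (hilbert_CS HY Yn Yv).
have cp : dot (ybar - zd) w - B (Rz (h_ n)) p @[n --> \oo] --> dot (ybar - zd) w - linearized w p.
  apply: cvgB; first exact: cvg_cst.
  rewrite (zE _ Yp); apply: (hilbert_cvg HY (fun n => YR _ (hh_ n)) Yz' Yp).
  have -> : (fun n => B (Rz (h_ n) - z) (Rz (h_ n) - z)) =
      (fun n => B (Rz (h_ n) - z') (Rz (h_ n) - z')) by apply/funext.
  exact: ch.
have cl : - (adjoint_bound * K n) @[n --> \oo] --> (0 : R).
  rewrite -oppr0 -[X in _ --> - X](mulr0 adjoint_bound); apply: cvgN; exact: cvgMr.
rewrite -subr_ge0; apply: (ler_cvg_to cl cp); apply: nearW => n.
by rewrite -(RE _ _ (hh_ n) Yp) php// opprK.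
Qed.

Lemma measurable_frob_norm F : L2 Omega F -> measurable_fun Omega (fun x => frob_norm (F x)).
Proof.
move=> hF; apply: (measurableT_comp (continuous_measurable_fun (@sqrt_continuous R))).
by apply: measurable_frob => i j; exact: L2_measurable hF.
Qed.

(** Outside the sphere lambda is forced: 0 below g and the derivative along eps p above. What the
    adjoint equation still lacks, [gap], depends only on eps w on {|E| = g}, and is represented
    there. *)
Lemma multiplier_exists p : Y Omega p ->
  (forall w, Y Omega w -> linearized w p <= dot (ybar - zd) w) ->
  exists lambda, [/\ L2 Omega lambda,
    forall v, Y Omega v -> mu * B p v + nu * dot lambda (ep v) = dot (ybar - zd) v,
    forall x, frob_norm (E x) < g -> lambda x = 0 &
    forall x, g < frob_norm (E x) -> lambda x = dstress (ep p) x].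
Proof.
move=> Yp hge; have hp := Y_L2_eps oO Yp; have mE := measurable_frob_norm hE.
pose l1 : stress := fun x => if g < frob_norm (E x) then dstress (ep p) x else 0.
pose chi F : stress := fun x => if frob_norm (E x) == g then F x else 0.
have hl1 : L2 Omega l1.
  by apply: L2_mask => //; [exact: measurable_fun_ltr|exact: dstress_L2].
have hchi F : L2 Omega F -> L2 Omega (chi F).
  by move=> hF; apply: L2_mask => //; exact: measurable_fun_eqr.
have chiC F G : dot (chi F) G = dot F (chi G).
  apply: eq_Rintegral => x _; rewrite /chi; case: ifP => // _.
  by rewrite frob0l frobC frob0l.
have chilin a y z F : Y Omega y -> Y Omega z -> L2 Omega F ->
    dot (chi (ep (a *: y + z))) F = a * dot (chi (ep y)) F + dot (chi (ep z)) F.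
  move=> Yy' Yz hF; have hcF := hchi _ hF.
  have C w : Y Omega w -> dot (chi (ep w)) F = dot (chi F) (ep w).
    move=> Yw; apply: (etrans (chiC _ _)); exact: (hilbertC HS (Y_L2_eps oO Yw) hcF).
  apply: (etrans (C _ (Y_lin oO a Yy' Yz))); apply: (etrans (dot_eps_lin oO a hcF Yy' Yz)).
  by congr (a * _ + _); apply/esym; exact: C.
pose gap w := dot (ybar - zd) w - mu * B p w - nu * dot l1 (ep w).
have gaplin a y z : Y Omega y -> Y Omega z -> gap (a *: y + z) = a * gap y + gap z.
  move=> Yy' Yz; have h1 := Y_L2 oO Yy'; have h2 := Y_L2 oO Yz.
  exact: (gap_lin mu nu (dot_lin oO a hr h1 h2) (dot_eps_lin oO a hp Yy' Yz)
    (dot_eps_lin oO a hl1 Yy' Yz)).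
(* Pointwise in three cases: both sides vanish below g, self-adjointness moves the derivative onto p
   above g, and only the masked part remains at g. *)
have split_dot w : Y Omega w -> dot (dstress (ep w)) (ep p) =
    dot l1 (ep w) + dot (dstress (chi (ep w))) (ep p).
  move=> Yw; have hw := Y_L2_eps oO Yw; have hcw := hchi _ hw.
  have i1 := frob_integrable mO hl1 hw; have i2 := frob_integrable mO (dstress_L2 hcw) hp.
  transitivity (\int[leb]_(x in Omega)
      (frob (l1 x) (ep w x) + frob (dstress (chi (ep w)) x) (ep p x))); last by exact (RintegralD mO i1 i2).
  apply: eq_Rintegral => x _; rewrite /l1.
  have [lt|gt|eq] := ltgtP (frob_norm (E x)) g.
  - by rewrite /dstress !dmreg_lt// !frob0l addr0.
  - have -> : dstress (chi (ep w)) x = 0 by rewrite dstress0// /chi gt_eqF.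
    by rewrite frob0l addr0; exact: dmreg_sym.
  - by rewrite frob0l add0r /dstress /chi eq eqxx.
pose S w : R := Num.sqrt (dot (chi (ep w)) (chi (ep w))) * Num.sqrt (B p p).
have S0 w : 0 <= S w by rewrite mulr_ge0 ?sqrtr_ge0.
have gap_ge w : Y Omega w -> - (nu * S w) <= gap w.
  move=> Yw; have hw := Y_L2_eps oO Yw; have hcw := hchi _ hw; have hdw := dstress_L2 hcw.
  have h1 := hge w Yw; rewrite /linearized (split_dot _ Yw) (hilbertC HY Yw Yp) in h1.
  have h2 : `|dot (dstress (chi (ep w))) (ep p)| <= S w.
    apply: le_trans (hilbert_CS_norm HS hdw hp) _.
    rewrite ler_wpM2r ?sqrtr_ge0// ler_wsqrtr// -[leRHS]mul1r.
    apply: (L2_dot_le oO hdw hcw) => x; rewrite mul1r.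
    have [eq|ne] := eqVneq (frob_norm (E x)) g; first exact: dmreg_le_eq.
    have c0 : chi (ep w) x = 0 by rewrite /chi (negbTE ne).
    by rewrite (dstress0 c0) c0.
  have h3 : - (nu * S w) <= nu * dot (dstress (chi (ep w))) (ep p).
    by rewrite -mulrN ler_wpM2l//; move: h2; rewrite ler_norml => /andP[].
  exact: (le_gap h1 h3).
have Y0' := Y_0 oO.
(* Apply the lower bound to -w, written -1 *: w + 0 to fit the linearity lemmas: [gap] changes sign
   and [S] does not. *)
have gap_le w : Y Omega w -> `|gap w| <= nu * S w.
  move=> Yw; rewrite ler_norml gap_ge//=.
  have hcw := hchi _ (Y_L2_eps oO Yw).
  have Yn := Y_lin oO (-1) Yw Y0'.
  have hcn := hchi _ (Y_L2_eps oO Yn).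
  have c0 F : L2 Omega F -> dot (chi (ep 0)) F = 0.
    move=> hF; have := chilin (-1) 0 0 F Y0' Y0' hF.
    by rewrite scaler0 addr0 => ->; rewrite mulN1r addNr.
  have g0' : gap 0 = 0.
    have := gaplin (-1) 0 0 Y0' Y0'.
    by rewrite scaler0 addr0 => ->; rewrite mulN1r addNr.
  have gn : gap (-1 *: w + 0) = - gap w by rewrite (gaplin _ _ _ Yw Y0') g0' addr0 mulN1r.
  have := gap_ge _ Yn; rewrite gn lerN2.
  suff -> : S (-1 *: w + 0) = S w by [].
  have cN F : L2 Omega F -> dot (chi (ep (-1 *: w + 0))) F = - dot (chi (ep w)) F.
    move=> hF; apply: (etrans (chilin (-1) w 0 F Yw Y0' hF)).
    exact: (mulN1_add _ (c0 _ hF)).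
  suff q : dot (chi (ep (-1 *: w + 0))) (chi (ep (-1 *: w + 0))) =
      dot (chi (ep w)) (chi (ep w)) by exact (congr1 (fun t => Num.sqrt t * Num.sqrt (B p p)) q).
  apply: (etrans (cN _ hcn)); apply: (etrans (congr1 -%R (hilbertC HS hcw hcn))).
  by apply: (etrans (congr1 -%R (cN _ hcw))); exact: opprK.
have l_le w : Y Omega w -> `|nu^-1 * gap w| <= S w.
  move=> Yw; have [n0|n0] := eqVneq nu 0; first by rewrite n0 invr0 mul0r normr0.
  have np : 0 < nu by rewrite lt_neqAle eq_sym n0.
  rewrite normrM gtr0_norm ?invr_gt0// -(ler_pM2l np) mulrA divff// mul1r.
  exact: gap_le.
(* For [nu = 0] the inverse is 0 by convention, but then the bound on the gap forces it to
   vanish. *)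
have gapE w : Y Omega w -> gap w = nu * (nu^-1 * gap w).
  move=> Yw; have [n0|n0] := eqVneq nu 0; last by rewrite mulrA divff// mul1r.
  have := gap_le _ Yw; rewrite [in X in _ <= X]n0 mul0r normr_le0 => /eqP ->.
  by rewrite !mulr0.
have Ylin := fun a y z => @Y_lin R N Omega oO a y z.
have hT w : Y Omega w -> L2 Omega (chi (ep w)).
  by move=> Yw; exact: hchi (Y_L2_eps oO Yw).
have [|||l0 [hl0 l0E _]] := @riesz_pullback _ _ _ _ HS _ (Y Omega) (fun w => chi (ep w))
  (fun w => nu^-1 * gap w) (B p p) Y0' Ylin hT chilin.
- by move=> a y z Yy' Yz; rewrite (gaplin _ _ _ Yy' Yz) mulrDr; congr (_ + _); exact: mulrCA.
- exact: (hilbert_ge0 HY Yp).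
- move=> w Yw; rewrite -real_normK ?num_real//.
  have -> : B p p * dot (chi (ep w)) (chi (ep w)) = S w ^+ 2.
    by rewrite exprMn !sqr_sqrtr ?(hilbert_ge0 HY Yp) ?(hilbert_ge0 HS (hT _ Yw))// mulrC.
  by rewrite lerXn2r ?nnegrE ?normr_ge0 ?S0// l_le.
(* The representative is masked once more: its pairing with masked fields is unchanged, and lambda
   gets the prescribed values at every point off the sphere. *)
exists (l1 + chi l0); split.
- exact: (hilbertD_in HS hl1 (hchi _ hl0)).
- move=> v Yv; have hv := Y_L2_eps oO Yv.
  rewrite (hilbertDl HS hl1 (hchi _ hl0) hv) chiC -(l0E _ Yv) mulrDr -(gapE _ Yv) /gap.
  exact: sum_gap.
- move=> x lt; rewrite -[LHS]/(l1 x + chi l0 x) /l1 /chi lt_eqF// addr0.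
  by case: ltgtP lt.
- by move=> x gt; rewrite -[LHS]/(l1 x + chi l0 x) /l1 /chi gt gt_eqF// addr0.
Qed.

End optimality.

Lemma bounded_coord {R : realType} {N : nat} (Omega : set 'rV[R]_N) (k : 'I_N) :
  bounded_set Omega -> exists M, forall x, Omega x -> `|x ord0 k| <= M.
Proof.
case=> M [_ hM]; exists (M + 1) => x Ox.
apply: le_trans (_ : `|x| <= _); last by apply: hM => //; rewrite ltrDl.
rewrite [leRHS]/Num.norm/= mx_normrE.
by apply/bigmax_geP; right => /=; exists (ord0, k).
Qed.

Theorem theorem4p4 (R : realType) (N : nat) (hN : N = 2%N \/ N = 3%N)
  (Omega : set 'rV[R]_N) (hOmega : bounded_lipschitz_domain Omega)
  (mu nu g alpha : R) (hmu : 0 < mu) (hnu : 0 <= nu) (hg : 0 < g)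
  (halpha : 0 < alpha)
  (zd : 'rV[R]_N -> 'rV[R]_N) (hzd : L2 Omega zd)
  (ybar ubar : 'rV[R]_N -> 'rV[R]_N)
  (hloc : local_solution Omega mu nu g alpha zd ybar ubar) :
  exists (p : 'rV[R]_N -> 'rV[R]_N) (lambda : 'rV[R]_N -> 'M[R]_N),
    Y Omega p /\ L2 Omega lambda /\
    (forall v, Y Omega v ->
       mu * L2_dot Omega (eps Omega ybar) (eps Omega v)
       + nu * L2_dot Omega (mreg g \o eps Omega ybar) (eps Omega v)
       = L2_dot Omega ubar v) /\
    (forall v, Y Omega v ->
       mu * L2_dot Omega (eps Omega p) (eps Omega v)
       + nu * L2_dot Omega lambda (eps Omega v)
       = L2_dot Omega (ybar \- zd) v) /\
    {ae lebesgue_rV N, forall x, Omega x -> alpha *: ubar x + p x = 0} /\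
    {ae lebesgue_rV N, forall x, Omega x ->
       frob_norm (eps Omega ybar x) < g -> lambda x = 0} /\
    {ae lebesgue_rV N, forall x, Omega x ->
       g < frob_norm (eps Omega ybar x) ->
       lambda x =
         eps Omega p x
         + (g / frob_norm (eps Omega ybar x) ^+ 3
            * frob (eps Omega ybar x) (eps Omega p x)) *: eps Omega ybar x
         - (g / frob_norm (eps Omega ybar x)) *: eps Omega p x}.
Proof.
have [_ oO _ bO _] := hOmega.
(* A first coordinate exists; [Omega] is bounded in that direction, as the Poincaré inequality
   requires. *)
have N0 : (0 < N)%N by case: hN => ->.
have [M OM] := bounded_coord (Ordinal N0) bO.
have [p [Yp ap pge]] := adjoint_exists oO OM hmu hnu hg hzd hloc.
have [lambda [hl eql lt gt]] := multiplier_exists oO OM hnu hg hzd hloc Yp pge.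
have [_ [_ eqs] _] := hloc.
exists p, lambda; split; first exact: Yp.
split; first exact: hl.
split; first exact: eqs.
split; first exact: eql.
split; first exact: ap.
split; apply: aeW => x _; first exact: lt.
by move=> h; rewrite gt// /dstress dmreg_gt.
Qed.
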